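(* Let $S$ be a Damek--Ricci space, with right Haar measure $\rho$ and left-invariant Riemannian distance $d$. Then $(S,\rho,d)$ is a Calderón--Zygmund space, i.e. there exist a family $\mathcal R$ of subsets of $S$ and a positive constant $\kappa_0$ such that $(S,\rho,d)$ is a Calderón--Zygmund space with family of Calderón--Zygmund sets $\mathcal R$ and Calderón--Zygmund constant $\kappa_0$.
   Context: **Damek--Ricci spaces.** Let $\mathfrak n$ be a finite-dimensional real Lie algebra with inner product $\langle\cdot,\cdot\rangle$ and norm $|\cdot|$, and $\mathfrak n=\mathfrak v\oplus\mathfrak z$ an orthogonal decomposition with $[\mathfrak n,\mathfrak z]=\{0\}$, $[\mathfrak n,\mathfrak n]\subseteq\mathfrak z$. For $Z\in\mathfrak z$ define $J_Z:\mathfrak v\to\mathfrak v$ by $\langle J_ZX,Y\rangle=\langle Z,[X,Y]\rangle$. $\mathfrak n$ is of $H$-type if $|J_ZX|=|Z||X|$ for all $X\in\mathfrak v$, $Z\in\mathfrak z$ (the abelian case $\mathfrak v=\mathbb R^d$, $d\ge1$, $\mathfrak z=\{0\}$ is also allowed; it gives the ''$ax+b$-groups''). The harmonic extension (Damek--Ricci space) is the Lie group $S=\mathfrak v\times\mathfrak z\times\mathbb R^+$ with product $$(X,Z,a)(X',Z',a')=\big(X+a^{1/2}X',\,Z+aZ'+\tfrac12a^{1/2}[X,X'],\,aa'\big),$$ identity $e=(0,0,1)$. Its Lie algebra is $\mathfrak s=\mathfrak n\oplus\mathbb RH$, where $H$ is tangent to $t\mapsto(0,0,e^t)$ at $t=0$;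 the inner product of $\mathfrak n$ is extended to $\mathfrak s$ by making $H$ a unit vector orthogonal to $\mathfrak n$. $d$ is the distance of the left-invariant Riemannian metric on $S$ which agrees with this inner product at $e$. The right Haar measure is $d\rho(X,Z,a)=a^{-1}\,dX\,dZ\,da$. **Calderón--Zygmund spaces.** Let $(X,\mu,d)$ be a metric measured space, $\mathcal R$ a family of (measurable) subsets of $X$ and $\kappa_0>0$. $(X,\mu,d)$ is a Calderón--Zygmund space with constant $\kappa_0$ (and family $\mathcal R$ of Calderón--Zygmund sets) if: (i) for every $R\in\mathcal R$ there exists $r>0$ such that $R$ is contained in a ball of radius at most $\kappa_0r$ and $\mu(R^* )\le\kappa_0\,\mu(R)$, where $R^*=\{x\in X: d(x,R)<r\}$; (ii) for every $f\in L^1(\mu)$ and $\alpha>\kappa_0\|f\|_{L^1(\mu)}/\mu(X)$ ($\alpha>0$ if $\mu(X)=\infty$) there is a decomposition $f=g+\sum_{i\in\mathbb N}b_i$ such that: $|g|\le\kappa_0\alpha$ $\mu$-a.e.; each $b_i$ is supported in a set $R_i\in\mathcal R$ and $\int b_i\,d\mu=0$; $\|b_i\|_{L^1(\mu)}\le\kappa_0\,\alpha\,\mu(R_i)$ for all $i$; $\sum_i\mu(R_i)\le\kappa_0\|f\|_{L^1(\mu)}/\alpha$. *)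

(* Defs.v *)
From HB Require Import structures.
From mathcomp Require Import all_boot all_order all_algebra.
From mathcomp Require Import complex.
From mathcomp Require Import all_classical all_reals all_analysis.
From mathcomp Require Import measurable_realfun.
Import Order.TTheory GRing.Theory Num.Theory.
Import numFieldNormedType.Exports.
Import passmx (rVof, vecof).

Set Implicit Arguments.
Unset Strict Implicit.
Unset Printing Implicit Defensive.

Local Open Scope classical_set_scope.
Local Open Scope ring_scope.

Section complex_functions.
Context d (T : measurableType d) (R : realType) (mu : {measure set T -> \bar R}).
Implicit Type f : T -> R[i].

Definition cmeasurable f : Prop :=
  measurable_fun setT (fun x => complex.Re (f x)) /\
  measurable_fun setT (fun x => complex.Im (f x)).

Definition cintegrable f : Prop :=
  mu.-integrable setT (fun x => (complex.Re (f x))%:E) /\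
  mu.-integrable setT (fun x => (complex.Im (f x))%:E).

Definition cintegral f : R[i] :=
  Complex (\int[mu]_x complex.Re (f x)) (\int[mu]_x complex.Im (f x)).

Definition cL1norm f : \bar R := (\int[mu]_x (Normc.normc (f x))%:E)%E.

End complex_functions.

Section metric.
Context (R : realType) (T : Type) (dist : T -> T -> R).

Record is_distance : Prop := IsDistance {
  distance_ge0 : forall x y, 0 <= dist x y ;
  distance_eq0 : forall x y, dist x y = 0 <-> x = y ;
  distanceC : forall x y, dist x y = dist y x ;
  distance_triangle : forall x y z, dist x z <= dist x y + dist y z }.

Definition dball (x : T) (r : R) : set T := [set y | dist x y < r].

Definition dopen (A : set T) : Prop :=
  forall x, A x -> exists2 e : R, 0 < e & dball x e `<=` A.

Definition dist_to_set (x : T) (A : set T) : \bar R :=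
  ereal_inf [set (dist x y)%:E | y in A].

(** [R^*] in the literature on Calderon-Zygmund sets. *)
Definition enlargement (A : set T) (r : R) : set T :=
  [set x | (dist_to_set x A < r%:E)%E].

End metric.

Section calderon_zygmund.
Local Open Scope ereal_scope.
Context d (T : measurableType d) (R : realType) (mu : {measure set T -> \bar R}).
Variables (dist : T -> T -> R) (family : set (set T)) (kappa : R).

(** Functions are identified up to null sets, and the convergence of the series
    is pointwise almost everywhere; under [cz_bad_norm] and [cz_sets_measure] it
    then converges absolutely almost everywhere and in [L^1]. *)
Record cz_decomposition (f : T -> R[i]) (alpha : R) (g : T -> R[i])
    (b : nat -> T -> R[i]) (Rs : nat -> set T) : Prop := CZDecomposition {
  cz_good_measurable : cmeasurable g ;
  cz_bad_integrable : forall i, cintegrable mu (b i) ;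
  cz_sum : {ae mu, forall x,
    (fun N => (g x + \sum_(i < N) b i x)%R) @ \oo --> (f x : R[i]^o)} ;
  cz_good_bounded :
    {ae mu, forall x, (Normc.normc (g x) <= kappa * alpha)%R} ;
  cz_sets_family : forall i, family (Rs i) ;
  cz_bad_support : forall i x, ~ Rs i x -> b i x = 0%R ;
  cz_bad_mean0 : forall i, cintegral mu (b i) = 0%R ;
  cz_bad_norm : forall i, cL1norm mu (b i) <= (kappa * alpha)%:E * mu (Rs i) ;
  cz_sets_measure :
    \sum_(i <oo) mu (Rs i) <= kappa%:E * cL1norm mu f / alpha%:E }.

(** When [mu setT = +oo] the quotient in [cz_decomp] is [0], so that the
    condition reads [0 < alpha]. *)
Record is_calderon_zygmund_space : Prop := IsCalderonZygmundSpace {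
  cz_distance : is_distance dist ;
  cz_borel : forall A, dopen dist A -> measurable A ;
  cz_family_measurable : forall A, family A -> measurable A ;
  cz_family_ball : forall A, family A -> exists r : R, [/\ (0 < r)%R,
    (exists x (s : R), [/\ (0 < s)%R, (s <= kappa * r)%R & A `<=` dball dist x s])
    & mu (enlargement dist A r) <= kappa%:E * mu A] ;
  cz_decomp : forall f (alpha : R), cintegrable mu f ->
    kappa%:E * cL1norm mu f / mu setT < alpha%:E ->
    exists g b Rs, cz_decomposition f alpha g b Rs }.

End calderon_zygmund.

Record is_lie_bracket (R : realType) (n : lmodType R) (br : n -> n -> n) : Prop :=
  IsLieBracket {
    lie_linearl : forall y, linear (br^~ y) ;
    lie_linearr : forall x, linear (br x) ;
    lie_alternating : forall x, br x x = 0 ;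
    lie_jacobi : forall x y t,
      br x (br y t) + br y (br t x) + br t (br x y) = 0 }.

Record is_inner_product (R : realType) (n : lmodType R) (ip : n -> n -> R) : Prop :=
  IsInnerProduct {
    ip_scalarl : forall y, scalar (ip^~ y) ;
    ip_sym : forall x y, ip x y = ip y x ;
    ip_pos : forall x, x != 0 -> 0 < ip x x }.

Definition ipnorm (R : realType) (n : lmodType R) (ip : n -> n -> R) (x : n) : R :=
  Num.sqrt (ip x x).

(** The abelian case [z = 0] is included; only [n = 0] is excluded. The vector
    [J Z X] of [ht_J] is determined by the equation it satisfies. *)
Structure htypeAlgebra (R : realType) := HTypeAlgebra {
  ht_space :> vectType R ;
  ht_bracket : ht_space -> ht_space -> ht_space ;
  ht_ip : ht_space -> ht_space -> R ;
  ht_v : {vspace ht_space} ;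
  ht_z : {vspace ht_space} ;
  ht_lie : is_lie_bracket ht_bracket ;
  ht_inner : is_inner_product ht_ip ;
  ht_neq0 : (0 < \dim {:ht_space})%N ;
  ht_sum : (ht_v + ht_z)%VS = fullv ;
  ht_orthogonal : forall x y, x \in ht_v -> y \in ht_z -> ht_ip x y = 0 ;
  ht_central : forall x y, y \in ht_z -> ht_bracket x y = 0 ;
  ht_derived : forall x y, ht_bracket x y \in ht_z ;
  ht_J : exists J : ht_space -> ht_space -> ht_space,
    forall Z X, Z \in ht_z -> X \in ht_v ->
      [/\ J Z X \in ht_v,
          forall Y, Y \in ht_v -> ht_ip (J Z X) Y = ht_ip Z (ht_bracket X Y)
        & ipnorm ht_ip (J Z X) = ipnorm ht_ip Z * ipnorm ht_ip X] }.

Arguments ht_bracket {R} h.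
Arguments ht_ip {R} h.
Arguments ht_v {R} h.
Arguments ht_z {R} h.

Record damekRicci (R : realType) (L : htypeAlgebra R) := DR {
  dr_X : subvs_of (ht_v L) ;
  dr_Z : subvs_of (ht_z L) ;
  dr_a : {posnum R} }.

Section group.
Context (R : realType) (L : htypeAlgebra R).
Local Notation S := (damekRicci L).
Implicit Types p q : S.

(** [vsproj] only casts the bracket, which belongs to [ht_z L], into the
    corresponding subtype. *)
Definition dr_mul p q : S :=
  DR (dr_X p + Num.sqrt (dr_a p)%:num *: dr_X q)
     (dr_Z p + (dr_a p)%:num *: dr_Z q
      + (2^-1 * Num.sqrt (dr_a p)%:num) *:
          vsproj (ht_z L) (ht_bracket L (vsval (dr_X p)) (vsval (dr_X q))))
     ((dr_a p)%:num * (dr_a q)%:num)%:pos.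

Definition dr_one : S := DR 0 0 1%:pos.

Definition dr_inv p : S :=
  DR (- ((Num.sqrt (dr_a p)%:num)^-1 *: dr_X p))
     (- ((dr_a p)%:num^-1 *: dr_Z p))
     ((dr_a p)%:num^-1)%:pos.

Lemma dr_mul1p p : dr_mul dr_one p = p.
Proof.
have [bl _ _ _] := ht_lie L; case: p => X Z a; congr DR => /=.
- by rewrite sqrtr1 scale1r add0r.
- rewrite scale1r add0r (_ : ht_bracket L 0 _ = 0) ?linear0 ?scaler0 ?addr0//.
  by have := bl (vsval X) (-1) 0 0; rewrite scaler0 addr0 scaleN1r addNr.
- by apply: val_inj; rewrite /= mul1r.
Qed.

Lemma dr_mulVp p : dr_mul (dr_inv p) p = dr_one.
Proof.
have [bl _ alt _] := ht_lie L; case: p => X Z a; congr DR => /=.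
- by rewrite sqrtrV ?ge0// addNr.
- rewrite addNr add0r (_ : ht_bracket L _ _ = 0) ?linear0 ?scaler0//.
  have b0 : ht_bracket L 0 (vsval X) = 0.
    by have := bl (vsval X) (-1) 0 0; rewrite scaler0 addr0 scaleN1r addNr.
  by rewrite -scaleNr -[_ *: _]addr0 bl alt b0 scaler0 addr0.
- by apply: val_inj; rewrite /= mulVf.
Qed.

End group.

Section curves.
Context (R : realType).

Definition C1 (V : normedModType R) (c : R -> V) : Prop :=
  (forall t, derivable c t 1) /\ continuous (derive1 c).

(** Calculus in a finite-dimensional space is done in the coordinates given by
    a basis; the resulting notions do not depend on that basis. *)
Definition vC1 (V : vectType R) (c : R -> V) : Prop :=
  C1 (fun t => rVof (vbasis {:V}) (c t)).

Definition vderive (V : vectType R) (c : R -> V) (t : R) : V :=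
  vecof (vbasis {:V}) (derive1 (fun s => rVof (vbasis {:V}) (c s)) t).

Context (L : htypeAlgebra R).
Local Notation S := (damekRicci L).

Definition dr_C1 (g : R -> S) : Prop :=
  [/\ vC1 (fun t => dr_X (g t)), vC1 (fun t => dr_Z (g t))
    & C1 (fun t => (dr_a (g t))%:num : R^o)].

(** The norm at the identity of the tangent vector [X + Z + tau H], where [H],
    the velocity of [t |-> (0, 0, e^t)] at [0], is [(0, 0, 1)] in the
    coordinates of [S]. *)
Definition tangent_norm (X : subvs_of (ht_v L)) (Z : subvs_of (ht_z L)) (tau : R) : R :=
  Num.sqrt (ht_ip L (vsval X + vsval Z) (vsval X + vsval Z) + tau ^+ 2).

(** The norm of the velocity of [g] at [t] for the left-invariant metric: the
    curve is translated so as to pass through the identity at time [t]. *)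
Definition dr_speed (g : R -> S) (t : R) : R :=
  let h s := dr_mul (dr_inv (g t)) (g s) in
  tangent_norm (vderive (fun s => dr_X (h s)) t)
               (vderive (fun s => dr_Z (h s)) t)
               (derive1 (fun s => (dr_a (h s))%:num : R^o) t).

Definition dr_length (g : R -> S) : R :=
  \int[lebesgue_measure]_(t in `[0, 1]) dr_speed g t.

(** Piecewise [C^1] curves are finite chains of [C^1] arcs, each of which is
    parametrized by [[0, 1]]. *)
Fixpoint dr_joins (p : S) (c : seq (R -> S)) (q : S) : Prop :=
  if c is g :: c' then [/\ dr_C1 g, g 0 = p & dr_joins (g 1) c' q] else p = q.

Definition dr_dist (p q : S) : R :=
  inf [set \sum_(g <- c) dr_length g | c in [set c | dr_joins p c q]].

End curves.

Section lebesgue_cons.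
Context (R : realType) (n : nat).
Local Notation Rm := (measurableTypeR R).
Variable m : {sigma_finite_measure set (n.-tuple Rm) -> \bar R}.
Local Open Scope ereal_scope.

Definition tuple_consp (p : Rm * n.-tuple Rm) : n.+1.-tuple Rm :=
  [the n.+1.-tuple Rm of p.1 :: p.2].

Lemma measurable_tuple_consp : measurable_fun setT tuple_consp.
Proof. exact: measurable_cons. Qed.

(** The product of the Lebesgue measure on the first coordinate and of [m] on
    the others. *)
Definition lebesgue_cons : set (n.+1.-tuple Rm) -> \bar R :=
  pushforward (lebesgue_measure \x m) tuple_consp.

Let lebesgue_cons_measure : {measure set (n.+1.-tuple Rm) -> \bar R} :=
  measure_function_pushforward__canonical__measure_function_Measure
    (lebesgue_measure \x m) measurable_tuple_consp.

Let lebesgue_cons0 : lebesgue_cons set0 = 0.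
Proof. exact: (measure0 lebesgue_cons_measure). Qed.

Let lebesgue_cons_ge0 A : 0 <= lebesgue_cons A.
Proof. exact: (measure_ge0 lebesgue_cons_measure). Qed.

Let lebesgue_cons_sigma_additive : semi_sigma_additive lebesgue_cons.
Proof. exact: (@measure_semi_sigma_additive _ _ _ lebesgue_cons_measure). Qed.

HB.instance Definition _ := isMeasure.Build _ _ _ lebesgue_cons
  lebesgue_cons0 lebesgue_cons_ge0 lebesgue_cons_sigma_additive.

Let lebesgue_cons_sigma_finite : sigma_finite setT lebesgue_cons.
Proof.
have /sigma_finiteP[F [FT ndF Ffin]] := sigma_finiteT (@lebesgue_measure R).
have /sigma_finiteP[G [GT ndG Gfin]] := sigma_finiteT m.
pose f (t : n.+1.-tuple Rm) : Rm * n.-tuple Rm := (thead t, [tuple of behead t]).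
have consK : cancel tuple_consp f.
  by case=> x t; rewrite /f /tuple_consp theadE; congr pair; apply: val_inj.
have mf : measurable_fun setT f.
  apply/measurable_fun_pairP; split; first exact: measurable_tnth.
  exact: measurable_behead.
exists (fun i => f @^-1` (F i `*` G i)).
  apply/esym/seteqP; split=> // t _.
  have [i _ Fi] : (\bigcup_i F i) (f t).1 by rewrite -FT.
  have [j _ Gj] : (\bigcup_i G i) (f t).2 by rewrite -GT.
  exists (maxn i j) => //; split.
    by move: Fi; exact/subsetPset/ndF/leq_maxl.
  by move: Gj; exact/subsetPset/ndG/leq_maxr.
move=> i; have [mF Foo] := Ffin i; have [mG Goo] := Gfin i.
split; first by rewrite -[X in measurable X]setTI; apply: mf => //; exact: measurableX.
rewrite /lebesgue_cons /pushforward -comp_preimage.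
rewrite (_ : f \o tuple_consp = id); last by apply/funext => p /=; rewrite consK.
by rewrite preimage_id product_measure1E// lte_mul_pinfty// ge0_fin_numE.
Qed.

HB.instance Definition _ := Measure_isSigmaFinite.Build _ _ _ lebesgue_cons
  lebesgue_cons_sigma_finite.

End lebesgue_cons.

Fixpoint lebesgue_tuple (R : realType) n :
    {sigma_finite_measure set (n.-tuple (measurableTypeR R)) -> \bar R} :=
  if n is n'.+1 then lebesgue_cons (lebesgue_tuple R n') else \d_([tuple] : 0.-tuple _).

Section haar.
Context (R : realType) (L : htypeAlgebra R).
Local Notation S := (damekRicci L).
Local Notation Rm := (measurableTypeR R).
Local Notation m := (\dim {:subvs_of (ht_v L)}).
Local Notation k := (\dim {:subvs_of (ht_z L)}).

HB.instance Definition _ := gen_eqMixin S.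
HB.instance Definition _ := gen_choiceMixin S.
HB.instance Definition _ := isPointed.Build S (dr_one L).

Definition vtuple (V : vectType R) (x : V) : (\dim {:V}).-tuple Rm :=
  [tuple coord (vbasis {:V}) i x | i < \dim {:V}].

Definition dr_coord (p : S) : m.-tuple Rm * k.-tuple Rm * Rm :=
  (vtuple (dr_X p), vtuple (dr_Z p), (dr_a p)%:num).

(** The Borel sets of [S] are those of the half-space of its coordinates. *)
Let dr_measurable : set (set S) := preimage_set_system setT dr_coord measurable.

Let sigma_algebra_dr : sigma_algebra setT dr_measurable.
Proof. exact/sigma_algebra_preimage/sigma_algebra_measurable. Qed.

Let dr_measurable0 : dr_measurable set0.
Proof. by case: sigma_algebra_dr. Qed.

Let dr_measurableC A : dr_measurable A -> dr_measurable (~` A).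
Proof. by case: sigma_algebra_dr => _ + _ => /[apply]; rewrite setTD. Qed.

Let dr_measurable_bigcup (F : (set S)^nat) :
  (forall i, dr_measurable (F i)) -> dr_measurable (\bigcup_i F i).
Proof. by case: sigma_algebra_dr => _ _; exact. Qed.

HB.instance Definition _ := @isMeasurable.Build default_measure_display S
  dr_measurable dr_measurable0 dr_measurableC dr_measurable_bigcup.

(** The measure [a^-1 dX dZ da], where [dX] and [dZ] are the Lebesgue measures in
    the coordinates given by the bases of [ht_v L] and [ht_z L]. Other bases give
    the same measure up to a constant factor, to which the notion of
    Calderon-Zygmund space is insensitive. *)
Definition dr_haar (A : set S) : \bar R :=
  (\int[lebesgue_tuple R m \x lebesgue_tuple R k \x lebesgue_measure]_(p in dr_coord @` A)
    ((p.2 : R)^-1)%:E)%E.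


Lemma vtuple_inj (V : vectType R) : injective (@vtuple V).
Proof.
move=> x y xy; rewrite (coord_vbasis (memvf x)) (coord_vbasis (memvf y)).
apply: eq_bigr => i _; congr (_ *: _).
by have := congr1 (fun t => tnth t i) xy; rewrite /= !tnth_mktuple.
Qed.

Lemma vtuple_surj (V : vectType R) (t : (\dim {:V}).-tuple Rm) :
  exists x, vtuple x = t.
Proof.
exists (\sum_i tnth t i *: (vbasis {:V})`_i).
apply: eq_from_tnth => i; rewrite tnth_mktuple coord_sum_free//.
exact: basis_free (vbasisP _).
Qed.

Lemma dr_coord_inj : injective dr_coord.
Proof.
move=> [X Z a] [X' Z' a'] pp'; congr DR.
- exact/vtuple_inj/(congr1 (fun p => p.1.1) pp').
- exact/vtuple_inj/(congr1 (fun p => p.1.2) pp').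
- exact/val_inj/(congr1 snd pp').
Qed.

Lemma range_dr_coord : range dr_coord = [set p | 0 < p.2].
Proof.
apply/seteqP; split=> [_ [p _ <-]/=|[[x z] a]/= a0]; first exact: gt0.
have [X Xx] := vtuple_surj x; have [Z Zz] := vtuple_surj z.
by exists (DR X Z (PosNum a0)) => //; rewrite /dr_coord Xx Zz.
Qed.

Lemma measurable_dr_half : measurable (range dr_coord).
Proof.
rewrite range_dr_coord (_ : [set _ | _] = snd @^-1` `]0, +oo[).
  by rewrite -[X in measurable X]setTI; exact: measurable_snd.
by apply/seteqP; split => p /=; rewrite in_itv/= andbT.
Qed.

Lemma measurable_dr_image (A : set S) : measurable A -> measurable (dr_coord @` A).
Proof.
move=> [B mB <-]; rewrite setTI (_ : _ @` _ = B `&` range dr_coord).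
  exact: measurableI measurable_dr_half.
apply/seteqP; split=> [_ [p Bp <-]|q [Bq [p _ pq]]]; first by split=> //; exists p.
by exists p; rewrite //= pq.
Qed.

Lemma measurable_dr_density (A : set S) :
  measurable_fun (dr_coord @` A) (fun p => (p.2 : R)^-1).
Proof.
apply: (@measurable_funS _ _ _ _ (range dr_coord)).
- exact: measurable_dr_half.
- exact: image_subset.
apply: (@measurable_comp _ _ _ _ Rm R `]0, +oo[%classic (@GRing.inv R) _ snd).
- exact: measurable_itv.
- by move=> _ [_ [p _ <-] <-] /=; rewrite in_itv/= andbT.
- apply: open_continuous_measurable_fun; first exact: interval_open.
  by move=> x; rewrite inE/= in_itv/= andbT => x0; apply: inv_continuous; rewrite gt_eqF.
- by apply: measurable_funTS; exact: measurable_snd.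
Qed.

Local Open Scope ereal_scope.

Let dr_haar0 : dr_haar set0 = 0.
Proof. by rewrite /dr_haar image_set0 integral_set0. Qed.

Let dr_haar_ge0 A : 0 <= dr_haar A.
Proof.
apply: integral_ge0 => _ [p _ <-] /=.
by rewrite lee_fin.
Qed.

Let dr_haar_sigma_additive : semi_sigma_additive dr_haar.
Proof.
move=> F mF tF mUF; rewrite /dr_haar image_bigcup ge0_integral_bigcup//.
- apply: is_cvg_ereal_nneg_natsum => i _; exact: dr_haar_ge0.
- by move=> i; exact: measurable_dr_image.
- rewrite -image_bigcup; apply/measurable_EFinP; exact: measurable_dr_density.
- by move=> _ [i _ [p _ <-]] /=; rewrite lee_fin.
- apply/trivIsetP => i j _ _ ij; apply/seteqP; split=> // _ [[p Fp <-] [q Fq]].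
  move=> /dr_coord_inj qp; move/trivIsetP : tF => /(_ _ _ I I ij) Fij.
  have : (F i `&` F j) p by split=> //; rewrite -qp.
  by rewrite Fij.
Qed.

HB.instance Definition _ := isMeasure.Build _ _ _ dr_haar
  dr_haar0 dr_haar_ge0 dr_haar_sigma_additive.

End haar.

(* Main.v *)
(** Nested countable partitions of [S] into Calderon-Zygmund sets carry the
    classical stopping-time argument: a tile of generation [n + 1] has a measure
    at least [1 / N] times that of its parent, and the sets of the decomposition
    are the first tiles on which the average of [|f|] exceeds [alpha].

    A tile at height [s = ln a] is a product of dyadic intervals in the
    coordinates of [X], of [Z - phi X] and in [s]. As the lengths of its sides
    range between [h e^h] and [4 h e^(6 h)] (up to the factors [e^(s/2)] and
    [e^s]), where [h] is its length in the direction of [s], it lies in a ball of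
    radius [O(h)] and its [h]-enlargement has measure comparable to its own:
    this is the exponential growth that defeats the doubling property for balls.
    The function [phi] straightens the bracket at all scales at once: on a dyadic
    cube of side [p] with corner [X0] it differs from the linear function
    [X |-> [X0, X] / 2] by a constant up to an error [O(p^2)], so that the tiles
    are close to left translates of boxes at the origin and yet are nested. *)

Require Import Defs.
From HB Require Import structures.
From mathcomp Require Import all_boot all_order all_algebra.
From mathcomp Require Import complex unstable.
From mathcomp Require Import all_classical all_reals all_analysis.
From mathcomp Require Import measurable_realfun.
From mathcomp Require Import ring lra.
Import Order.TTheory GRing.Theory Num.Theory.
Import numFieldNormedType.Exports.
Import passmx (rVof, vecof).

Set Implicit Arguments.
Unset Strict Implicit.
Unset Printing Implicit Defensive.

Local Open Scope classical_set_scope.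
Local Open Scope ring_scope.

(** * Calderon-Zygmund decomposition along a filtration *)

(** No covering lemma or differentiation theorem for balls is used. Maximal cells are disjoint by
    nestedness, and the good part is bounded almost everywhere by approximating sets from outside by
    unions of cells. The stopping time also needs a start: no top tile may stop, so top tiles must
    have measure at least [||f|| / alpha], and the filtration depends on [f] and [alpha] through its
    top height [H]. The family may not depend on them; it therefore consists of all measurable sets
    that satisfy condition (i) with a fixed constant, and all estimates on tiles are uniform in [H].

    The window for the sides must survive halving. A displacement by [h] moves the coordinates,
    rescaled to height 0, by [h e^h] and [h e^(3 h)] up to constants, which dictates the lower
    bounds. The height is halved once both sides are less than twice these bounds, and [2 h e^(3 h)]
    is [4 h' e^(6 h')] for [h' = h / 2]: hence the exponent 6. Sides that long still fit in a ball
    of radius [O(h)] because horizontal displacements are exponentially cheaper higher up. *)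

Section nested_partitions.
Context d (T : measurableType d) (R : realType) (mu : {measure set T -> \bar R}).
Context (K : countType) (lev : nat -> T -> K).
Hypothesis mlev : forall n i, measurable [set x | lev n x = i].
Hypothesis nest : forall n x y, lev n.+1 x = lev n.+1 y -> lev n x = lev n y.

Definition cell n x : set T := [set y | lev n y = lev n x].

Lemma measurable_cell n x : measurable (cell n x).
Proof. exact: mlev. Qed.

Lemma lev_nested m n x y : (m <= n)%N -> lev n x = lev n y -> lev m x = lev m y.
Proof.
move=> /subnKC <-; elim: (n - m)%N => [|k ih]; first by rewrite addn0.
by rewrite addnS => /nest/ih.
Qed.

Lemma sub_cell m n x : (m <= n)%N -> cell n x `<=` cell m x.
Proof. by move=> mn y; exact: lev_nested. Qed.

Section stopping.
Variable P : nat -> K -> Prop.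

Definition stops_at n x := P n (lev n x) /\ forall m, (m < n)%N -> ~ P m (lev m x).

Definition stopped : set T := [set x | exists n, P n (lev n x)].

(** Indexed by the codes of pairs (generation, label), so that the maximal cells form a sequence of
    disjoint sets; a code of no pair, or of a cell that does not stop, gives the empty set. *)
Definition stop_piece k : set T :=
  if pickle_inv k is Some ni then [set x | lev ni.1 x = ni.2 /\ stops_at ni.1 x]
  else set0.

Lemma stops_at_cell n x y : cell n x y -> stops_at n x -> stops_at n y.
Proof.
move=> xy [Px nP]; split; first by rewrite xy.
by move=> m mn; rewrite (lev_nested (ltnW mn) xy); exact: nP.
Qed.

Lemma stop_pieceP k :
  stop_piece k = set0 \/ exists n x, stop_piece k = cell n x /\ stops_at n x.
Proof.
rewrite /stop_piece; case: pickle_inv => [[n i]/=|]; last by left.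
have [[x [xi Px]]|nx] := pselect (exists x, lev n x = i /\ stops_at n x); last first.
  by left; apply/seteqP; split=> // x xP; apply: nx; exists x.
right; exists n, x; split=> //; apply/seteqP; split=> [y [yi _]|y yx].
  by rewrite /cell/= yi xi.
by split; [rewrite yx|exact: stops_at_cell yx Px].
Qed.

Lemma measurable_stop_piece k : measurable (stop_piece k).
Proof.
by have [->|[n [x [-> _]]]] := stop_pieceP k; [exact: measurable0|exact: mlev].
Qed.

Lemma bigcup_stop_piece : \bigcup_k stop_piece k = stopped.
Proof.
apply/seteqP; split=> [x [k _]|x [n Pn]].
  by rewrite /stop_piece; case: pickle_inv => [[n i]/= [_ [? _]]|//]; exists n.
have exP : exists n, `[< P n (lev n x) >] by exists n; exact/asboolP.
case: (ex_minnP exP) => m /asboolP Pm minm.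
exists (pickle (m, lev m x)) => //; rewrite /stop_piece pickleK_inv/=; split=> //; split=> // l lm Pl.
by have := minm l (asboolT Pl); rewrite leqNgt lm.
Qed.

Lemma trivIset_stop_piece : trivIset setT stop_piece.
Proof.
move=> k l _ _ [x []]; rewrite /stop_piece.
have := @pickle_invK (nat * K)%type k; have := @pickle_invK (nat * K)%type l.
case: (pickle_inv k) => [[n i]/=|//]; case: (pickle_inv l) => [[m j]/=|//] <- <-.
move=> [<- [Pn nP]] [<- [Pm mP]]; suff nm : n = m.
  exact: (congr1 (fun n => pickle (n, lev n x)) nm).
case: (ltngtP n m) => [/mP/(_ Pn) []|/nP/(_ Pm) []|]; exact: id.
Qed.

Lemma measurable_stopped : measurable stopped.
Proof.
by rewrite -bigcup_stop_piece; apply: bigcupT_measurable => k; exact: measurable_stop_piece.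
Qed.

Lemma stop_piece_integral_le (F G : T -> \bar R) : measurable_fun setT F ->
  measurable_fun setT G -> (forall x, 0 <= F x)%E -> (forall x, 0 <= G x)%E ->
  (forall n x, stops_at n x ->
    \int[mu]_(y in cell n x) F y <= \int[mu]_(y in cell n x) G y)%E ->
  (\int[mu]_(y in stopped) F y <= \int[mu]_(y in stopped) G y)%E.
Proof.
move=> mF mG F0 G0 FG; rewrite -bigcup_stop_piece.
rewrite !ge0_integral_bigcup//; try exact: measurable_stop_piece;
  try exact: trivIset_stop_piece; try exact: measurable_funTS.
apply: lee_nneseries => [k _ _|k _]; first by apply: integral_ge0 => x _.
have [->|[n [x [-> nx]]]] := stop_pieceP k; first by rewrite !integral_set0.
exact: FG.
Qed.

End stopping.

(** The topology that has the cells as a basis. It refines that of the distance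
    ([dr_dopen_cell_open]), and its cells are both open and closed. *)
Definition cell_open (U : set T) : Prop := forall x, U x -> exists n, cell n x `<=` U.

(** Stopping at the first cell contained in [U] writes [U] as a countable union of cells. *)
Lemma cell_open_gen U : cell_open U -> <<s [set A | exists n x, A = cell n x] >> U.
Proof.
set G := [set A | _]; move=> oU.
have [G0 _ Gcup] := smallest_sigma_algebra setT G.
pose P n i := (forall y, lev n y = i -> U y) /\ exists y, lev n y = i.
have -> : U = stopped P.
  apply/seteqP; split=> [x /oU[n nU]|x [n [+ _]]]; last exact.
  by exists n; split=> [y yx|]; [exact: nU|exists x].
rewrite -bigcup_stop_piece; apply: Gcup => i.
have [->|[n [x [-> _]]]] := stop_pieceP P i; first exact: G0.
by apply: sub_gen_smallest; exists n, x.
Qed.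

Lemma cell_open_measurable U : cell_open U -> measurable U.
Proof.
move=> /cell_open_gen; apply: smallest_sub; first exact: sigma_algebra_measurable.
by move=> _ [n [x ->]]; exact: measurable_cell.
Qed.

Lemma cell_openT : cell_open setT.
Proof. by move=> x _; exists 0%N. Qed.

Lemma cell_openI U V : cell_open U -> cell_open V -> cell_open (U `&` V).
Proof.
move=> oU oV x [/oU[n nU] /oV[m mV]]; exists (maxn n m) => y yx; split.
  by apply: nU; apply: sub_cell yx; exact: leq_maxl.
by apply: mV; apply: sub_cell yx; exact: leq_maxr.
Qed.

Lemma cell_open_bigcup (U : (set T)^nat) :
  (forall k, cell_open (U k)) -> cell_open (\bigcup_k U k).
Proof.
move=> oU x [k _ /oU[n nU]]; exists n => y /nU Uy; exact: bigcup_sup Uy.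
Qed.

Lemma cell_openC_cell n x : cell_open (~` cell n x).
Proof. by move=> y yx; exists n => z zy zx; apply: yx; rewrite /cell/= -zy. Qed.

(** * Regularity of the measure with respect to unions of cells *)

Section regular.
Variables (Q : set T).
Hypotheses (mQ : measurable Q) (Qoo : (mu Q < +oo)%E).

(** Inner and outer regularity are asked together, to be stable under complement, and inside a set
    [Q] of finite measure, to have continuity from above in countable unions. *)
Definition cell_regular (A : set T) : Prop := forall e : R, 0 < e ->
  exists F U, [/\ cell_open U, cell_open (~` F), F `<=` A, A `<=` U
                & (mu (Q `&` (U `\` F)) <= e%:E)%E].

Lemma cell_regularC A : cell_regular A -> cell_regular (~` A).
Proof.
move=> rA e /rA[F [U [oU oF FA AU UFe]]]; exists (~` U), (~` F).
rewrite setCK; split=> //; [exact: subsetC|exact: subsetC|].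
by rewrite [_ `\` _]setDE setCK (setIC (~` F)) -setDE.
Qed.

Lemma cell_regular_bigcup (A : (set T)^nat) :
  (forall k, cell_regular (A k)) -> cell_regular (\bigcup_k A k).
Proof.
move=> rA e e0.
have e2 k : 0 < e / 2 / (2 ^ k.+1)%:R by rewrite !divr_gt0// ltr0n expn_gt0.
have /choice[FU FUP] : forall k, exists FU : set T * set T,
    [/\ cell_open FU.2, cell_open (~` FU.1), FU.1 `<=` A k, A k `<=` FU.2
      & (mu (Q `&` (FU.2 `\` FU.1)) <= (e / 2 / (2 ^ k.+1)%:R)%:E)%E].
  by move=> k; have [F [U FU]] := rA k _ (e2 k); exists (F, U).
pose F k := (FU k).1; pose U k := (FU k).2.
(* The union of all the closed sets [F k] need not be closed. Finitely many are kept; the remainder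
   [D N] decreases to the empty set inside [Q], so its measure tends to 0. *)
pose FN N := \bigcup_(k < N) F k.
have oFN N : cell_open (~` FN N).
  elim: N => [|N ih]; first by rewrite /FN bigcup_mkord big_ord0 setC0; exact: cell_openT.
  rewrite /FN bigcup_mkord big_ord_recr/= setCU -bigcup_mkord.
  by apply: cell_openI => //; have [] := FUP N.
have mF k : measurable (F k).
  by rewrite -[F k]setCK; apply: measurableC; apply: cell_open_measurable; have [] := FUP k.
have mFN N : measurable (FN N).
  by rewrite -[FN N]setCK; apply: measurableC; exact: cell_open_measurable.
have mU k : measurable (U k) by apply: cell_open_measurable; have [] := FUP k.
pose D N := Q `&` (\bigcup_k F k `\` FN N).
have mD N : measurable (D N).
  by apply: measurableI => //; apply: measurableD => //; exact: bigcupT_measurable.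
have cD : mu (D N) @[N --> \oo] --> mu (\bigcap_N D N).
  apply: nonincreasing_cvg_mu => //.
  - by apply: le_lt_trans Qoo; apply: le_measure; rewrite ?inE//; exact: subIsetl.
  - exact: bigcapT_measurable.
  - move=> N M NM; apply/subsetPset => x [Qx [Fx FMx]]; split=> //; split=> // -[k kN Fk].
    by apply: FMx; exists k => //=; exact: leq_trans NM.
have D0 : \bigcap_N D N = set0.
  apply/seteqP; split=> // x Dx; have [_ [[k _ Fk] _]] := Dx 0%N I.
  by have [_ [_]] := Dx k.+1 I; apply; exists k => /=.
have [N DN] : exists N, (mu (D N) <= (e / 2)%:E)%E.
  move: cD; rewrite D0 measure0 => /fine_cvgP[fD /cvgrPdist_le/(_ (e / 2))].
  rewrite divr_gt0// => /(_ isT) {}cD.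
  near \oo => N; exists N.
  rewrite -(@fineK _ (mu (D N))) ?lee_fin; last by near: N.
  have : `|0 - fine (mu (D N))| <= e / 2 by near: N.
  by rewrite sub0r normrN; exact: le_trans (ler_norm _).
exists (FN N), (\bigcup_k U k); split=> //.
- by apply: cell_open_bigcup => k; have [] := FUP k.
- by move=> x [k _ Fx]; exists k => //; have [_ _ + _ _] := FUP k; exact.
- by move=> x [k _ Ax]; exists k => //; have [_ _ _ + _] := FUP k; exact.
apply: (@le_trans _ _ (mu (\bigcup_k (Q `&` (U k `\` F k)) `|` D N))).
  apply: le_measure; rewrite ?inE//.
  - apply: measurableI => //; apply: measurableD => //; exact: bigcupT_measurable.
  - apply: measurableU => //; apply: bigcupT_measurable => k.
    by apply: measurableI => //; exact: measurableD.
  - move=> x [Qx [[k _ Ux] FNx]].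
    have [[j _ Fj]|nF] := pselect ((\bigcup_k F k) x); first by right; split=> //; split=> //; exists j.
    by left; exists k => //; split=> //; split=> // Fk; apply: nF; exists k.
rewrite (splitr e) EFinD (le_trans (measureU2 _ _ _))//.
  apply: bigcupT_measurable => k.
  by apply: measurableI => //; exact: measurableD.
rewrite leeD//.
apply: (@le_trans _ _ (\sum_(k <oo) mu (Q `&` (U k `\` F k)))%E).
  apply: measure_sigma_subadditive => //.
    by move=> k; apply: measurableI => //; exact: measurableD.
  apply: bigcupT_measurable => k.
  by apply: measurableI => //; exact: measurableD.
apply: le_trans (epsilon_trick0 xpredT _); last by rewrite divr_ge0// ltW.
by apply: lee_nneseries => // k _; have [] := FUP k.
Unshelve. all: by end_near. Qed.

Lemma cell_regular_cell n x : cell_regular (cell n x).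
Proof.
move=> e e0; exists (cell n x), (cell n x); split=> //.
- by move=> y yx; exists n => z; rewrite /cell/= yx.
- exact: cell_openC_cell.
- by rewrite setDv setI0 measure0 lee_fin ltW.
Qed.

Lemma cell_regular_gen A : <<s [set A | exists n x, A = cell n x] >> A -> cell_regular A.
Proof.
apply: smallest_sub => [|_ [n [x ->]]]; last exact: cell_regular_cell.
split=> [e e0|B rB|B rB].
- exists set0, set0; rewrite setC0 setD0 setI0 measure0 lee_fin ltW//; split=> //.
  exact: cell_openT.
- by rewrite setTD; exact: cell_regularC.
- exact: cell_regular_bigcup.
Qed.

End regular.
End nested_partitions.

(** * Differentiation along cells and the stopping-time decomposition *)

Section calderon_zygmund_filtration.
Context d (T : measurableType d) (R : realType) (mu : {measure set T -> \bar R}).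
Context (K : countType) (lev : nat -> T -> K).
Hypothesis mlev : forall n i, measurable [set x | lev n x = i].
Hypothesis nest : forall n x y, lev n.+1 x = lev n.+1 y -> lev n x = lev n y.
Hypothesis fin_cell : forall n x, (mu (cell lev n x) < +oo)%E.
Hypothesis gen_cell :
  (@measurable _ T) `<=` <<s [set A | exists n x, A = cell lev n x] >>.

Lemma integrable_cst_fin (A : set T) (k : R) :
  measurable A -> (mu A < +oo)%E -> mu.-integrable A (EFin \o cst k).
Proof.
move=> mA Aoo; apply: measurable_bounded_integrable => //.
by exists `|k|; split; [exact: num_real|move=> M kM x _; exact: ltW].
Qed.

(** Stands in for Lebesgue differentiation. If [A] is the part of [D] in a cell where [F] exceeds
    [alpha], the maximal cells that meet [A] inside an open neighbourhood of [A] have averages at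
    most [alpha]; letting the neighbourhood shrink bounds the integral of [F] on [A] by [alpha]
    times the measure of [A], so [A] is null. *)
Lemma ae_le_of_cell_integral_le (F : T -> R) (alpha : R) (D : set T) :
  mu.-integrable setT (EFin \o F) -> (forall x, 0 <= F x) -> 0 <= alpha -> measurable D ->
  (forall n x, D x -> \int[mu]_(y in cell lev n x) (F y)%:E <= alpha%:E * mu (cell lev n x))%E ->
  {ae mu, forall x, D x -> F x <= alpha}.
Proof.
move=> iF F0 alpha0 mD DF.
have mF : measurable_fun setT F by apply/measurable_EFinP; case/integrableP : iF.
pose B := D `&` [set x | alpha < F x].
have mB : measurable B.
  apply: measurableI => //; rewrite -[X in measurable X]setTI.
  by apply: measurable_fun_ltr.
have mc n x : measurable (cell lev n x) by exact: measurable_cell.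
suff Bnull n x : mu.-negligible (cell lev n x `&` B).
  apply: (@negligibleS _ _ _ _ B).
    by move=> x /= /not_implyP[Dx /negP]; rewrite -ltNge; split.
  (* Stopping everywhere at generation 0 cuts [B] into countably many pieces, each contained in a
     cell of finite measure. *)
  pose P (n : nat) (i : K) := n = 0%N.
  rewrite (_ : B = \bigcup_k (stop_piece lev P k `&` B)); last first.
    rewrite -setI_bigcupl bigcup_stop_piece//.
    by apply/seteqP; split=> [x Bx|x []//]; split=> //; exists 0%N.
  apply: negligible_bigcup => k.
  have [->|[m [x [-> _]]]] := stop_pieceP nest P k; last exact: Bnull.
  by rewrite set0I; exact: negligible_set0.
set Q := cell lev n x; set A := Q `&` B.
have mQ : measurable Q by exact: mc.
have mA : measurable A by exact: measurableI.
have Afin : (mu A < +oo)%E.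
  by apply: le_lt_trans (fin_cell n x); apply: le_measure; rewrite ?inE//; exact: subIsetl.
have AE : (\int[mu]_(y in A) (F y)%:E <= alpha%:E * mu A)%E.
  apply/lee_addgt0Pr => e e0.
  (* The excess measure is later multiplied by [alpha], which may be 0: hence the division by
     [alpha + 1]. *)
  have e'0 : 0 < e / (alpha + 1) by rewrite divr_gt0// ltr_wpDl.
  have [C [U [oU oC CA AU UCe]]] :=
    cell_regular_gen mlev nest mQ (fin_cell n x) (gen_cell mA) e'0.
  have mU := cell_open_measurable mlev nest oU.
  have mC : measurable C.
    by rewrite -[C]setCK; apply: measurableC; exact: cell_open_measurable oC.
  (* Only cells through a point of [A] are retained: such a point lies in [D], where the averages
     are under control. *)
  pose P m i := exists y, [/\ A y, lev m y = i & cell lev m y `<=` U `&` Q].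
  pose V := stopped lev P.
  have mV : measurable V by exact: measurable_stopped.
  have VU : V `<=` U `&` Q.
    by move=> y [m [z [_ zy]]]; apply; rewrite /cell/= zy.
  have AV : A `<=` V.
    move=> y Ay; have /oU[m mU'] := AU _ Ay; exists (maxn m n), y; split=> // z zy; split.
      by apply: mU'; apply: sub_cell zy => //; exact: leq_maxl.
    have := sub_cell nest (leq_maxr m n) zy; rewrite /Q /cell/= => ->.
    by case: Ay.
  have mVle : (mu V <= mu A + (e / (alpha + 1))%:E)%E.
    apply: (@le_trans _ _ (mu (A `|` (Q `&` (U `\` A))))%E).
      apply: le_measure; rewrite ?inE//.
        by apply: measurableU => //; apply: measurableI => //; exact: measurableD.
      move=> y /VU[Uy Qy]; have [Ay|nAy] := pselect (A y); first by left.
      by right.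
    apply: (le_trans (measureU2 _ _ _)) => //.
      by apply: measurableI => //; exact: measurableD.
    rewrite leeD2l//; apply: le_trans UCe; apply: le_measure; rewrite ?inE//.
    - by apply: measurableI => //; exact: measurableD.
    - by apply: measurableI => //; exact: measurableD.
    - by move=> y [Qy [Uy nA]]; split=> //; split=> // /CA.
  apply: (@le_trans _ _ (\int[mu]_(y in V) (F y)%:E)%E).
    apply: ge0_subset_integral => //; first exact/measurable_EFinP/measurable_funTS.
    by move=> y _; rewrite lee_fin.
  apply: (@le_trans _ _ (alpha%:E * mu V)%E); last first.
    rewrite (le_trans (lee_wpmul2l _ mVle))// ge0_muleDr ?lee_fin ?(ltW e'0)//.
    rewrite leeD2l// -EFinM lee_fin mulrCA ler_piMr// ?ltW//.
    by rewrite ltr_pdivrMr ?ltr_wpDl// mul1r ltrDl.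
  rewrite -(integral_cst mu mV alpha%:E); apply: stop_piece_integral_le => //.
  - exact/measurable_EFinP.
  - move=> m y [[z [[_ [Dz _]] zy _]] _].
    have := DF m z Dz; rewrite -(integral_cst mu (mc m z) alpha%:E).
    by rewrite /cell zy.
have iA : mu.-integrable A (EFin \o F) by exact: integrableS iF.
have iAa : mu.-integrable A (EFin \o cst alpha) by exact: integrable_cst_fin.
have : (\int[mu]_(y in A) `|(F y - alpha)%:E| = 0)%E.
  apply/eqP; rewrite eq_le; apply/andP; split; last exact: integral_ge0.
  rewrite (eq_integral (fun y => (F y)%:E - alpha%:E)%E); last first.
    move=> y; rewrite inE => -[_ [_ /= Fy]].
    by rewrite -EFinB/= ger0_norm// subr_ge0 ltW.
  rewrite (integralB_EFin mA iA iAa) sube_le0; apply: le_trans AE _.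
  by rewrite -(integral_cst mu mA).
move/ae_eq_integral_abs => /(_ mA) [].
  by apply/measurable_EFinP; apply: measurable_funB => //; exact: measurable_funTS.
move=> N [mN N0 NA]; exists N; split=> // y [Qy [Dy Fy]]; apply: NA => /=.
apply/not_implyP; split; first by split.
by move=> [/eqP]; rewrite subr_eq0 => /eqP Fa; move: Fy => /=; rewrite Fa ltxx.
Qed.

Lemma normc_ge_abs (z : R[i]) : `|complex.Re z| <= Normc.normc z /\ `|complex.Im z| <= Normc.normc z.
Proof.
case: z => a b /=; rewrite -!sqrtr_sqr; split; apply: ler_wsqrtr.
  by rewrite lerDl sqr_ge0.
by rewrite lerDr sqr_ge0.
Qed.

Lemma normc_le_abs (z : R[i]) : Normc.normc z <= `|complex.Re z| + `|complex.Im z|.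
Proof.
case: z => a b /=; rewrite -[leRHS]ger0_norm ?addr_ge0// -sqrtr_sqr ler_wsqrtr//.
by rewrite sqrrD !real_normK ?num_real// lerD2r lerDl mulrn_wge0// mulr_ge0.
Qed.

Lemma measurable_normc (f : T -> R[i]) : cmeasurable f ->
  measurable_fun setT (fun x => Normc.normc (f x)).
Proof.
move=> [mRe mIm].
rewrite (_ : (fun x => _) = (fun x => Num.sqrt (complex.Re (f x) ^+ 2 + complex.Im (f x) ^+ 2))).
  apply: measurableT_comp; last by apply: measurable_funD; exact: measurable_funX.
  by apply: continuous_measurable_fun; exact: sqrt_continuous.
by apply/funext => x; case: (f x).
Qed.

Lemma integrable_normc (f : T -> R[i]) : cintegrable mu f ->
  mu.-integrable setT (EFin \o (fun x => Normc.normc (f x))).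
Proof.
move=> [iRe iIm].
apply: (@le_integrable _ _ _ _ _ measurableT _
  (EFin \o (fun x => `|complex.Re (f x)| + `|complex.Im (f x)|))) => //.
- apply/measurable_EFinP; apply: measurable_normc; split; apply/measurable_EFinP.
    by case/integrableP : iRe.
  by case/integrableP : iIm.
- move=> x _ /=; rewrite lee_fin [leRHS]ger0_norm ?addr_ge0// ger0_norm; first exact: normc_le_abs.
  by case: (f x) => a b /=; exact: sqrtr_ge0.
- rewrite (_ : _ \o _ = (EFin \o (fun x => `|complex.Re (f x)|)%R) \+
      (EFin \o (fun x => `|complex.Im (f x)|)%R))%E//.
  by apply: integrableD => //; [exact: (integrable_norm iRe)|exact: (integrable_norm iIm)].
Qed.

Lemma average_bound (u F : T -> R) (A : set T) (M : R) :
  mu.-integrable setT (EFin \o u) -> mu.-integrable setT (EFin \o F) ->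
  (forall x, `|u x| <= F x) -> measurable A -> (mu A < +oo)%E ->
  \int[mu]_(x in A) F x <= M * fine (mu A) -> 0 <= M ->
  let c := \int[mu]_(x in A) u x / fine (mu A) in
  [/\ mu.-integrable setT (EFin \o ((fun x => u x - c) \_ A)),
      \int[mu]_x ((fun x => u x - c) \_ A) x = 0 & `|c| <= M].
Proof.
move=> iu iF uF mA Aoo FM M0 c.
have iuA : mu.-integrable A (EFin \o u) by exact: integrableS iu.
have iFA : mu.-integrable A (EFin \o F) by exact: integrableS iF.
have icA : mu.-integrable A (EFin \o cst c) by exact: integrable_cst_fin.
have iucA : mu.-integrable A (EFin \o (fun x => u x - c)).
  by rewrite (_ : _ \o _ = (EFin \o u) \- (EFin \o cst c))%E//; exact: integrableB.
have uA : `|\int[mu]_(x in A) u x| <= M * fine (mu A).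
  apply: le_trans (le_normr_Rintegral _ iuA) _ => //; apply: le_trans FM.
  apply: le_Rintegral => //.
  exact: (integrable_norm iuA).
split.
- by rewrite -restrict_EFin; exact/(integrable_mkcond _ mA).
- rewrite -Rintegral_mkcond RintegralB// Rintegral_cst// /c.
  (* On a null set [c] is 0 since [0^-1 = 0], and the bound [uA] forces the integral of [u] to
     vanish, so the mean is still 0. *)
  have [A0|A0] := eqVneq (fine (mu A)) 0; last by rewrite divfK// subrr.
  by move: uA; rewrite A0 !mulr0 subr0 normr_le0 => /eqP.
- rewrite /c; have [A0|A0] := eqVneq (fine (mu A)) 0; first by rewrite A0 invr0 mulr0 normr0.
  by rewrite normrM normfV ler_pdivrMr ?normr_gt0// [in leRHS]ger0_norm// fine_ge0.
Qed.

(** The constant [3 * N] bounds a bad part on its cell: [N] for [|f|], whose average at most grows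
    by [N] from the parent cell, and [2 * N] for the subtracted average, whose real and imaginary
    parts are estimated separately. The hypothesis on generation 0 makes every stopped cell have a
    parent. *)
Theorem filtration_cz_decomposition (N kappa alpha : R) (family : set (set T)) (f : T -> R[i]) :
  1 <= N -> 3 * N <= kappa -> 0 < alpha -> cintegrable mu f ->
  (forall n x, mu (cell lev n x) <= N%:E * mu (cell lev n.+1 x))%E ->
  (forall x, cL1norm mu f <= alpha%:E * mu (cell lev 0 x))%E ->
  family set0 -> (forall n x, family (cell lev n x)) ->
  exists g b Rs, cz_decomposition mu family kappa f alpha g b Rs.
Proof.
move=> N1 kN alpha0 cf doub big fam0 famc.
have [iRe iIm] := cf; have iF := integrable_normc cf.
pose F x := Normc.normc (f x).
have F0 x : 0 <= F x by rewrite /F; case: (f x) => a b /=; exact: sqrtr_ge0.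
have mF : measurable_fun setT F by apply/measurable_EFinP; case/integrableP : iF.
have mEF (A : set T) : measurable_fun A (fun x => (F x)%:E).
  exact/measurable_EFinP/measurable_funTS.
have mc n x : measurable (cell lev n x) by exact: measurable_cell.
pose P n i := exists x, lev n x = i /\
  (alpha%:E * mu (cell lev n x) < \int[mu]_(y in cell lev n x) (F y)%:E)%E.
have PE n x : P n (lev n x) <->
    (alpha%:E * mu (cell lev n x) < \int[mu]_(y in cell lev n x) (F y)%:E)%E.
  by split=> [[y [yx]]|?]; [rewrite /cell yx|exists x].
have nP n x : ~ P n (lev n x) ->
    (\int[mu]_(y in cell lev n x) (F y)%:E <= alpha%:E * mu (cell lev n x))%E.
  by rewrite PE => /negP; rewrite -leNgt.
have nP0 x : ~ P 0%N (lev 0 x).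
  rewrite PE; apply/negP; rewrite -leNgt; apply: le_trans (big x).
  by apply: ge0_subset_integral => // y _; rewrite lee_fin.
have stopF n x : stops_at lev P n x ->
    (\int[mu]_(y in cell lev n x) (F y)%:E <= (N * alpha)%:E * mu (cell lev n x))%E.
  (* The parent of a stopped cell did not stop, so its average is at most [alpha]; passing to the
     cell itself costs the factor [N]. *)
  case: n => [|n] [Px nPx]; first by case: (nP0 x).
  apply: (@le_trans _ _ (\int[mu]_(y in cell lev n x) (F y)%:E)%E).
    apply: ge0_subset_integral => //; last exact: sub_cell.
    by move=> y _; rewrite lee_fin.
  apply: le_trans (nP _ _ (nPx n (ltnSn n))) _.
  rewrite EFinM (muleC N%:E) -muleA lee_wpmul2l// ?lee_fin ?(ltW alpha0)//.
pose Rs := stop_piece lev P.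
have mRs k : measurable (Rs k) by exact: measurable_stop_piece.
have tRs : trivIset setT Rs by exact: trivIset_stop_piece.
have URs : \bigcup_k Rs k = stopped lev P by exact: bigcup_stop_piece.
have RsP k : Rs k = set0 \/ exists n x, Rs k = cell lev n x /\ stops_at lev P n x.
  exact: stop_pieceP.
have Rsoo k : (mu (Rs k) < +oo)%E.
  by have [->|[n [x [-> _]]]] := RsP k; [rewrite measure0|exact: fin_cell].
have RsF k : \int[mu]_(x in Rs k) F x <= N * alpha * fine (mu (Rs k)).
  have [->|[n [x [-> nx]]]] := RsP k; first by rewrite Rintegral_set0 measure0 mulr0.
  rewrite -lee_fin EFinM !fineK ?ge0_fin_numE//; first exact: stopF.
    rewrite (le_lt_trans (stopF _ _ nx))// lte_mul_pinfty//.
    by rewrite lee_fin mulr_ge0// ltW// (lt_le_trans _ N1).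
  by apply: integral_ge0 => y _; rewrite lee_fin.
have M0 : 0 <= N * alpha by rewrite mulr_ge0// ltW// (lt_le_trans _ N1).
pose cRe (k : nat) := \int[mu]_(x in Rs k) complex.Re (f x) / fine (mu (Rs k)).
pose cIm (k : nat) := \int[mu]_(x in Rs k) complex.Im (f x) / fine (mu (Rs k)).
have avRe k := average_bound iRe iF (fun x => (normc_ge_abs (f x)).1) (mRs k) (Rsoo k) (RsF k) M0.
have avIm k := average_bound iIm iF (fun x => (normc_ge_abs (f x)).2) (mRs k) (Rsoo k) (RsF k) M0.
pose avg (k : nat) : R[i] := Complex (cRe k) (cIm k).
have avgM k : Normc.normc (avg k) <= 2 * (N * alpha).
  apply: le_trans (normc_le_abs _) _ => /=; rewrite mulr_natl mulr2n.
  by apply: lerD; [have [] := avRe k|have [] := avIm k].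
pose g (x : T) : R[i] := if pselect (exists k : nat, Rs k x) is left p then avg (sval (cid p)) else f x.
have gE (k : nat) x : Rs k x -> g x = avg k.
  move=> kx; rewrite /g; case: pselect => [p|[]]; last by exists k.
  congr avg; case: cid => j /= jx; apply: contrapT => jk.
  by have /trivIsetP/(_ _ _ Logic.I Logic.I (introN eqP jk)) := tRs; move/seteqP => [/(_ x) + _]; apply.
have gN x : ~ stopped lev P x -> g x = f x.
  move=> sx; rewrite /g; case: pselect => // -[k kx].
  by exfalso; apply: sx; rewrite -URs; exists k.
pose b (k : nat) (x : T) : R[i] := Complex (((fun x => complex.Re (f x) - cRe k) \_ (Rs k)) x)
                      (((fun x => complex.Im (f x) - cIm k) \_ (Rs k)) x).
have bN (k : nat) x : ~ Rs k x -> b k x = 0.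
  by move=> kx; rewrite /b !patchE memNset.
have bE (k : nat) x : Rs k x -> b k x = f x - avg k.
  by move=> kx; rewrite /b !patchE mem_set//; case: (f x).
(* The pieces are disjoint, so at most one bad part is nonzero at [x] and the partial sums are
   eventually constant. *)
have sumE x : exists k, forall n, (k < n)%N -> g x + \sum_(i < n) b i x = f x.
  have [[k _ kx]|sx] := pselect ((\bigcup_k Rs k) x).
    exists k => n kn; rewrite (bigD1 (Ordinal kn))//= big1 ?addr0.
      by rewrite (gE k)// bE// addrC subrK.
    move=> i ik; apply: bN => ix.
    have /trivIsetP/(_ k (nat_of_ord i) Logic.I Logic.I) := tRs.
    have -> : k != i by apply: contraNneq ik => ki; apply/eqP/val_inj.
    by move/(_ isT)/seteqP => [/(_ x) + _]; apply.
  exists 0%N => n _; rewrite gN -?URs// big1 ?addr0// => i _.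
  by apply: bN => ix; apply: sx; exists (i : nat).
have measg (G : R[i] -> R) : measurable_fun setT (G \o f) -> measurable_fun setT (G \o g).
  move=> mG; rewrite -(setUv (\bigcup_k Rs k)).
  have mU : measurable (\bigcup_k Rs k) by exact: bigcupT_measurable.
  apply/measurable_funU => //; first exact: measurableC.
  split.
    apply/measurable_fun_bigcup => // k.
    apply: (@eq_measurable_fun _ _ _ _ _ (cst (G (avg k)))) => //.
    by move=> x; rewrite inE => kx /=; rewrite (gE k).
  apply: (@eq_measurable_fun _ _ _ _ _ (G \o f)); last exact: measurable_funTS.
  by move=> x; rewrite inE => kx /=; rewrite gN// -URs.
have cg : cmeasurable g.
  split.
    by apply: (measg (@complex.Re R)); apply/measurable_EFinP; case/integrableP : iRe.
  by apply: (measg (@complex.Im R)); apply/measurable_EFinP; case/integrableP : iIm.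
exists g, b, Rs; split=> //.
- by move=> k; split; [have [] := avRe k|have [] := avIm k].
- apply: aeW => x; have [k kE] := sumE x.
  move=> A /nbhs_singleton Afx; exists k.+1 => // n /= kn; rewrite /= kE//.
(* Through a point that is never stopped all cells have averages at most [alpha], whence
   [|f| <= alpha] almost everywhere there. *)
- have : {ae mu, forall x, (~` stopped lev P) x -> F x <= alpha}.
    apply: ae_le_of_cell_integral_le => //; first exact: ltW.
      by apply: measurableC; exact: measurable_stopped.
    by move=> n x sx; apply: nP => Px; apply: sx; exists n.
  apply: filterS => x xE.
  have kM c : 0 <= c -> c <= 3 -> c * (N * alpha) <= kappa * alpha.
    move=> c0 c3; rewrite mulrA ler_wpM2r ?(ltW alpha0)//; apply: le_trans kN.
    by rewrite ler_wpM2r// (le_trans _ N1).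
  have [[k _ kx]|sx] := pselect ((\bigcup_k Rs k) x).
    by rewrite (gE k)// (le_trans (avgM k))// kM//; lra.
  rewrite gN -?URs// (@le_trans _ _ (1 * (N * alpha)))//; last by apply: kM; lra.
  rewrite mul1r (le_trans (xE _))//; first by rewrite -URs.
  by rewrite ler_peMl// ltW.
- by move=> k; have [->|[n [x [-> _]]]] := RsP k.
- move=> k; rewrite /cintegral; have [_ rRe _] := avRe k; have [_ rIm _] := avIm k.
  by rewrite rRe rIm.
- move=> k; rewrite /cL1norm.
  apply: (@le_trans _ _ (\int[mu]_(x in Rs k) ((F x)%:E + (2 * (N * alpha))%:E))%E).
    rewrite [leRHS]integral_mkcond; apply: ge0_le_integral => //.
    + by move=> x _; rewrite lee_fin; case: (b k x) => u v /=; exact: sqrtr_ge0.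
    + apply/measurable_EFinP/measurable_normc; split; apply/measurable_EFinP.
        by have [/integrableP[]] := avRe k.
      by have [/integrableP[]] := avIm k.
    + apply/(measurable_restrictT _ (mRs k)); apply: emeasurable_funD => //.
    + move=> x _; rewrite patchE; case: ifPn => [|/negP] xk.
        rewrite -EFinD lee_fin bE; last by rewrite inE in xk.
        apply: le_trans (le_normcD _ _) _; rewrite normcN.
        by rewrite lerD2l.
      by rewrite bN ?Normc.normc0// => kx; apply: xk; rewrite inE.
  rewrite ge0_integralD//.
  + rewrite (integral_cst mu (mRs k)) -(@fineK _ (mu (Rs k))) ?ge0_fin_numE//.
    rewrite -(@fineK _ (\int[mu]_(x in Rs k) (F x)%:E)%E); last first.
      apply: integrable_fin_num => //; exact: integrableS iF.
    rewrite -!EFinM -EFinD lee_fin.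
    apply: (@le_trans _ _ (3 * (N * alpha) * fine (mu (Rs k)))).
      by have := RsF k; rewrite /Rintegral; lra.
    by rewrite ler_wpM2r ?fine_ge0// mulrA ler_wpM2r// ltW.
  + by move=> x _; rewrite lee_fin.
  + by move=> x _; rewrite lee_fin mulr_ge0.
- have -> : (\sum_(i <oo) mu (Rs i) = mu (stopped lev P))%E.
    rewrite -URs measure_semi_bigcup//; exact: bigcupT_measurable.
  have mS : measurable (stopped lev P) by exact: measurable_stopped.
  have SF : (alpha%:E * mu (stopped lev P) <= cL1norm mu f)%E.
    apply: (@le_trans _ _ (\int[mu]_(y in stopped lev P) (F y)%:E)%E).
      rewrite -(integral_cst mu mS); apply: stop_piece_integral_le => //.
        by move=> x; rewrite lee_fin ltW.
      by move=> n x [/PE Px _]; rewrite integral_cst// ltW.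
    by apply: ge0_subset_integral => // y _; rewrite lee_fin.
  have Ffin : cL1norm mu f \is a fin_num by exact: integrable_fin_num.
  apply: (@le_trans _ _ (cL1norm mu f / alpha%:E)%E).
    by rewrite inver gt_eqF// lee_pdivlMr// muleC.
  rewrite -muleA -[leLHS]mul1e lee_wpmul2r//.
    rewrite inver gt_eqF//; apply: mule_ge0; last by rewrite lee_fin invr_ge0 ltW.
    by apply: integral_ge0 => x _; rewrite lee_fin; exact: F0.
  by rewrite lee_fin; lra.
Qed.

End calderon_zygmund_filtration.

(** * Coordinates and the group law *)

Notation cd := (coord (vbasis fullv)).

Section coordinates.
Context (R : realType) (V : vectType R).
Implicit Types x y : V.

Lemma cd_eq x y : (forall i, cd i x = cd i y) -> x = y.
Proof.
move=> xy; rewrite (coord_vbasis (memvf x)) (coord_vbasis (memvf y)).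
by apply: eq_bigr => i _; rewrite xy.
Qed.

Context (ip : V -> V -> R).
Hypothesis inner : is_inner_product ip.

Lemma ipDl x y z : ip (x + y) z = ip x z + ip y z.
Proof. by case: inner => lin _ _; have := lin z 1 x y; rewrite scale1r /= mul1r. Qed.

Lemma ip0l z : ip 0 z = 0.
Proof.
have := ipDl 0 0 z; rewrite addr0 => /eqP.
by rewrite -subr_eq0 opprD addrA subrr sub0r oppr_eq0 => /eqP.
Qed.

Lemma ipZl k x z : ip (k *: x) z = k * ip x z.
Proof. by case: inner => lin _ _; have := lin z k x 0; rewrite !addr0 ip0l addr0. Qed.

Lemma ipC x y : ip x y = ip y x. Proof. by case: inner. Qed.

Lemma ipDr x y z : ip z (x + y) = ip z x + ip z y.
Proof. by rewrite ipC ipDl !(ipC z). Qed.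

Lemma ipZr k x z : ip z (k *: x) = k * ip z x.
Proof. by rewrite ipC ipZl ipC. Qed.

Lemma ip_ge0 x : 0 <= ip x x.
Proof.
have [->|x0] := eqVneq x 0; first by rewrite ip0l.
by case: inner => _ _ /(_ _ x0)/ltW.
Qed.

Lemma ip_eq0 x : ip x x = 0 -> x = 0.
Proof.
move=> xx0; apply/eqP/contraT => x0; case: inner => _ _ /(_ _ x0).
by rewrite xx0 ltxx.
Qed.

Lemma ip_suml n (c : 'I_n -> R) (b : 'I_n -> V) z :
  ip (\sum_i c i *: b i) z = \sum_i c i * ip (b i) z.
Proof.
elim/big_rec2 : _ => [|i u v _ <-]; first by rewrite ip0l.
by rewrite ipDl ipZl.
Qed.

Lemma ip_sumr n (c : 'I_n -> R) (b : 'I_n -> V) z :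
  ip z (\sum_i c i *: b i) = \sum_i c i * ip z (b i).
Proof. by rewrite ipC ip_suml; apply: eq_bigr => i _; rewrite ipC. Qed.

Lemma ipnorm_ge0 x : 0 <= ipnorm ip x. Proof. exact: sqrtr_ge0. Qed.

Lemma ipnorm_sqr x : ipnorm ip x ^+ 2 = ip x x.
Proof. by rewrite sqr_sqrtr// ip_ge0. Qed.

Lemma ip_cauchy_schwarz x y : `|ip x y| <= ipnorm ip x * ipnorm ip y.
Proof.
have [->|y0] := eqVneq y 0; first by rewrite ipC ip0l normr0 mulr_ge0// ipnorm_ge0.
have yy0 : 0 < ip y y by case: inner => _ _; exact.
rewrite -(@ler_pXn2r _ 2)// ?nnegrE ?mulr_ge0 ?ipnorm_ge0// exprMn !ipnorm_sqr real_normK ?num_real//.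
have := ip_ge0 (x + (- (ip x y / ip y y)) *: y).
rewrite ipDl ipDr ipDr !ipZl !ipZr (ipC y x) => h.
rewrite -ler_pdivrMr// -subr_ge0; apply: le_trans h _.
rewrite le_eqVlt; apply/orP; left; apply/eqP.
by field; rewrite gt_eqF.
Qed.

Lemma ipnormZ k x : ipnorm ip (k *: x) = `|k| * ipnorm ip x.
Proof. by rewrite /ipnorm ipZl ipZr mulrA -expr2 sqrtrM ?sqr_ge0// sqrtr_sqr. Qed.

Lemma ipnormD x y : ipnorm ip (x + y) <= ipnorm ip x + ipnorm ip y.
Proof.
rewrite -(@ler_pXn2r _ 2)// ?nnegrE ?addr_ge0 ?ipnorm_ge0//.
rewrite sqrrD !ipnorm_sqr ipDl !ipDr (ipC y x).
have := le_trans (ler_norm _) (ip_cauchy_schwarz x y); rewrite mulr2n; lra.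
Qed.

Lemma ipnorm_coord_le : exists2 C : R, 0 <= C &
  forall x c, 0 <= c -> (forall i, `|cd i x| <= c) -> ipnorm ip x <= C * c.
Proof.
exists (\sum_(i < \dim {:V}) ipnorm ip (vbasis {:V})`_i); first by apply: sumr_ge0 => i _; exact: ipnorm_ge0.
move=> x c c0 xc; rewrite {1}(coord_vbasis (memvf x)) mulr_suml.
elim/big_rec2 : _ => [|i u v _ uv].
  by rewrite -[0 : V](scale0r 0) ipnormZ normr0 mul0r.
apply: le_trans (ipnormD _ _) _; rewrite lerD// ipnormZ mulrC ler_wpM2l ?ipnorm_ge0//.
Qed.

(* The Gram matrix is invertible, which bounds coordinates by inner products
   with the basis vectors. *)
Lemma coord_le_ipnorm : exists2 C : R, 0 <= C &
  forall x i, `|cd i x| <= C * ipnorm ip x.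
Proof.
pose b := fun i : 'I_(\dim {:V}) => (vbasis {:V})`_i.
pose G := \matrix_(i, j) ip (b i) (b j).
have GE (u : 'rV[R]_(\dim {:V})) : u *m G = \row_j ip (\sum_i u 0 i *: b i) (b j).
  apply/rowP => j; rewrite !mxE ip_suml; apply: eq_bigr => i _; by rewrite mxE.
have uG : G \in unitmx.
  rewrite -row_free_unit; apply: inj_row_free => u; rewrite GE => u0.
  have s0 : \sum_i u 0 i *: b i = 0.
    apply: ip_eq0; rewrite ip_sumr big1// => j _.
    by have /rowP/(_ j) := u0; rewrite !mxE => ->; rewrite mulr0.
  apply/rowP => j; rewrite mxE.
  have := coord_sum_free (u 0) j (basis_free (vbasisP {:V})).
  by rewrite -/(b _) s0 linear0.
exists (\sum_i \sum_j ipnorm ip (b j) * `|invmx G j i|).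
  by apply: sumr_ge0 => i _; apply: sumr_ge0 => j _; rewrite mulr_ge0// ipnorm_ge0.
move=> x i; have xE : \row_i cd i x = (\row_j ip x (b j)) *m invmx G.
  rewrite -[LHS](mulmxK uG) GE; congr (_ *m _); apply/rowP => j; rewrite !mxE.
  congr (ip _ _); rewrite {2}(coord_vbasis (memvf x)); apply: eq_bigr => l _.
  by rewrite mxE.
have /rowP/(_ i) := xE; rewrite !mxE => ->.
apply: le_trans (ler_norm_sum _ _ _) _.
apply: (@le_trans _ _ (\sum_j ipnorm ip (b j) * `|invmx G j i| * ipnorm ip x)).
  apply: ler_sum => j _; rewrite mxE normrM mulrAC ler_wpM2r//.
  by rewrite mulrC; exact: ip_cauchy_schwarz.
rewrite -mulr_suml ler_wpM2r ?ipnorm_ge0// [leRHS](bigD1 i)//= lerDl sumr_ge0// => l _.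
by apply: sumr_ge0 => j _; rewrite mulr_ge0// ipnorm_ge0.
Qed.

End coordinates.

(** * The bracket and the group law in coordinates *)

Section damek_ricci_algebra.
Context (R : realType) (L : htypeAlgebra R).
Local Notation V := (subvs_of (ht_v L)).
Local Notation Z := (subvs_of (ht_z L)).
Local Notation S := (damekRicci L).
Local Notation m := (\dim {:V}).

Definition dr_bracket (X Y : V) : Z := vsproj (ht_z L) (ht_bracket L (vsval X) (vsval Y)).

Lemma bracketDl (x y z : L) : ht_bracket L (x + y) z = ht_bracket L x z + ht_bracket L y z.
Proof. by case: (ht_lie L) => lin _ _ _; have := lin z 1 x y; rewrite !scale1r. Qed.

Lemma bracketDr (x y z : L) : ht_bracket L z (x + y) = ht_bracket L z x + ht_bracket L z y.
Proof. by case: (ht_lie L) => _ lin _ _; have := lin z 1 x y; rewrite !scale1r. Qed.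

Lemma bracket0l (z : L) : ht_bracket L 0 z = 0.
Proof. by apply: (addrI (ht_bracket L 0 z)); rewrite -bracketDl !addr0. Qed.

Lemma bracket0r (z : L) : ht_bracket L z 0 = 0.
Proof. by apply: (addrI (ht_bracket L z 0)); rewrite -bracketDr !addr0. Qed.

Lemma bracketZl k (x z : L) : ht_bracket L (k *: x) z = k *: ht_bracket L x z.
Proof.
by case: (ht_lie L) => lin _ _ _; have := lin z k x 0; rewrite /= !addr0 bracket0l addr0.
Qed.

Lemma bracketZr k (x z : L) : ht_bracket L z (k *: x) = k *: ht_bracket L z x.
Proof.
by case: (ht_lie L) => _ lin _ _; have := lin z k x 0; rewrite /= !addr0 bracket0r addr0.
Qed.

Lemma dr_bracketDl X Y W : dr_bracket (X + Y) W = dr_bracket X W + dr_bracket Y W.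
Proof. by rewrite /dr_bracket linearD bracketDl linearD. Qed.

Lemma dr_bracketDr X Y W : dr_bracket W (X + Y) = dr_bracket W X + dr_bracket W Y.
Proof. by rewrite /dr_bracket linearD bracketDr linearD. Qed.

Lemma dr_bracketZl k X W : dr_bracket (k *: X) W = k *: dr_bracket X W.
Proof. by rewrite /dr_bracket linearZ/= bracketZl linearZ. Qed.

Lemma dr_bracketZr k X W : dr_bracket W (k *: X) = k *: dr_bracket W X.
Proof. by rewrite /dr_bracket linearZ/= bracketZr linearZ. Qed.

Lemma dr_bracket0l W : dr_bracket 0 W = 0.
Proof. by rewrite -(scale0r 0) dr_bracketZl scale0r. Qed.

Lemma dr_bracket0r W : dr_bracket W 0 = 0.
Proof. by rewrite -(scale0r 0) dr_bracketZr scale0r. Qed.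

Lemma dr_bracketNl X W : dr_bracket (- X) W = - dr_bracket X W.
Proof. by rewrite -scaleN1r dr_bracketZl scaleN1r. Qed.

Lemma dr_bracketxx X : dr_bracket X X = 0.
Proof. by case: (ht_lie L) => _ _ alt _; rewrite /dr_bracket alt linear0. Qed.

Lemma dr_bracketC X Y : dr_bracket X Y = - dr_bracket Y X.
Proof.
apply/eqP; rewrite -addr_eq0; apply/eqP.
have := dr_bracketxx (X + Y).
by rewrite dr_bracketDl !dr_bracketDr !dr_bracketxx add0r addr0.
Qed.

(** Half the structure constants: in [cd_bracket] each pair of indices appears through the
    antisymmetric expression [x_i y_j - x_j y_i], the one that [grid_section] approximates, and is
    thus counted twice. *)
Definition dr_structure t i j : R :=
  2^-1 * cd t (dr_bracket (vbasis {:V})`_i (vbasis {:V})`_j).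

Lemma cd_bracket t X Y : cd t (dr_bracket X Y) =
  \sum_(i < m) \sum_(j < m) dr_structure t i j * (cd i X * cd j Y - cd j X * cd i Y).
Proof.
have E X' Y' : cd t (dr_bracket X' Y') =
    \sum_(i < m) \sum_(j < m) (cd i X' * cd j Y') * cd t (dr_bracket (vbasis {:V})`_i (vbasis {:V})`_j).
  have El W : cd t (dr_bracket X' W) =
      \sum_(i < m) cd i X' * cd t (dr_bracket (vbasis {:V})`_i W).
    rewrite {1}(coord_vbasis (memvf X')).
    elim/big_rec2 : _ => [|i u v _ <-]; first by rewrite dr_bracket0l linear0.
    by rewrite dr_bracketDl dr_bracketZl linearD linearZ.
  rewrite El; apply: eq_bigr => i _.
  under eq_bigr do rewrite -mulrA; rewrite -mulr_sumr; congr (_ * _).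
  rewrite {1}(coord_vbasis (memvf Y')).
  elim/big_rec2 : _ => [|j u v _ <-]; first by rewrite dr_bracket0r linear0.
  by rewrite dr_bracketDr dr_bracketZr linearD linearZ.
transitivity (2^-1 * (cd t (dr_bracket X Y) - cd t (dr_bracket Y X))).
  have -> : cd t (dr_bracket Y X) = - cd t (dr_bracket X Y) by rewrite dr_bracketC linearN.
  by field.
rewrite !E -sumrB mulr_sumr; apply: eq_bigr => i _.
rewrite -sumrB mulr_sumr; apply: eq_bigr => j _.
by rewrite /dr_structure; ring.
Qed.

Lemma cd_bracket_bound : exists2 C : R, 0 <= C & forall X Y c c' t, 0 <= c -> 0 <= c' ->
  (forall i, `|cd i X| <= c) -> (forall i, `|cd i Y| <= c') ->
  `|cd t (dr_bracket X Y)| <= C * (c * c').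
Proof.
pose C t := \sum_(i < m) \sum_(j < m) `|dr_structure t i j| * 2.
have C0 t : 0 <= C t.
  by apply: sumr_ge0 => i _; apply: sumr_ge0 => j _; rewrite mulr_ge0.
exists (\sum_t C t); first by apply: sumr_ge0.
move=> X Y c c' t c0 c'0 Xc Yc; rewrite cd_bracket.
apply: (@le_trans _ _ (C t * (c * c'))); last first.
  by rewrite ler_wpM2r ?mulr_ge0// (bigD1 t)//= lerDl sumr_ge0.
rewrite mulr_suml; apply: le_trans (ler_norm_sum _ _ _) _; apply: ler_sum => i _.
rewrite mulr_suml; apply: le_trans (ler_norm_sum _ _ _) _; apply: ler_sum => j _.
rewrite normrM -mulrA ler_wpM2l// mulr_natl mulr2n.
by apply: le_trans (ler_normB _ _) _; rewrite !normrM lerD// ler_pM.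
Qed.

Local Notation "p *g q" := (dr_mul p q) (at level 40, left associativity).

Lemma dr_eq (p q : S) : dr_X p = dr_X q -> dr_Z p = dr_Z q ->
  (dr_a p)%:num = (dr_a q)%:num -> p = q.
Proof.
case: p => X W a; case: q => X' W' a' /= -> -> aa'; congr DR; exact: val_inj.
Qed.

Lemma dr_XM (p q : S) : dr_X (p *g q) = dr_X p + Num.sqrt (dr_a p)%:num *: dr_X q.
Proof. by []. Qed.

Lemma dr_ZM (p q : S) : dr_Z (p *g q) = dr_Z p + (dr_a p)%:num *: dr_Z q +
  (2^-1 * Num.sqrt (dr_a p)%:num) *: dr_bracket (dr_X p) (dr_X q).
Proof. by []. Qed.

Lemma dr_aM (p q : S) : (dr_a (p *g q))%:num = (dr_a p)%:num * (dr_a q)%:num.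
Proof. by []. Qed.

Lemma dr_mulA (p q r : S) : p *g (q *g r) = p *g q *g r.
Proof.
have s k : Num.sqrt ((dr_a p)%:num * k) = Num.sqrt (dr_a p)%:num * Num.sqrt k by rewrite sqrtrM.
apply: dr_eq.
- by rewrite !dr_XM dr_aM s scalerDr addrA scalerA.
- rewrite !dr_ZM !dr_XM dr_aM s dr_bracketDl dr_bracketDr !dr_bracketZl !dr_bracketZr.
  rewrite !scalerDr !scalerA -!addrA; congr (_ + _); congr (_ + _).
  rewrite [RHS]addrCA; congr (_ + _).
  rewrite addrC -addrA; congr (_ + (_ + _)); congr (_ *: _); first by ring.
  have := sqr_sqrtr (ge0 (dr_a p)); rewrite expr2 => {1}<-; ring.
- by rewrite !dr_aM mulrA.
Qed.

Lemma dr_mulpV (p : S) : p *g dr_inv p = dr_one L.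
Proof.
rewrite -(dr_mul1p (p *g dr_inv p)) -(dr_mulVp (dr_inv p)) -dr_mulA.
by rewrite (dr_mulA (dr_inv p) p) dr_mulVp dr_mul1p.
Qed.

Lemma dr_mulp1 (p : S) : p *g dr_one L = p.
Proof. by rewrite -(dr_mulVp p) dr_mulA dr_mulpV dr_mul1p. Qed.

Lemma dr_mulKp (p q : S) : dr_inv p *g (p *g q) = q.
Proof. by rewrite dr_mulA dr_mulVp dr_mul1p. Qed.

Lemma dr_mulVKp (p q : S) : p *g (dr_inv p *g q) = q.
Proof. by rewrite dr_mulA dr_mulpV dr_mul1p. Qed.

Lemma dr_invM (p q : S) : dr_inv (p *g q) = dr_inv q *g dr_inv p.
Proof.
have : p *g q *g (dr_inv q *g dr_inv p) = dr_one L.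
  by rewrite -dr_mulA dr_mulVKp dr_mulpV.
by move=> /(congr1 (dr_mul (dr_inv (p *g q)))); rewrite dr_mulKp dr_mulp1.
Qed.

Lemma dr_translate (g p q : S) : dr_inv (g *g p) *g (g *g q) = dr_inv p *g q.
Proof. by rewrite dr_invM -dr_mulA dr_mulKp. Qed.

End damek_ricci_algebra.

(** * Curves and the distance *)

Section C1_functions.
Context (R : realType).
Local Notation mu := (@lebesgue_measure R).

(** Carries the derivative along, so that each rule below yields regularity and the value of the
    derivative at once. *)
Definition C1_with (f f' : R -> R) : Prop :=
  (forall t, is_derive t (1 : R) (f : R -> R^o) (f' t)) /\ continuous f'.

Lemma C1_withP (f f' : R -> R) : C1_with f f' <-> C1 (f : R -> R^o) /\ derive1 (f : R -> R^o) = f'.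
Proof.
split=> [[df cf]|[[df cf] <-]].
  have f'E : derive1 (f : R -> R^o) = f'.
    by apply/funext => t; rewrite derive1E; case: (df t).
  by split=> //; split; [move=> t; case: (df t)|rewrite f'E].
split=> // t; rewrite derive1E; exact: derivableP.
Qed.

Lemma C1_continuous (f : R -> R^o) : C1 f -> continuous (f : R -> R).
Proof. by move=> [df _] t; apply/differentiable_continuous/derivable1_diffP. Qed.

Lemma C1_with_cst k : C1_with (cst k) (cst 0).
Proof. by split=> [t|]; [exact: is_derive_cst|move=> t; exact: cvg_cst]. Qed.

Lemma C1_with_id : C1_with id (cst 1).
Proof. by split=> [t|]; [exact: is_derive_id|move=> t; exact: cvg_cst]. Qed.

Lemma C1_withD f f' g g' : C1_with f f' -> C1_with g g' ->
  C1_with (fun t => f t + g t) (fun t => f' t + g' t).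
Proof.
move=> [df cf] [dg cg]; split=> [t|]; first exact: is_deriveD.
by move=> t; apply: cvgD; [exact: cf|exact: cg].
Qed.

Lemma C1_withZ k f f' : C1_with f f' -> C1_with (fun t => k * f t) (fun t => k * f' t).
Proof.
move=> [df cf]; split=> [t|]; first exact: (is_deriveZ (V := R) (W := R^o)).
by move=> t; apply: cvgM; [exact: cvg_cst|exact: cf].
Qed.

Lemma C1_with_sum n (f f' : 'I_n -> R -> R) : (forall i, C1_with (f i) (f' i)) ->
  C1_with (fun t => \sum_i f i t) (fun t => \sum_i f' i t).
Proof.
elim: n f f' => [|n ih] f f' ff'.
  rewrite (_ : (fun t => _) = cst 0); last by apply/funext => t; rewrite big_ord0.
  rewrite (_ : (fun t => \sum_i f' i t) = cst 0); first exact: C1_with_cst.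
  by apply/funext => t; rewrite big_ord0.
rewrite (_ : (fun t => _) = (fun t => f ord0 t + \sum_i f (lift ord0 i) t)); last first.
  by apply/funext => t; rewrite big_ord_recl.
rewrite (_ : (fun t => \sum_i f' i t) = (fun t => f' ord0 t + \sum_i f' (lift ord0 i) t)).
  by apply: C1_withD => //; exact: ih.
by apply/funext => t; rewrite big_ord_recl.
Qed.

Lemma C1_with_comp f f' g g' : C1_with f f' -> C1_with g g' ->
  C1_with (f \o g) (fun t => f' (g t) * g' t).
Proof.
move=> [df cf] [dg cg]; split=> [t|]; first exact: is_derive1_comp.
move=> t; apply: cvgM; last exact: cg.
apply: continuous_comp; last exact: cf.
by apply/differentiable_continuous/derivable1_diffP; case: (dg t).
Qed.

Lemma C1_with_onem f f' : C1_with f f' -> C1_with (fun t => f (1 - t)) (fun t => - f' (1 - t)).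
Proof.
move=> ff'; have o : C1_with (fun t => 1 - t) (cst (-1)).
  have := C1_withD (C1_with_cst 1) (C1_withZ (-1) C1_with_id).
  by congr C1_with; apply/funext => t /=; ring.
have := C1_with_comp ff' o; congr C1_with.
by apply/funext => t; rewrite /= mulrN1.
Qed.

Lemma C1_with_expR s : C1_with (fun t => expR (s * t)) (fun t => expR (s * t) * s).
Proof.
have e : C1_with (@expR R) (@expR R).
  by split=> [t|]; [exact: is_derive_expR|exact: continuous_expR].
have := C1_with_comp e (C1_withZ s C1_with_id); congr C1_with.
by apply/funext => t; rewrite /= mulr1.
Qed.

Lemma continuous_integrable01 (u : R -> R) (t : R) : continuous u ->
  mu.-integrable `[0, t] (EFin \o u).
Proof.
move=> cu; apply: continuous_compact_integrable; first exact: segment_compact.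
exact: continuous_subspaceT.
Qed.

(* The fundamental theorem of calculus bounds an increment by the integral of
   the derivative. *)
Lemma C1_increment_le f f' (u : R -> R) k t : C1_with f f' -> continuous u ->
  (forall s, 0 <= u s) -> 0 <= k -> 0 <= t <= 1 ->
  (forall s, 0 <= s <= t -> `|f' s| <= k * u s) ->
  `|f t - f 0| <= k * \int[mu]_(s in `[0, 1]) u s.
Proof.
move=> [df cf] cu u0 k0 /andP[t0 t1] fu.
have [->|tne] := eqVneq t 0.
  by rewrite subrr normr0 mulr_ge0// Rintegral_ge0.
have {tne}t0' : 0 < t by rewrite lt_neqAle eq_sym tne.
have if' := continuous_integrable01 t cf.
have iu := continuous_integrable01 1 cu.
have iut := continuous_integrable01 t cu.
have fE : f t - f 0 = \int[mu]_(s in `[0, t]) f' s.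
  have cff : continuous f.
    by move=> s; apply/differentiable_continuous/derivable1_diffP; case: (df s).
  rewrite /Rintegral (@continuous_FTC2 _ f' f)//.
  - exact: continuous_subspaceT.
  - split.
    + by move=> s _; case: (df s).
    + by apply: cvg_at_right_filter; exact: cff.
    + by apply: cvg_at_left_filter; exact: cff.
  - by move=> s _; rewrite derive1E; case: (df s).
rewrite fE; apply: le_trans (le_normr_Rintegral _ if') _ => //.
apply: (@le_trans _ _ (\int[mu]_(s in `[0, t]) (k * u s))).
  apply: le_Rintegral => //.
  - exact: (integrable_norm if').
  - rewrite (_ : _ \o _ = (fun s => k%:E * (EFin \o u) s)%E)//.
    exact: integrableZl.
rewrite RintegralZl// ler_wpM2l//.
rewrite /Rintegral fine_le//; [exact: integrable_fin_num|exact: integrable_fin_num|].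
apply: ge0_subset_integral => //.
- by case/integrableP : iu.
- by move=> s _; rewrite lee_fin.
- by apply: subset_itvl; rewrite bnd_simp.
Qed.

End C1_functions.

Section vector_curves.
Context (R : realType) (V : vectType R).

Lemma continuous_row n (h : 'I_n -> R -> R) : (forall j, continuous (h j)) ->
  continuous (fun t => \row_j h j t : 'rV[R]_n).
Proof.
move=> ch t; apply/cvgrPdist_le => /= e e0; near=> x.
rewrite /Num.Def.normr/= mx_normrE (bigmax_le _ (ltW e0))//= => i _.
rewrite !mxE/=; move: i; near: x; apply: filter_forall => /= i.
have := ch i.2 t; move/cvgrPdist_le => /(_ e e0); exact.
Unshelve. all: by end_near. Qed.

Lemma vC1P (c : R -> V) : vC1 c <-> forall i, C1 (fun t => cd i (c t) : R^o).
Proof.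
have E i : (fun t => cd i (c t)) = (fun t => rVof (vbasis fullv) (c t) ord0 i).
  by apply/funext => t; rewrite mxE.
split=> [[dc cc] i|ci].
  have dci t : derivable (fun t => cd i (c t) : R^o) t 1.
    by rewrite E; have /derivable_mxP := dc t; apply.
  split; first exact: dci.
  rewrite (_ : derive1 _ = (fun t => derive1 (fun t => rVof (vbasis {:V}) (c t)) t ord0 i)).
    move=> t; apply: (@continuous_comp _ _ _ _
      (fun M : 'rV[R]_(\dim {:V}) => M ord0 i)); first exact: cc.
    exact: coord_continuous.
  by apply/funext => t; rewrite !derive1E (derive_mx (dc t)) mxE E.
have dc t : derivable (fun t => rVof (vbasis {:V}) (c t)) t 1.
  by apply/derivable_mxP => i j; rewrite (ord1 i) -E; case: (ci j) => dcj _; exact: dcj.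
split; first exact: dc.
rewrite (_ : derive1 _ = (fun t => \row_j derive1 (fun t => cd j (c t) : R^o) t)).
  by apply: continuous_row => j; case: (ci j).
by apply/funext => t; apply/rowP => j; rewrite derive1E (derive_mx (dc t)) !mxE derive1E E.
Qed.

Lemma cd_vderive (c : R -> V) i t : vC1 c ->
  cd i (vderive c t) = derive1 (fun s => cd i (c s) : R^o) t.
Proof.
move=> [dc _]; rewrite /vderive passmx.coord_vecof ?basis_free ?vbasisP//.
rewrite derive1E (derive_mx (dc t)) mxE derive1E.
by rewrite (_ : (fun s => cd i (c s)) = (fun s => rVof (vbasis {:V}) (c s) ord0 i))//;
  apply/funext => s; rewrite mxE.
Qed.

Lemma vC1_cd (c : R -> V) i : vC1 c -> C1_with (fun s => cd i (c s)) (fun s => cd i (vderive c s)).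
Proof.
move=> vc; apply/C1_withP; split; first by move/vC1P : vc.
by apply/funext => t; rewrite cd_vderive.
Qed.

Lemma vC1_intro (c c' : R -> V) :
  (forall i, C1_with (fun s => cd i (c s)) (fun s => cd i (c' s))) ->
  vC1 c /\ vderive c = c'.
Proof.
move=> cc'; have vc : vC1 c by apply/vC1P => i; have /C1_withP[] := cc' i.
split=> //; apply/funext => t; apply: cd_eq => i; rewrite cd_vderive//.
by have /C1_withP[_ ->] := cc' i.
Qed.

End vector_curves.

(** * The speed of a curve in the left-invariant metric *)

Section speed.
Context (R : realType) (L : htypeAlgebra R).
Local Notation V := (subvs_of (ht_v L)).
Local Notation Z := (subvs_of (ht_z L)).
Local Notation S := (damekRicci L).
Local Notation m := (\dim {:V}).
Local Notation mu := (@lebesgue_measure R).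
Local Notation "p *g q" := (dr_mul p q) (at level 40, left associativity).

Lemma C1_linear_form (V' : vectType R) (k : V' -> R) (c : R -> V') :
  (forall Y, k Y = \sum_(j < \dim {:V'}) k (vbasis {:V'})`_j * cd j Y) -> vC1 c ->
  C1_with (fun s => k (c s)) (fun s => k (vderive c s)).
Proof.
move=> kE vc.
have := C1_with_sum (fun j => C1_withZ (k (vbasis {:V'})`_j) (vC1_cd j vc)).
by congr C1_with; apply/funext => s; rewrite -kE.
Qed.

Lemma cd_bracketr t (W : V) (Y : V) : cd t (dr_bracket W Y) =
  \sum_(j < m) cd t (dr_bracket W (vbasis {:V})`_j) * cd j Y.
Proof.
rewrite {1}(coord_vbasis (memvf Y)).
elim/big_rec2 : _ => [|j u v _ <-]; first by rewrite dr_bracket0r linear0.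
by rewrite dr_bracketDr dr_bracketZr linearD linearZ/= mulrC.
Qed.

Lemma vC1_bracket t (W : V) (c : R -> V) : vC1 c ->
  C1_with (fun s => cd t (dr_bracket W (c s))) (fun s => cd t (dr_bracket W (vderive c s))).
Proof.
by move=> vc; apply: (C1_linear_form (k := fun Y => cd t (dr_bracket W Y))) vc => Y; exact: cd_bracketr.
Qed.

Definition ip_v (X Y : V) := ht_ip L (vsval X) (vsval Y).
Definition ip_z (X Y : Z) := ht_ip L (vsval X) (vsval Y).

Lemma ip_v_inner : is_inner_product ip_v.
Proof.
have [sl sC sp] := ht_inner L; split.
- by move=> y k x z; rewrite /ip_v linearP; exact: sl.
- by move=> x y; exact: sC.
- by move=> x x0; apply: sp; apply: contra x0 => /eqP x0; apply/eqP/val_inj.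
Qed.

Lemma ip_z_inner : is_inner_product ip_z.
Proof.
have [sl sC sp] := ht_inner L; split.
- by move=> y k x z; rewrite /ip_z linearP; exact: sl.
- by move=> x y; exact: sC.
- by move=> x x0; apply: sp; apply: contra x0 => /eqP x0; apply/eqP/val_inj.
Qed.

Lemma tangent_normE X W tau :
  tangent_norm (L := L) X W tau = Num.sqrt (ip_v X X + ip_z W W + tau ^+ 2).
Proof.
rewrite /tangent_norm /ip_v /ip_z.
rewrite (ipDl (ht_inner L)) !(ipDr (ht_inner L)) (ipC (ht_inner L) (vsval W) (vsval X)).
by rewrite (ht_orthogonal (subvsP X) (subvsP W)) addr0 add0r.
Qed.

Lemma tangent_norm_ge X W tau : [/\ ipnorm ip_v X <= tangent_norm X W tau,
  ipnorm ip_z W <= tangent_norm X W tau & `|tau| <= tangent_norm X W tau].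
Proof.
have := ip_ge0 ip_v_inner X; have := ip_ge0 ip_z_inner W => W0 X0.
rewrite tangent_normE -sqrtr_sqr /ipnorm; split; apply: ler_wsqrtr;
  have := sqr_ge0 tau; lra.
Qed.

Lemma tangent_norm_le X W tau :
  tangent_norm X W tau <= ipnorm ip_v X + ipnorm ip_z W + `|tau|.
Proof.
have := ip_ge0 ip_v_inner X; have := ip_ge0 ip_z_inner W => W0 X0.
rewrite tangent_normE -(@ler_pXn2r _ 2)// ?nnegrE ?sqrtr_ge0 ?addr_ge0 ?ipnorm_ge0//.
rewrite sqr_sqrtr ?addr_ge0 ?sqr_ge0// -(real_normK (num_real tau)).
rewrite -(ipnorm_sqr ip_v_inner) -(ipnorm_sqr ip_z_inner).
have := ipnorm_ge0 ip_v X; have := ipnorm_ge0 ip_z W; have := normr_ge0 tau; nra.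
Qed.

(** The translate by [dr_inv (g t)] is affine in the coordinates of the moving point; the bracket
    with the fixed point [dr_X (g t)] produces the contact form [Z' - [X, X'] / 2]. *)
Lemma dr_speedE (g : R -> S) t : dr_C1 g ->
  let a := (dr_a (g t))%:num in
  let X' := vderive (fun s => dr_X (g s)) t in
  dr_speed g t = tangent_norm ((Num.sqrt a)^-1 *: X')
    (a^-1 *: (vderive (fun s => dr_Z (g s)) t - 2^-1 *: dr_bracket (dr_X (g t)) X'))
    (derive1 (fun s => (dr_a (g s))%:num : R^o) t / a).
Proof.
move=> [vX vZ ca] a X'; rewrite /dr_speed.
have iX s : dr_X (dr_inv (g t) *g g s) =
    - ((Num.sqrt a)^-1 *: dr_X (g t)) + (Num.sqrt a)^-1 *: dr_X (g s).
  by rewrite dr_XM /= sqrtrV.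
have iZ s : dr_Z (dr_inv (g t) *g g s) =
    - (a^-1 *: dr_Z (g t)) + a^-1 *: dr_Z (g s)
      + (2^-1 * (Num.sqrt a)^-1) *: - ((Num.sqrt a)^-1 *: dr_bracket (dr_X (g t)) (dr_X (g s))).
  by rewrite dr_ZM /= sqrtrV// dr_bracketNl dr_bracketZl.
have ia s : (dr_a (dr_inv (g t) *g g s))%:num = a^-1 * (dr_a (g s))%:num by [].
have sa : (Num.sqrt a)^-1 * (Num.sqrt a)^-1 = a^-1.
  by rewrite -invfM -expr2 sqr_sqrtr // /a ge0.
congr tangent_norm.
- suff [_ ->] : vC1 (fun s => dr_X (dr_inv (g t) *g g s)) /\
      vderive (fun s => dr_X (dr_inv (g t) *g g s)) =
      (fun s => (Num.sqrt a)^-1 *: vderive (fun s => dr_X (g s)) s) by [].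
  apply: vC1_intro => i.
  have := C1_withD (C1_with_cst (cd i (- ((Num.sqrt a)^-1 *: dr_X (g t)))))
    (C1_withZ (Num.sqrt a)^-1 (vC1_cd i vX)).
  by congr C1_with; apply/funext => s; rewrite ?iX ?linearD ?linearZ/= ?add0r.
- suff [_ ->] : vC1 (fun s => dr_Z (dr_inv (g t) *g g s)) /\
      vderive (fun s => dr_Z (dr_inv (g t) *g g s)) =
      (fun s => a^-1 *: (vderive (fun s => dr_Z (g s)) s - 2^-1 *: dr_bracket (dr_X (g t))
       (vderive (fun s => dr_X (g s)) s))) by [].
  apply: vC1_intro => i.
  have := C1_withD (C1_withD (C1_with_cst (cd i (- (a^-1 *: dr_Z (g t)))))
    (C1_withZ a^-1 (vC1_cd i vZ)))
    (C1_withZ (- (2^-1 * a^-1)) (vC1_bracket i (dr_X (g t)) vX)).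
  congr C1_with; apply/funext => s.
    by rewrite iZ !linearD !linearZ/= !linearN/= !linearZ/= -sa -[2^-1 *: _]/(2^-1 * _); ring.
  rewrite /cst add0r [RHS]linearZ/= [X in _ = a^-1 * X]linearB/= [X in _ = a^-1 * (_ - X)]linearZ/=.
  by ring.
- have /C1_withP[_ ->] : C1_with (fun s => (dr_a (dr_inv (g t) *g g s))%:num)
      (fun s => a^-1 * derive1 (fun s => (dr_a (g s))%:num : R^o) s).
    by apply: (C1_withZ a^-1); apply/C1_withP.
  by rewrite mulrC.
Qed.

End speed.

(** * Lengths under translation and reversal *)

Section distance.
Context (R : realType) (L : htypeAlgebra R).
Local Notation V := (subvs_of (ht_v L)).
Local Notation Z := (subvs_of (ht_z L)).
Local Notation S := (damekRicci L).
Local Notation mu := (@lebesgue_measure R).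
Local Notation "p *g q" := (dr_mul p q) (at level 40, left associativity).

Lemma eq_continuous (f h : R -> R) : f =1 h -> continuous h -> continuous f.
Proof. by move=> /funext ->. Qed.

Lemma continuous_sum_ord n (f : 'I_n -> R -> R) : (forall i, continuous (f i)) ->
  continuous (fun t => \sum_i f i t).
Proof.
elim: n f => [|n ih] f cf.
  apply: (@eq_continuous _ (cst 0)) => [t|t]; first by rewrite big_ord0.
  exact: cvg_cst.
apply: (@eq_continuous _ (fun t => f ord0 t + \sum_i f (lift ord0 i) t)) => [t|t].
  by rewrite big_ord_recl.
by apply: cvgD; [exact: cf|exact: (ih (fun i => f (lift ord0 i)))].
Qed.

Lemma continuous_ip (W : vectType R) (ip : W -> W -> R) (U : R -> W) :
  is_inner_product ip -> (forall i, continuous (fun t => cd i (U t))) ->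
  continuous (fun t => ip (U t) (U t)).
Proof.
move=> inner cU.
rewrite (_ : (fun t => _) = (fun t => \sum_(i < \dim {:W}) \sum_(j < \dim {:W})
    cd i (U t) * (cd j (U t) * ip (vbasis {:W})`_i (vbasis {:W})`_j))); last first.
  apply/funext => t; rewrite {1}(coord_vbasis (memvf (U t))) (ip_suml inner).
  apply: eq_bigr => i _; rewrite {2}(coord_vbasis (memvf (U t))) (ip_sumr inner).
  by rewrite mulr_sumr.
apply: continuous_sum_ord => i; apply: continuous_sum_ord => j t.
by apply: cvgM; [exact: cU|apply: cvgM; [exact: cU|exact: cvg_cst]].
Qed.

(** Needed to integrate bounds by the speed in [C1_increment_le] and to change variables along a
    reversed curve. *)
Lemma continuous_speed (g : R -> S) : dr_C1 g -> continuous (dr_speed g).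
Proof.
move=> gC1; have [vX vZ ca] := gC1.
have cX i := (vC1_cd i vX).2; have cZ i := (vC1_cd i vZ).2.
have cx i : continuous (fun t => cd i (dr_X (g t))) by apply: C1_continuous; exact: ((vC1P _).1 vX).
have ca' := ca.2; have ca0 := C1_continuous ca.
have an0 t : (dr_a (g t))%:num != 0 by [].
have cV : continuous (fun t => (dr_a (g t))%:num^-1).
  by move=> t; apply: cvgV => //; exact: ca0.
have csV : continuous (fun t => (Num.sqrt (dr_a (g t))%:num)^-1).
  move=> t; apply: cvgV => //.
  by apply: continuous_comp; [exact: ca0|exact: sqrt_continuous].
pose X' t := vderive (fun s => dr_X (g s)) t.
pose U t := (Num.sqrt (dr_a (g t))%:num)^-1 *: X' t.
pose W t := (dr_a (g t))%:num^-1 *: (vderive (fun s => dr_Z (g s)) t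
  - 2^-1 *: dr_bracket (dr_X (g t)) (X' t)).
pose tau t := derive1 (fun s => (dr_a (g s))%:num : R^o) t / (dr_a (g t))%:num.
have cU : continuous (fun t => ip_v (U t) (U t)).
  apply: (continuous_ip (@ip_v_inner R L)) => i.
  apply: eq_continuous => [s|s]; first by rewrite linearZ.
  by apply: cvgM; [exact: csV|exact: cX].
have cW : continuous (fun t => ip_z (W t) (W t)).
  apply: (continuous_ip (@ip_z_inner R L)) => i.
  apply: eq_continuous => [s|]; first by rewrite linearZ/= linearB/= linearZ/= cd_bracket.
  move=> s; apply: cvgM; first exact: cV.
  apply: cvgB; first exact: cZ.
  apply: cvgM; first exact: cvg_cst.
  apply: continuous_sum_ord => j; apply: continuous_sum_ord => k {}s.
  apply: cvgM; first exact: cvg_cst.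
  by apply: cvgB; apply: cvgM; by [exact: cx|exact: cX].
have ctau : continuous (fun t => tau t ^+ 2).
  move=> t; apply: (@cvgM _ _ _ _ tau tau); apply: cvgM; by [exact: ca'|exact: cV].
apply: (@eq_continuous _ (fun t => Num.sqrt (ip_v (U t) (U t) + ip_z (W t) (W t) + tau t ^+ 2))).
  by move=> t; rewrite dr_speedE// tangent_normE.
move=> t; apply: (@continuous_comp _ _ _
  (fun t => ip_v (U t) (U t) + ip_z (W t) (W t) + tau t ^+ 2) Num.sqrt).
  by apply: cvgD; [apply: cvgD; [exact: cU|exact: cW]|exact: ctau].
exact: sqrt_continuous.
Qed.

Lemma dr_speed_ge0 (g : R -> S) t : 0 <= dr_speed g t.
Proof. exact: sqrtr_ge0. Qed.

Lemma dr_length_ge0 (g : R -> S) : 0 <= dr_length g.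
Proof. by apply: Rintegral_ge0 => t _; exact: dr_speed_ge0. Qed.

Lemma dr_C1_translate (p : S) (g : R -> S) : dr_C1 g -> dr_C1 (fun t => p *g g t).
Proof.
move=> [vX vZ ca]; split.
- suff [] : vC1 (fun s => dr_X (p *g g s)) /\ vderive (fun s => dr_X (p *g g s)) =
    (fun s => Num.sqrt (dr_a p)%:num *: vderive (fun s => dr_X (g s)) s) by [].
  apply: vC1_intro => i.
  have := C1_withD (C1_with_cst (cd i (dr_X p))) (C1_withZ (Num.sqrt (dr_a p)%:num) (vC1_cd i vX)).
  by congr C1_with; apply/funext => s; rewrite ?dr_XM ?linearD ?linearZ/= ?add0r.
- apply/vC1P => i.
  have /C1_withP[+ _] := C1_withD (C1_withD (C1_with_cst (cd i (dr_Z p)))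
    (C1_withZ (dr_a p)%:num (vC1_cd i vZ)))
    (C1_withZ (2^-1 * Num.sqrt (dr_a p)%:num) (vC1_bracket i (dr_X p) vX)).
  rewrite (_ : (fun t : R => _) = (fun s => cd i (dr_Z (p *g g s))))//.
  by apply/funext => s; rewrite dr_ZM !linearD/= !linearZ.
- have /C1_withP[] // := C1_withZ (dr_a p)%:num ((C1_withP _ _).2 (conj ca erefl)).
Qed.

Lemma dr_speed_translate (p : S) (g : R -> S) : dr_speed (fun t => p *g g t) = dr_speed g.
Proof.
apply/funext => t.
pose F (h : R -> S) := tangent_norm (vderive (fun s => dr_X (h s)) t)
  (vderive (fun s => dr_Z (h s)) t) (derive1 (fun s => (dr_a (h s))%:num : R^o) t).
rewrite -[LHS]/(F (fun s => dr_inv (p *g g t) *g (p *g g s))).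
rewrite -[RHS]/(F (fun s => dr_inv (g t) *g g s)).
by congr F; apply/funext => s; exact: dr_translate.
Qed.

Lemma dr_length_translate (p : S) (g : R -> S) : dr_length (fun t => p *g g t) = dr_length g.
Proof. by rewrite /dr_length dr_speed_translate. Qed.

Lemma dr_C1_rev (g : R -> S) : dr_C1 g -> dr_C1 (fun t => g (1 - t)) /\
  dr_length (fun t => g (1 - t)) = dr_length g.
Proof.
move=> gC1; have [vX vZ ca] := gC1.
have [vX' dX] : vC1 (fun s => dr_X (g (1 - s))) /\ vderive (fun s => dr_X (g (1 - s))) =
    (fun s => - vderive (fun s => dr_X (g s)) (1 - s)).
  apply: vC1_intro => i; have := C1_with_onem (vC1_cd i vX).
  by congr C1_with; apply/funext => s; rewrite linearN.
have [vZ' dZ] : vC1 (fun s => dr_Z (g (1 - s))) /\ vderive (fun s => dr_Z (g (1 - s))) =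
    (fun s => - vderive (fun s => dr_Z (g s)) (1 - s)).
  apply: vC1_intro => i; have := C1_with_onem (vC1_cd i vZ).
  by congr C1_with; apply/funext => s; rewrite linearN.
have /C1_withP[ca' da] := C1_with_onem ((C1_withP _ _).2 (conj ca erefl)).
have rC1 : dr_C1 (fun t => g (1 - t)) := And3 vX' vZ' ca'.
split; first exact: rC1.
have spE t : dr_speed (fun t => g (1 - t)) t = dr_speed g (1 - t).
  rewrite (dr_speedE t rC1) (dr_speedE (1 - t) gC1) /= dX dZ da !tangent_normE.
  have -> : dr_bracket (dr_X (g (1 - t))) (- vderive (fun s => dr_X (g s)) (1 - t)) =
    - dr_bracket (dr_X (g (1 - t))) (vderive (fun s => dr_X (g s)) (1 - t)).
    by rewrite dr_bracketC dr_bracketNl opprK dr_bracketC.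
  rewrite scalerN -opprD !scalerN mulNr sqrrN.
  have ipN (W : vectType R) (ip : W -> W -> R) x : is_inner_product ip -> ip (- x) (- x) = ip x x.
    by move=> inner; rewrite -scaleN1r (ipZl inner) (ipZr inner) !mulN1r opprK.
  by rewrite (ipN _ _ _ (@ip_v_inner R L)) (ipN _ _ _ (@ip_z_inner R L)).
have cs : {within `[0, 1], continuous (dr_speed g)}.
  by apply: continuous_subspaceT; exact: continuous_speed.
have r01 : 0 <= (1 : R) <= 1 by rewrite ler01 lexx.
rewrite /dr_length (Rintegration_by_substitution_onem r01 cs) /onem subrr.
by apply: eq_Rintegral => t _; exact: spE.
Qed.

Lemma dr_joins_cat (p q r : S) c c' : dr_joins p c q -> dr_joins q c' r -> dr_joins p (c ++ c') r.
Proof.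
elim: c p => [p /= ->//|g c ih p /= [gC1 g0 cj] c'j].
by split=> //; exact: ih.
Qed.

Lemma dr_joins_translate (g p q : S) c : dr_joins p c q ->
  dr_joins (g *g p) [seq (fun t => g *g f t) | f : R -> S <- c] (g *g q).
Proof.
elim: c p => [p /= ->//|f c ih p /= [fC1 <- cj]].
by split; [exact: dr_C1_translate|by []|exact: ih].
Qed.

Lemma dr_joins_rev (p q : S) c : dr_joins p c q ->
  dr_joins q (rev [seq (fun t => f (1 - t)) | f : R -> S <- c]) p.
Proof.
elim: c p => [p /= ->//|f c ih p /= [fC1 <- cj]].
rewrite rev_cons -cats1; apply: dr_joins_cat (ih _ cj) _ => /=.
by split; [have [] := dr_C1_rev fC1|rewrite subr0|rewrite subrr].
Qed.

Definition dr_chain_length (c : seq (R -> S)) : R := \sum_(g <- c) dr_length g.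

Lemma dr_chain_length_ge0 c : 0 <= dr_chain_length c.
Proof. by apply: sumr_ge0 => g _; exact: dr_length_ge0. Qed.

End distance.

(** * Existence of chains, symmetry, triangle inequality and left invariance *)

Section metric_axioms.
Context (R : realType) (L : htypeAlgebra R).
Local Notation V := (subvs_of (ht_v L)).
Local Notation Z := (subvs_of (ht_z L)).
Local Notation S := (damekRicci L).
Local Notation mu := (@lebesgue_measure R).
Local Notation "p *g q" := (dr_mul p q) (at level 40, left associativity).

Definition dr_horizontal (X : V) (W : Z) : S := DR X W 1%:pos.

Definition dr_vertical (s : R) : S := DR 0 0 (PosNum (expR_gt0 s)).

Lemma dr_decompose p : p = dr_horizontal (dr_X p) (dr_Z p) *g dr_vertical (ln (dr_a p)%:num).
Proof.
apply: dr_eq; rewrite ?dr_XM ?dr_ZM ?dr_aM/=.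
- by rewrite scaler0 addr0.
- by rewrite dr_bracket0r !scaler0 !addr0.
- by rewrite mul1r lnK// posrE.
Qed.

Lemma vC1_scale (W : vectType R) (X : W) : vC1 (fun t => t *: X) /\ vderive (fun t => t *: X) = cst X.
Proof.
apply: vC1_intro => i; have := C1_withZ (cd i X) (@C1_with_id R).
by congr C1_with; apply/funext => s; rewrite ?linearZ/= ?mulr1// mulrC.
Qed.

Lemma vC1_cst (W : vectType R) (X : W) : vC1 (fun _ : R => X) /\ vderive (fun _ : R => X) = cst 0.
Proof.
apply: vC1_intro => i; have := C1_with_cst (cd i X).
by congr C1_with; apply/funext => s; rewrite /= ?linear0.
Qed.

Lemma Rintegral01_cst (f : R -> R) k : (forall t, f t = k) -> \int[mu]_(t in `[0, 1]) f t = k.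
Proof.
move=> fk; rewrite (_ : f = cst k); last exact/funext.
by rewrite Rintegral_cst//= lebesgue_measure_itv/= lte01 oppr0 adde0 mulr1.
Qed.

(** Along a straight line at height 1 the bracket correction of the speed vanishes because [[X, X] =
    0], so the speed is constant. *)
Lemma dr_horizontal_joins X W : exists2 c, dr_joins (dr_one L) c (dr_horizontal X W) &
  dr_chain_length c <= ipnorm (@ip_v R L) X + ipnorm (@ip_z R L) W.
Proof.
pose g t : S := dr_horizontal (t *: X) (t *: W).
have [vX dX] := vC1_scale X; have [vW dW] := vC1_scale W.
have /C1_withP[ca da] := @C1_with_cst R 1.
have gC1 : dr_C1 g := And3 vX vW ca.
exists [:: g].
  by split; [exact: gC1|rewrite /g !scale0r|rewrite /= /g !scale1r].
rewrite /dr_chain_length big_seq1 /dr_length (Rintegral01_cst (k := tangent_norm X W 0)).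
  by apply: le_trans (tangent_norm_le _ _ _) _; rewrite normr0 addr0.
move=> t; rewrite (dr_speedE t gC1) /g /= dX dW da /cst mul0r sqrtr1 invr1 !scale1r.
by rewrite dr_bracketZl dr_bracketxx !scaler0 subr0.
Qed.

Lemma dr_vertical_joins s : exists2 c, dr_joins (dr_one L) c (dr_vertical s) &
  dr_chain_length c <= `|s|.
Proof.
pose g t : S := dr_vertical (s * t).
have [vX dX] := @vC1_cst V 0; have [vW dW] := @vC1_cst Z 0.
have /C1_withP[ca da] := @C1_with_expR R s.
have gC1 : dr_C1 g := And3 vX vW ca.
exists [:: g].
  split; first exact: gC1.
    by apply: dr_eq => //=; rewrite mulr0 expR0.
  by apply: dr_eq => //=; rewrite mulr1.
rewrite /dr_chain_length big_seq1 /dr_length (Rintegral01_cst (k := tangent_norm (0 : V) (0 : Z) s)).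
  apply: le_trans (tangent_norm_le _ _ _) _.
  by rewrite /ipnorm (ip0l (@ip_v_inner R L)) (ip0l (@ip_z_inner R L)) sqrtr0 !add0r.
move=> t; rewrite (dr_speedE t gC1) /g /= dX dW da /cst dr_bracket0l !scaler0 subr0 scaler0.
by rewrite mulrAC divff ?mul1r// gt_eqF// expR_gt0.
Qed.

(** Ensures that [dr_dist] is not the infimum of an empty set, whose default value would be
    meaningless. *)
Lemma dr_joins_ex p q : exists c, @dr_joins R L p c q.
Proof.
have [c cj _] := dr_horizontal_joins (dr_X (dr_inv p *g q)) (dr_Z (dr_inv p *g q)).
have [c' c'j _] := dr_vertical_joins (ln (dr_a (dr_inv p *g q))%:num).
have := dr_joins_translate (dr_horizontal (dr_X (dr_inv p *g q)) (dr_Z (dr_inv p *g q))) c'j.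
rewrite dr_mulp1 => /(dr_joins_cat cj)/(dr_joins_translate p).
by rewrite -dr_decompose dr_mulp1 dr_mulVKp => h; eexists; exact: h.
Qed.

Lemma dr_dist_lb p q : has_lbound [set @dr_chain_length R L c | c in [set c | dr_joins p c q]].
Proof. by exists 0 => _ [c _ <-]; exact: dr_chain_length_ge0. Qed.

Lemma dr_dist_le p q c : dr_joins p c q -> dr_dist p q <= @dr_chain_length R L c.
Proof. by move=> cj; apply: ge_inf; [exact: dr_dist_lb|exists c]. Qed.

Lemma dr_dist_lt p q e : @dr_dist R L p q < e ->
  exists2 c, dr_joins p c q & dr_chain_length c < e.
Proof.
move=> de; have [//||_ [c cj <-]] := @inf_adherent _
    [set @dr_chain_length R L c | c in [set c | dr_joins p c q]] (e - dr_dist p q).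
- by rewrite subr_gt0.
- by split; [have [c cj] := dr_joins_ex p q; exists (dr_chain_length c), c|exact: dr_dist_lb].
- by rewrite addrC subrK; exists c.
Qed.

Lemma dr_dist_ge0 p q : 0 <= @dr_dist R L p q.
Proof.
have [c cj] := dr_joins_ex p q; apply: lb_le_inf; first by exists (dr_chain_length c), c.
by move=> _ [c0 _ <-]; exact: dr_chain_length_ge0.
Qed.

Lemma dr_distxx p : @dr_dist R L p p = 0.
Proof.
apply/eqP; rewrite eq_le dr_dist_ge0 andbT.
by have := @dr_dist_le p p [::] erefl; rewrite /dr_chain_length big_nil.
Qed.

Lemma dr_chain_length_cat (c c' : seq (R -> S)) :
  dr_chain_length (c ++ c') = dr_chain_length c + dr_chain_length c'.
Proof. exact: big_cat. Qed.

Lemma dr_chain_length_cons (g : R -> S) c :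
  dr_chain_length (g :: c) = dr_length g + dr_chain_length c.
Proof. exact: big_cons. Qed.

Lemma dr_chain_length_rev p q c : @dr_joins R L p c q ->
  dr_chain_length (rev [seq (fun t => f (1 - t)) | f : R -> S <- c]) = dr_chain_length c.
Proof.
elim: c p => [//|g c ih] p [gC1 _ cj].
rewrite map_cons rev_cons -cats1 dr_chain_length_cat (ih _ cj) !dr_chain_length_cons.
by rewrite (dr_C1_rev gC1).2 addrC /dr_chain_length big_nil addr0.
Qed.

Lemma dr_dist_sym_le p q : @dr_dist R L q p <= dr_dist p q.
Proof.
apply/ler_addgt0Pr => e e0.
have [|c cj ce] := @dr_dist_lt p q (dr_dist p q + e); first by rewrite ltrDl.
apply: le_trans (dr_dist_le (dr_joins_rev cj)) _.
by rewrite (dr_chain_length_rev cj) ltW.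
Qed.

Lemma dr_distC p q : @dr_dist R L p q = dr_dist q p.
Proof. by apply/eqP; rewrite eq_le !dr_dist_sym_le. Qed.

Lemma dr_dist_triangle p q r : @dr_dist R L p r <= dr_dist p q + dr_dist q r.
Proof.
apply/ler_addgt0Pr => e e0.
have e2 : 0 < e / 2 by rewrite divr_gt0.
have [|c cj ce] := @dr_dist_lt p q (dr_dist p q + e / 2); first by rewrite ltrDl.
have [|c' c'j c'e] := @dr_dist_lt q r (dr_dist q r + e / 2); first by rewrite ltrDl.
apply: le_trans (dr_dist_le (dr_joins_cat cj c'j)) _.
rewrite dr_chain_length_cat; lra.
Qed.

Lemma dr_chain_length_translate (p : S) c :
  dr_chain_length [seq (fun t => p *g f t) | f : R -> S <- c] = dr_chain_length c.
Proof.
elim: c => [//|f c ih].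
by rewrite map_cons !dr_chain_length_cons ih dr_length_translate.
Qed.

Lemma dr_dist_translate_le g p q : @dr_dist R L (g *g p) (g *g q) <= dr_dist p q.
Proof.
apply/ler_addgt0Pr => e e0.
have [|c cj ce] := @dr_dist_lt p q (dr_dist p q + e); first by rewrite ltrDl.
apply: le_trans (dr_dist_le (dr_joins_translate g cj)) _.
by rewrite dr_chain_length_translate ltW.
Qed.

Lemma dr_dist_translate g p q : @dr_dist R L (g *g p) (g *g q) = dr_dist p q.
Proof.
apply/eqP; rewrite eq_le dr_dist_translate_le/=.
by have := dr_dist_translate_le (dr_inv g) (g *g p) (g *g q); rewrite !dr_mulKp.
Qed.

Lemma dr_dist1 p q : @dr_dist R L p q = dr_dist (dr_one L) (dr_inv p *g q).
Proof. by rewrite -(dr_dist_translate (dr_inv p)) dr_mulVp. Qed.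

Lemma dr_dist1M p q : @dr_dist R L (dr_one L) (p *g q) <= dr_dist (dr_one L) p + dr_dist (dr_one L) q.
Proof.
apply: le_trans (dr_dist_triangle _ p _) _.
by rewrite lerD2l -{1}(dr_mulp1 p) dr_dist_translate.
Qed.

Lemma dr_dist1_horizontal X W : dr_dist (dr_one L) (dr_horizontal X W) <=
  ipnorm (@ip_v R L) X + ipnorm (@ip_z R L) W.
Proof. by have [c cj] := dr_horizontal_joins X W; apply: le_trans; exact: dr_dist_le. Qed.

Lemma dr_dist1_vertical s : dr_dist (dr_one L) (dr_vertical s) <= `|s|.
Proof. by have [c cj] := dr_vertical_joins s; apply: le_trans; exact: dr_dist_le. Qed.

End metric_axioms.

(** * Lower and upper bounds of the distance by the coordinates *)

Section gauge.
Context (R : realType) (L : htypeAlgebra R).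
Local Notation V := (subvs_of (ht_v L)).
Local Notation Z := (subvs_of (ht_z L)).
Local Notation S := (damekRicci L).
Local Notation "p *g q" := (dr_mul p q) (at level 40, left associativity).

Lemma sqrt_expR (x : R) : Num.sqrt (expR x) = expR (x / 2).
Proof.
by rewrite {1}(splitr x) expRD -expr2 sqrtr_sqr ger0_norm// expR_ge0.
Qed.

(** Bounds that are stable under products, with [l] adding up. With [B] a bound of the bracket and
    [D = B C / 2], the bracket of two factors adds at most [C D e^l e^(l'/2) l l'] to the
    coordinates of [Z], which the cross term of [D (l + l')^2] absorbs. *)
Definition dr_gauge (C D l : R) (p : S) : Prop :=
  [/\ `|ln (dr_a p)%:num| <= l,
      forall i, `|cd i (dr_X p)| <= C * (l * expR (l / 2))
    & forall t, `|cd t (dr_Z p)| <= C * (expR l * (l + D * l ^+ 2))].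

Lemma dr_gauge_a C D l p : dr_gauge C D l p -> (dr_a p)%:num <= expR l.
Proof.
move=> [al _ _]; rewrite -[leLHS]lnK ?posrE// ler_expR.
exact: le_trans (ler_norm _) al.
Qed.

Lemma dr_gauge_le C D l l' p : 0 <= C -> 0 <= D -> 0 <= l -> l <= l' ->
  dr_gauge C D l p -> dr_gauge C D l' p.
Proof.
move=> C0 D0 l0 ll' [al xl zl]; split=> [|i|t].
- exact: le_trans ll'.
- apply: le_trans (xl i) _; rewrite ler_wpM2l// ler_pM ?expR_ge0// ler_expR; lra.
- apply: le_trans (zl t) _; rewrite ler_wpM2l// ler_pM ?expR_ge0//.
  + by rewrite addr_ge0// mulr_ge0// sqr_ge0.
  + by rewrite ler_expR.
  + by rewrite lerD// ler_wpM2l// ler_pXn2r// nnegrE// (le_trans l0).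
Qed.

Lemma dr_gauge1 C D : dr_gauge C D 0 (dr_one L).
Proof.
split=> [|i|t] /=; first by rewrite ln1 normr0.
- by rewrite linear0 normr0 mul0r mulr0.
- by rewrite linear0 normr0 expr0n/= mulr0 addr0 !mulr0.
Qed.

Lemma dr_gaugeM (C B l l' : R) p q : 0 <= C -> 0 <= B -> 0 <= l -> 0 <= l' ->
  (forall (X Y : V) c c' t, 0 <= c -> 0 <= c' ->
    (forall i, `|cd i X| <= c) -> (forall i, `|cd i Y| <= c') ->
    `|cd t (dr_bracket X Y)| <= B * (c * c')) ->
  dr_gauge C (2^-1 * (B * C)) l p -> dr_gauge C (2^-1 * (B * C)) l' q ->
  dr_gauge C (2^-1 * (B * C)) (l + l') (p *g q).
Proof.
move=> C0 B0 l0 l'0 bB pl ql; have ap := dr_gauge_a pl.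
have sap : Num.sqrt (dr_a p)%:num <= expR (l / 2) by rewrite -sqrt_expR ler_wsqrtr.
have [apl xpl zpl] := pl; have [aql xql zql] := ql.
set D := 2^-1 * (B * C) in pl ql zpl zql *.
have D0 : 0 <= D by rewrite !mulr_ge0.
set E := expR (l / 2); set E' := expR (l' / 2).
have EE : expR l = E * E by rewrite -expRD -splitr.
have EE' : expR l' = E' * E' by rewrite -expRD -splitr.
have E1 : 1 <= E by rewrite -expR0 ler_expR divr_ge0.
have E'1 : 1 <= E' by rewrite -expR0 ler_expR divr_ge0.
have E0 : 0 <= E by lra.
have E'0 : 0 <= E' by lra.
split=> [|i|t].
- rewrite dr_aM lnM ?posrE//; apply: le_trans (ler_normD _ _) _; exact: lerD.
- rewrite dr_XM linearD/= linearZ/= (mulrDl l l' 2^-1) expRD -/E -/E'.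
  apply: le_trans (ler_normD _ _) _; rewrite normrM ger0_norm//.
  apply: (@le_trans _ _ (C * (l * E) + E * (C * (l' * E')))).
    by apply: lerD => //; apply: ler_pM.
  rewrite -subr_ge0.
  have -> : C * ((l + l') * (E * E')) - (C * (l * E) + E * (C * (l' * E'))) =
    C * l * E * (E' - 1) by ring.
  by rewrite !mulr_ge0// subr_ge0.
- rewrite dr_ZM !linearD/= !linearZ/= expRD EE EE'.
  apply: le_trans (ler_normD _ _) _.
  apply: (@le_trans _ _ (C * (E * E * (l + D * l ^+ 2)) +
     (E * E) * (C * (E' * E' * (l' + D * l' ^+ 2))) +
     (2^-1 * E) * (B * ((C * (l * E)) * (C * (l' * E')))))).
    apply: lerD; first (apply: le_trans (ler_normD _ _) _; apply: lerD).
    + by rewrite -EE; exact: zpl.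
    + by rewrite normrM; apply: ler_pM => //; [rewrite ger0_norm// -EE|rewrite -EE'; exact: zql].
    + rewrite normrM; apply: ler_pM => //.
        by rewrite normrM ger0_norm// ger0_norm// ler_wpM2l.
      by apply: bB => //; rewrite !mulr_ge0.
  rewrite -subr_ge0.
  have -> : C * (E * E * (E' * E') * (l + l' + D * (l + l') ^+ 2)) -
    (C * (E * E * (l + D * l ^+ 2)) +
     E * E * (C * (E' * E' * (l' + D * l' ^+ 2))) +
     2^-1 * E * (B * (C * (l * E) * (C * (l' * E'))))) =
    C * (E * E) * (l + D * l ^+ 2) * (E' * E' - 1) +
    D * C * (E * E) * E' * (l * l') * (2 * E' - 1).
    by rewrite /D; field.
  have E'E'1 : 1 <= E' * E' by rewrite mulr_ege1.
  apply: addr_ge0; rewrite !mulr_ge0 ?subr_ge0 ?addr_ge0 ?mulr_ge0 ?sqr_ge0//; lra.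
Qed.

(** The speed controls [a' / a] first, so [a <= e^l] on the whole arc; this turns the speed into a
    bound on [X'], hence on [X], and then on [Z'], where [[X, X'] / 2] accounts for the quadratic
    term. *)
Lemma dr_arc_gauge (C B : R) (g : R -> S) : 0 <= C -> 0 <= B ->
  (forall (X Y : V) c c' t, 0 <= c -> 0 <= c' ->
    (forall i, `|cd i X| <= c) -> (forall i, `|cd i Y| <= c') ->
    `|cd t (dr_bracket X Y)| <= B * (c * c')) ->
  (forall (X : V) i, `|cd i X| <= C * ipnorm (@ip_v R L) X) ->
  (forall (W : Z) i, `|cd i W| <= C * ipnorm (@ip_z R L) W) ->
  dr_C1 g -> g 0 = dr_one L -> dr_gauge C (2^-1 * (B * C)) (dr_length g) (g 1).
Proof.
move=> C0 B0 bB CV CZ gC1 g0; have [vX vZ ca] := gC1.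
have cu := continuous_speed gC1; have u0 := dr_speed_ge0 g.
set l := dr_length g; have l0 : 0 <= l by exact: dr_length_ge0.
have t1 : 0 <= (1 : R) <= 1 by rewrite ler01 lexx.
pose a t := (dr_a (g t))%:num; pose a' t := derive1 (fun s => (dr_a (g s))%:num : R^o) t.
have ap t : 0 < a t by rewrite /a gt0.
have an0 t : a t != 0 by rewrite gt_eqF.
have aa' : C1_with a a' by exact/C1_withP.
have lna : C1_with (fun t => ln (a t)) (fun t => a' t / a t).
  split=> [t|t].
    rewrite mulrC; apply: is_derive1_comp; last exact: aa'.1.
    exact: is_derive1_ln.
  apply: cvgM; first exact: aa'.2.
  by apply: cvgV => //; apply/differentiable_continuous/derivable1_diffP; case: (aa'.1 t).
have sp t := tangent_norm_ge ((Num.sqrt (a t))^-1 *: vderive (fun s => dr_X (g s)) t)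
  ((a t)^-1 *: (vderive (fun s => dr_Z (g s)) t -
     2^-1 *: dr_bracket (dr_X (g t)) (vderive (fun s => dr_X (g s)) t))) (a' t / a t).
have lnl t : 0 <= t <= 1 -> `|ln (a t)| <= l.
  move=> t01; have := C1_increment_le lna cu u0 ler01 t01 _.
  rewrite (_ : a 0 = 1); last by rewrite /a g0.
  rewrite ln1 subr0 mul1r; apply => s _; rewrite mul1r dr_speedE//.
  by have [] := sp s.
have al t : 0 <= t <= 1 -> a t <= expR l.
  move=> /lnl al; rewrite -[leLHS]lnK ?posrE// ler_expR.
  exact: le_trans (ler_norm _) al.
have sal t : 0 <= t <= 1 -> Num.sqrt (a t) <= expR (l / 2).
  by move=> /al al'; rewrite -sqrt_expR ler_wsqrtr.
have X'u t i : 0 <= t <= 1 ->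
    `|cd i (vderive (fun s => dr_X (g s)) t)| <= C * expR (l / 2) * dr_speed g t.
  move=> t01; have [h _ _] := sp t.
  have s0 : 0 < Num.sqrt (a t) by rewrite sqrtr_gt0.
  have : `|cd i ((Num.sqrt (a t))^-1 *: vderive (fun s => dr_X (g s)) t)| <= C * dr_speed g t.
    by apply: le_trans (CV _ _) _; rewrite ler_wpM2l// dr_speedE.
  rewrite linearZ/= normrM normfV (ger0_norm (ltW s0)) ler_pdivrMl//.
  move/le_trans; apply; rewrite -mulrA mulrCA ler_wpM2l// ler_wpM2r//; exact: sal.
have Xl t i : 0 <= t <= 1 -> `|cd i (dr_X (g t))| <= C * (l * expR (l / 2)).
  move=> /andP[t0 t1']; have k0 : 0 <= C * expR (l / 2) by rewrite mulr_ge0// expR_ge0.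
  have := C1_increment_le (vC1_cd i vX) cu u0 k0 _ (t := t).
  rewrite t0 t1' => /(_ isT) h; apply: le_trans (le_trans _ (h _)) _.
  - by rewrite g0 linear0 subr0.
  - by move=> s /andP[s0 st]; apply: X'u; rewrite s0 (le_trans st).
  - by rewrite -/(dr_length g) -/l le_eqVlt; apply/orP; left; apply/eqP; ring.
split=> [|i|t]; [exact: lnl|exact: Xl|].
have k0 : 0 <= C * (expR l * (1 + 2^-1 * (B * C) * l)).
  by rewrite !mulr_ge0 ?expR_ge0 ?addr_ge0 ?mulr_ge0.
have := C1_increment_le (vC1_cd t vZ) cu u0 k0 t1.
rewrite g0 linear0 subr0 => h; apply: le_trans (h _) _; last first.
  by rewrite -/(dr_length g) -/l le_eqVlt; apply/orP; left; apply/eqP; ring.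
move=> s s01; have [_ h2 _] := sp s.
have a0 := ap s.
set X' := vderive (fun s => dr_X (g s)) s; set Z' := vderive (fun s => dr_Z (g s)) s.
have b1 : `|cd t (Z' - 2^-1 *: dr_bracket (dr_X (g s)) X')| <= expR l * (C * dr_speed g s).
  have : `|cd t ((a s)^-1 *: (Z' - 2^-1 *: dr_bracket (dr_X (g s)) X'))| <= C * dr_speed g s.
    by apply: le_trans (CZ _ _) _; rewrite ler_wpM2l// dr_speedE.
  rewrite linearZ/= normrM normfV (ger0_norm (ltW a0)) ler_pdivrMl//.
  by move/le_trans; apply; rewrite ler_wpM2r ?mulr_ge0//; exact: al.
have b2 : `|cd t (dr_bracket (dr_X (g s)) X')| <=
    B * (C * (l * expR (l / 2)) * (C * expR (l / 2) * dr_speed g s)).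
  apply: bB => [||i|i]; rewrite ?mulr_ge0 ?expR_ge0//; [exact: Xl|exact: X'u].
have -> : cd t Z' = cd t (Z' - 2^-1 *: dr_bracket (dr_X (g s)) X') +
    2^-1 * cd t (dr_bracket (dr_X (g s)) X').
  by rewrite linearB/= linearZ/= subrK.
apply: le_trans (ler_normD _ _) _; rewrite normrM (ger0_norm (_ : 0 <= 2^-1))//.
apply: le_trans (lerD b1 (ler_wpM2l _ b2)) _ => //.
have -> : expR l = expR (l / 2) * expR (l / 2) by rewrite -expRD -splitr.
by rewrite le_eqVlt; apply/orP; left; apply/eqP; field.
Qed.

(** Each arc of a chain, translated to start at the identity, has the gauge of its length, and
    gauges multiply along the chain. *)
Theorem dr_dist_lower : exists2 C : R, 1 <= C & forall p r, dr_dist (dr_one L) p < r ->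
  [/\ `|ln (dr_a p)%:num| <= r, forall i, `|cd i (dr_X p)| <= C * (r * expR (r / 2))
    & forall t, `|cd t (dr_Z p)| <= C * (r * expR (2 * r))].
Proof.
have [B B0 bB] := cd_bracket_bound L.
have [C1 C10 CV] := coord_le_ipnorm (@ip_v_inner R L).
have [C2 C20 CZ] := coord_le_ipnorm (@ip_z_inner R L).
pose C := 1 + C1 + C2; have C_ge0 : 0 <= C by rewrite /C; lra.
have CV' (X : V) i : `|cd i X| <= C * ipnorm (@ip_v R L) X.
  apply: le_trans (CV _ _) _; rewrite ler_wpM2r ?ipnorm_ge0// /C; lra.
have CZ' (W : Z) i : `|cd i W| <= C * ipnorm (@ip_z R L) W.
  apply: le_trans (CZ _ _) _; rewrite ler_wpM2r ?ipnorm_ge0// /C; lra.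
pose D := 2^-1 * (B * C); have D0 : 0 <= D by rewrite !mulr_ge0.
have chain c p q : dr_joins p c q -> dr_gauge C D (dr_chain_length c) (dr_inv p *g q).
  elim: c p => [|g c ih] p.
    by move=> /= ->; rewrite dr_mulVp /dr_chain_length big_nil; exact: dr_gauge1.
  move=> [gC1 g0 cj]; rewrite dr_chain_length_cons.
  have -> : dr_inv p *g q = dr_inv p *g g 1 *g (dr_inv (g 1) *g q).
    by rewrite -dr_mulA dr_mulVKp.
  apply: dr_gaugeM => //; [exact: dr_length_ge0|exact: dr_chain_length_ge0| |exact: ih].
  rewrite -(dr_length_translate (dr_inv p)).
  apply: (dr_arc_gauge C_ge0 B0 bB CV' CZ' (dr_C1_translate (dr_inv p) gC1)).
  by rewrite g0 dr_mulVp.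
exists (C * (1 + D)).
  by rewrite mulr_ege1// /C; lra.
move=> p r dr; have [c cj cr] := dr_dist_lt dr.
have := chain _ _ _ cj.
have -> : dr_inv (dr_one L) *g p = p by have := dr_mulKp (dr_one L) p; rewrite dr_mul1p.
move/(dr_gauge_le C_ge0 D0 (dr_chain_length_ge0 c) (ltW cr)) => [h1 h2 h3].
have r0 : 0 <= r by apply: le_trans (ltW cr); exact: dr_chain_length_ge0.
split=> // [i|t].
  apply: le_trans (h2 i) _; rewrite ler_wpM2r ?mulr_ge0 ?expR_ge0//.
  by rewrite mulrDr mulr1 lerDl mulr_ge0.
apply: le_trans (h3 t) _; rewrite -mulrA ler_wpM2l//.
have -> : expR (2 * r) = expR r * expR r by rewrite -expRD mulr_natl.
(* This trades the quadratic term [D r^2] for a second factor [e^r], whence [expR (2 * r)] in the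
   statement. *)
have e1 : 1 + r <= expR r by exact: expR_ge1Dx.
have -> : (1 + D) * (r * (expR r * expR r)) = expR r * ((1 + D) * r * expR r) by ring.
rewrite ler_wpM2l ?expR_ge0//.
apply: (@le_trans _ _ ((1 + D) * r * (1 + r))); last by rewrite ler_wpM2l// mulr_ge0// addr_ge0.
rewrite -subr_ge0.
have -> : (1 + D) * r * (1 + r) - (r + D * r ^+ 2) = D * r + r * r by ring.
by rewrite addr_ge0// mulr_ge0.
Qed.

(* A horizontal displacement is cheap high up: conjugating by a vertical
   translation of length [2 c r] divides it by [e ^ (c r)]. *)
Theorem dr_dist_upper (A c : R) : 0 <= A -> 0 <= c ->
  exists2 K : R, 0 <= K & forall p r, 0 <= r -> `|ln (dr_a p)%:num| <= r ->
  (forall i, `|cd i (dr_X p)| <= A * (r * expR (c * r))) ->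
  (forall t, `|cd t (dr_Z p)| <= A * (r * expR (c * r))) ->
  dr_dist (dr_one L) p <= K * r.
Proof.
move=> A0 c0.
have [K1 K10 KV] := ipnorm_coord_le (@ip_v_inner R L).
have [K2 K20 KZ] := ipnorm_coord_le (@ip_z_inner R L).
(* Going up and down by [2 c r] costs [4 c r], the horizontal move at the top [(K1 + K2) A r], and
   the final change of height at most [r]. *)
exists (4 * c + (K1 + K2) * A + 1); first by rewrite !addr_ge0 ?mulr_ge0 ?addr_ge0.
move=> p r r0 ap xp zp.
rewrite {1}(dr_decompose p).
apply: le_trans (dr_dist1M _ _) _; rewrite mulrDl mul1r lerD//; last first.
  exact: le_trans (dr_dist1_vertical _ _) ap.
pose s := 2 * c * r.
have s0 : 0 <= s by rewrite /s !mulr_ge0.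
have sE : Num.sqrt (expR s) = expR (c * r) by rewrite sqrt_expR /s; congr expR; field.
have -> : dr_horizontal (dr_X p) (dr_Z p) = dr_vertical L s *g
    (dr_horizontal (expR (- (c * r)) *: dr_X p) (expR (- s) *: dr_Z p) *g dr_vertical L (- s)).
  apply: dr_eq; rewrite ?dr_XM ?dr_ZM ?dr_aM /= ?sE.
  - by rewrite scaler0 addr0 add0r scalerA -expRD subrr expR0 scale1r.
  - by rewrite dr_bracket0l dr_bracket0r !scaler0 !addr0 add0r scalerA -expRD subrr expR0 scale1r.
  - by rewrite mul1r -expRD subrr expR0.
apply: le_trans (dr_dist1M _ _) _.
apply: le_trans (lerD (dr_dist1_vertical _ _) (dr_dist1M _ _)) _.
apply: le_trans (lerD (lexx _) (lerD (dr_dist1_horizontal _ _) (dr_dist1_vertical _ _))) _.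
rewrite normrN ger0_norm// (ipnormZ (@ip_v_inner R L)) (ipnormZ (@ip_z_inner R L)).
rewrite !ger0_norm ?expR_ge0//.
have b0 : 0 <= A * (r * expR (c * r)) by rewrite !mulr_ge0 ?expR_ge0.
have bX : expR (- (c * r)) * ipnorm (@ip_v R L) (dr_X p) <= K1 * A * r.
  apply: (@le_trans _ _ (expR (- (c * r)) * (K1 * (A * (r * expR (c * r)))))).
    by rewrite ler_wpM2l ?expR_ge0// KV.
  rewrite expRN le_eqVlt; apply/orP; left; apply/eqP; field.
  by rewrite gt_eqF// expR_gt0.
have bZ : expR (- s) * ipnorm (@ip_z R L) (dr_Z p) <= K2 * A * r.
  apply: (@le_trans _ _ (expR (- (c * r)) * (K2 * (A * (r * expR (c * r)))))).
    rewrite ler_pM ?expR_ge0 ?ipnorm_ge0//; last exact: KZ.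
    by rewrite ler_expR lerN2 /s -mulrA ler_peMl ?mulr_ge0// ler1n.
  rewrite expRN le_eqVlt; apply/orP; left; apply/eqP; field.
  by rewrite gt_eqF// expR_gt0.
rewrite /s; lra.
Qed.

End gauge.

(** * Tiles *)

Section dyadic_grid.
Context (R : realType).
Implicit Types (P x y : R) (n : nat).

Definition grid_index P n x : int := Num.floor (x * 2 ^+ n / P).

Definition grid_point P n x : R := P / 2 ^+ n * (grid_index P n x)%:~R.

Lemma grid_index_coarse1 P n x y :
  grid_index P n.+1 x = grid_index P n.+1 y -> grid_index P n x = grid_index P n y.
Proof.
have E z (k : int) : (k <= grid_index P n z) = (k * 2 <= grid_index P n.+1 z).
  rewrite /grid_index !floor_ge_int intrM.
  have -> : z * 2 ^+ n.+1 / P = z * 2 ^+ n / P * 2%:~R by rewrite exprSr; ring.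
  by rewrite ler_pM2r.
move=> xy; apply/eqP; rewrite eq_le; apply/andP.
by split; rewrite E; [rewrite -xy|rewrite xy]; rewrite -E.
Qed.

Lemma grid_index_coarse P m n x y : (m <= n)%N ->
  grid_index P n x = grid_index P n y -> grid_index P m x = grid_index P m y.
Proof.
move=> /subnKC <-; elim: (n - m)%N => [|k ih]; first by rewrite addn0.
by rewrite addnS => /grid_index_coarse1/ih.
Qed.

Lemma grid_pointP P n x : 0 < P ->
  grid_point P n x <= x /\ x < grid_point P n x + P / 2 ^+ n.
Proof.
move=> P0; have P2 : 0 < P / 2 ^+ n by rewrite divr_gt0// exprn_gt0.
have xE : P / 2 ^+ n * (x * 2 ^+ n / P) = x.
  by field; rewrite gt_eqF// expf_neq0.
have /andP[h1 h2] := floor_itv (x * 2 ^+ n / P).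
rewrite -(ler_pM2l P2) xE in h1; rewrite -(ltr_pM2l P2) xE intrD mulrDr mulr1 in h2.
by split.
Qed.

Lemma grid_point_dist P n x : 0 < P -> `|x - grid_point P n x| <= P / 2 ^+ n.
Proof.
move=> P0; have [h1 h2] := grid_pointP n x P0.
by rewrite ger0_norm ?subr_ge0// lerBlDl ltW.
Qed.

Lemma grid_dist P n x y : 0 < P -> grid_index P n x = grid_index P n y ->
  `|x - y| <= P / 2 ^+ n.
Proof.
move=> P0 xy; have [x1 x2] := grid_pointP n x P0; have [y1 y2] := grid_pointP n y P0.
have E : grid_point P n x = grid_point P n y by rewrite /grid_point xy.
by rewrite ler_norml; move: x1 x2 y1 y2; rewrite E => *; apply/andP; split; lra.
Qed.

Lemma grid_index_floorP P n x k : 0 < P -> grid_index P n x = k <->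
  P / 2 ^+ n * k%:~R <= x < P / 2 ^+ n * (k + 1)%:~R.
Proof.
move=> P0; have P2 : 0 < P / 2 ^+ n by rewrite divr_gt0// exprn_gt0.
have -> : x = P / 2 ^+ n * (x * 2 ^+ n / P).
  by field; rewrite gt_eqF// expf_neq0.
rewrite ler_pM2l// ltr_pM2l// -floor_eq /grid_index.
have -> : P / 2 ^+ n * (x * 2 ^+ n / P) * 2 ^+ n / P = x * 2 ^+ n / P.
  by field; rewrite gt_eqF// expf_neq0.
by split=> /eqP.
Qed.

Lemma measurable_grid_point P n : 0 < P -> measurable_fun setT (grid_point P n).
Proof.
move=> P0; apply: nondecreasing_measurable => // x y xy.
rewrite /grid_point ler_wpM2l ?divr_ge0 ?exprn_ge0// ?(ltW P0)// ler_int le_floor//.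
by rewrite ler_pM2r ?invr_gt0// ler_pM2r// exprn_gt0.
Qed.

Lemma grid_point_cvg P x : 0 < P -> grid_point P n x @[n --> \oo] --> x.
Proof.
move=> P0; apply/cvgrPdist_le => e e0.
have : P / 2 ^+ n @[n --> \oo] --> 0.
  have h2 : `|2^-1 : R| < 1 by rewrite ger0_norm//; lra.
  have := cvg_geometric P h2; rewrite (_ : geometric P 2^-1 = (fun n => P / 2 ^+ n))//.
  by apply/funext => n; rewrite /geometric/= exprVn.
move/cvgrPdist_le => /(_ e e0); apply: filterS => n; rewrite sub0r normrN => h.
by apply: le_trans (grid_point_dist n x P0) _; apply: le_trans h; exact: ler_norm.
Qed.

(* The increments of a fractal section of the symplectic form: on a dyadic
   square with corner [(c, c')] the function [grid_section P] coincides with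
   [c * y - c' * x] up to a constant and to the area of the square. *)
Definition grid_section_term P x y n : R :=
  grid_point P n x * (grid_point P n.+1 y - grid_point P n y) -
  grid_point P n y * (grid_point P n.+1 x - grid_point P n x).

Definition grid_section P x y : R := limn (series (grid_section_term P x y)).

Lemma grid_step P n x : 0 < P -> `|grid_point P n.+1 x - grid_point P n x| <= P / 2 ^+ n.
Proof.
move=> P0; have [h1 h2] := grid_pointP n x P0; have [h3 h4] := grid_pointP n.+1 x P0.
have p0 : 0 < P / 2 ^+ n by rewrite divr_gt0// exprn_gt0.
have E : P / 2 ^+ n.+1 = P / 2 ^+ n / 2 by rewrite exprSr invfM mulrA.
rewrite E in h4; rewrite ler_norml; apply/andP.
have h5 : grid_point P n x <= grid_point P n.+1 x + P / 2 ^+ n by lra.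
split; lra.
Qed.

(** The corners of the dyadic intervals stay bounded and their steps are at most [P / 2 ^+ n], so a
    geometric series dominates. *)
Lemma grid_section_cvg P x y : 0 < P ->
  series (grid_section_term P x y) @ \oo --> grid_section P x y.
Proof.
move=> P0; suff : cvgn (series (grid_section_term P x y)) by [].
apply: normed_cvg.
pose K := (`|x| + P + (`|y| + P)) * P.
have gb n z : `|grid_point P n z| <= `|z| + P.
  have -> : grid_point P n z = z - (z - grid_point P n z) by rewrite subKr.
  apply: le_trans (ler_normB _ _) _; rewrite lerD2l.
  apply: le_trans (grid_point_dist n z P0) _.
  by rewrite ler_pdivrMr ?exprn_gt0// ler_peMr ?(ltW P0)// exprn_ege1// ler1n.
apply: (@series_le_cvg _ _ (geometric K 2^-1)) => //.
- by move=> n /=.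
- by move=> n; rewrite /geometric/= /K !mulr_ge0 ?addr_ge0 ?exprn_ge0 ?invr_ge0 ?(ltW P0)//.
- move=> n; rewrite /geometric/= exprVn.
  have -> : K / 2 ^+ n = (`|x| + P) * (P / 2 ^+ n) + (`|y| + P) * (P / 2 ^+ n).
    by rewrite /K; ring.
  apply: le_trans (ler_normB _ _) _; rewrite (normrM (grid_point P n x)) (normrM (grid_point P n y)).
  by apply: lerD; apply: ler_pM; rewrite ?gb ?grid_step.
- by apply: is_cvg_geometric_series; rewrite ger0_norm//; lra.
Qed.

Lemma measurable_grid_section P d (T : measurableType d) (f h : T -> R) : 0 < P ->
  measurable_fun setT f -> measurable_fun setT h ->
  measurable_fun setT (fun t => grid_section P (f t) (h t)).
Proof.
move=> P0 mf mh.
have mg n (k : T -> R) : measurable_fun setT k -> measurable_fun setT (fun t => grid_point P n (k t)).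
  by move=> mk; apply: measurableT_comp mk; exact: measurable_grid_point.
apply: (@measurable_fun_cvg _ _ _ _ (fun n t => series (grid_section_term P (f t) (h t)) n)).
  move=> n; rewrite /series/=; apply: measurable_sum => k.
  by apply: measurable_funB; apply: measurable_funM => //; try exact: mg;
    apply: measurable_funB; exact: mg.
by move=> t _; exact: grid_section_cvg.
Qed.

(** Freezing the corner at generation [N] changes the term of generation [n] by at most
    [2 (P / 2^N) (P / 2^n)]. As [P / 2^n] is twice the difference of two consecutive sides, these
    errors telescope to the right-hand side. *)
Lemma grid_section_partial P N k x y : 0 < P ->
  `|series (grid_section_term P x y) (N + k)%N - series (grid_section_term P x y) N -
    (grid_point P N x * (grid_point P (N + k) y - grid_point P N y) -
     grid_point P N y * (grid_point P (N + k) x - grid_point P N x))| <=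
  4 * (P / 2 ^+ N) * (P / 2 ^+ N - P / 2 ^+ (N + k)).
Proof.
move=> P0; elim: k => [|k ih].
  by rewrite addn0 !subrr !mulr0 subrr subr0 normr0.
rewrite addnS seriesSr.
set n := (N + k)%N in ih *.
have E : P / 2 ^+ n.+1 = P / 2 ^+ n / 2 by rewrite exprSr invfM mulrA.
set s := series _ _ in ih *; set s' := series _ N in ih *.
set X := grid_point P N x in ih *; set Y := grid_point P N y in ih *.
have pn : P / 2 ^+ n <= P / 2 ^+ N.
  by rewrite ler_pM2l// lef_pV2 ?posrE ?exprn_gt0// ler_eXn2l ?ltr1n// leq_addr.
have d z : `|grid_point P n z - grid_point P N z| <= P / 2 ^+ N.
  have [h1 h2] := grid_pointP N z P0; have [h3 h4] := grid_pointP n z P0.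
  by rewrite ler_norml; apply/andP; split; lra.
have dx := d x; have dy := d y.
have sx := grid_step n x P0; have sy := grid_step n y P0.
rewrite /grid_section_term.
set x1 := grid_point P n.+1 x in sx *; set y1 := grid_point P n.+1 y in sy *.
set x0 := grid_point P n x in dx sx ih *; set y0 := grid_point P n y in dy sy ih *.
rewrite (_ : _ - _ = s - s' - (X * (y0 - Y) - Y * (x0 - X)) +
   ((x0 - X) * (y1 - y0) - (y0 - Y) * (x1 - x0))); last by ring.
apply: le_trans (ler_normD _ _) _.
have := ler_normB ((x0 - X) * (y1 - y0)) ((y0 - Y) * (x1 - x0)).
rewrite !normrM => h.
have h1 : `|x0 - X| * `|y1 - y0| <= P / 2 ^+ N * (P / 2 ^+ n) by exact: ler_pM.
have h2 : `|y0 - Y| * `|x1 - x0| <= P / 2 ^+ N * (P / 2 ^+ n) by exact: ler_pM.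
rewrite E; lra.
Qed.

(** The two points share all corners up to generation [N], so the first [N] terms cancel. The tails
    cost [4 p^2] each by [grid_section_partial], and replacing the common corner by [(x', y')] in
    the linear part costs [2 p^2]: hence 10. *)
Theorem grid_section_increment P N x y x' y' : 0 < P ->
  grid_index P N x = grid_index P N x' -> grid_index P N y = grid_index P N y' ->
  `|grid_section P x y - grid_section P x' y' - (x' * y - y' * x)| <= 10 * (P / 2 ^+ N) ^+ 2.
Proof.
move=> P0 xx yy; set p := P / 2 ^+ N.
have p0 : 0 < p by rewrite divr_gt0// exprn_gt0.
have Xx n : (n <= N)%N -> grid_point P n x = grid_point P n x'.
  by move=> nN; rewrite /grid_point (grid_index_coarse nN xx).
have Yy n : (n <= N)%N -> grid_point P n y = grid_point P n y'.
  by move=> nN; rewrite /grid_point (grid_index_coarse nN yy).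
have SN : series (grid_section_term P x y) N = series (grid_section_term P x' y') N.
  rewrite /series/= !big_mkord; apply: eq_bigr => -[n nN] _ /=.
  by rewrite /grid_section_term !Xx ?Yy// ltnW.
pose X := grid_point P N x; pose Y := grid_point P N y.
pose S n := series (grid_section_term P x y) n; pose S' n := series (grid_section_term P x' y') n.
pose f n := S n - S' n - (X * (grid_point P n y - grid_point P n y') -
  Y * (grid_point P n x - grid_point P n x')).
have fle k : `|f (N + k)%N| <= 8 * p ^+ 2.
  have h := grid_section_partial N k x y P0; have h' := grid_section_partial N k x' y' P0.
  rewrite -/p in h h'.
  have pk : 0 < P / 2 ^+ (N + k) by rewrite divr_gt0// exprn_gt0.
  have b : 4 * p * (p - P / 2 ^+ (N + k)) <= 4 * p ^+ 2.
    rewrite -subr_ge0 (_ : _ - _ = 4 * p * (P / 2 ^+ (N + k))); last by ring.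
    by rewrite !mulr_ge0// ltW.
  rewrite -SN -(Xx N (leqnn _)) -(Yy N (leqnn _)) in h'.
  rewrite (_ : f _ = (S (N + k)%N - S N - (X * (grid_point P (N + k) y - Y) -
      Y * (grid_point P (N + k) x - X))) - (S' (N + k)%N - S N -
      (X * (grid_point P (N + k) y' - Y) - Y * (grid_point P (N + k) x' - X)))).
    apply: le_trans (ler_normB _ _) _; apply: le_trans (lerD h h') _; lra.
  by rewrite /f; ring.
have fcvg : `|f n| @[n --> \oo] -->
    `|grid_section P x y - grid_section P x' y' - (X * (y - y') - Y * (x - x'))|.
  apply: cvg_norm; apply: cvgB.
    by apply: cvgB; exact: grid_section_cvg.
  by apply: cvgB; apply: cvgM; (try exact: cvg_cst); apply: cvgB; exact: grid_point_cvg.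
have main : `|grid_section P x y - grid_section P x' y' - (X * (y - y') - Y * (x - x'))| <= 8 * p ^+ 2.
  apply: (cvgr_to_le fcvg); exists N => // n /= Nn.
  by rewrite -(subnKC Nn); exact: fle.
have Xd : `|X - x'| <= p.
  by rewrite /X (Xx N (leqnn _)) distrC; exact: grid_point_dist.
have Yd : `|Y - y'| <= p.
  by rewrite /Y (Yy N (leqnn _)) distrC; exact: grid_point_dist.
have xd : `|x - x'| <= p by exact: grid_dist.
have yd : `|y - y'| <= p by exact: grid_dist.
rewrite (_ : _ - _ = grid_section P x y - grid_section P x' y' - (X * (y - y') - Y * (x - x')) +
  ((X - x') * (y - y') - (Y - y') * (x - x'))); last by ring.
apply: le_trans (ler_normD _ _) _.
have h := ler_normB ((X - x') * (y - y')) ((Y - y') * (x - x')).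
rewrite !normrM in h.
have h1 : `|X - x'| * `|y - y'| <= p * p by exact: ler_pM.
have h2 : `|Y - y'| * `|x - x'| <= p * p by exact: ler_pM.
rewrite expr2 in main *; lra.
Qed.

End dyadic_grid.

(** * The Haar measure of sheared boxes *)

Section boxes.
Context (R : realType).
Local Notation Rm := (measurableTypeR R).

Definition tuple_box n (lo hi : 'I_n -> R) : set (n.-tuple Rm) :=
  [set t | forall i, lo i <= tnth t i < hi i].

Lemma measurable_tuple_box n (lo hi : 'I_n -> R) : measurable (tuple_box lo hi).
Proof.
rewrite (_ : tuple_box lo hi = \big[setI/setT]_(i < n) ((@tnth n Rm)^~ i @^-1` `[lo i, hi i[)).
  apply: bigsetI_measurable => i _; rewrite -[X in measurable X]setTI.
  exact: measurable_tnth.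
apply/seteqP; split=> t /=.
  by move=> tb; elim/big_ind : _ => //= i _; rewrite in_itv/= tb.
move=> tb i; move: tb; rewrite (bigD1 i)//= => -[+ _].
by rewrite in_itv.
Qed.

Lemma lebesgue_tuple_box n (lo hi : 'I_n -> R) : (forall i, lo i <= hi i) ->
  lebesgue_tuple R n (tuple_box lo hi) = (\prod_i (hi i - lo i))%:E.
Proof.
elim: n lo hi => [|n ih] lo hi lohi.
  rewrite big_ord0 /= diracE mem_set//; by case.
rewrite big_ord_recl EFinM.
pose lo' i := lo (lift ord0 i); pose hi' i := hi (lift ord0 i).
have E : tuple_consp (n := n) @^-1` tuple_box lo hi =
    `[lo ord0, hi ord0[%classic `*` tuple_box lo' hi'.
  apply/seteqP; split=> -[x t] /=.
    move=> tb; split; first by have := tb ord0; rewrite in_itv.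
    by move=> i; have := tb (lift ord0 i); rewrite tnthS.
  move=> [x0 tb] i; case: (unliftP ord0 i) => [j ->|->]; first by rewrite tnthS; exact: tb.
  by rewrite tnth0; move: x0; rewrite in_itv.
rewrite -[LHS]/((lebesgue_measure \x lebesgue_tuple R n)%E (tuple_consp (n := n) @^-1` tuple_box lo hi)).
rewrite E product_measure1E//; last exact: measurable_tuple_box.
rewrite ih; last by move=> i; exact: lohi.
congr (_ * _)%E; apply: (etrans (lebesgue_measure_itv `[lo ord0, hi ord0[)).
rewrite /= lte_fin; case: ltP => // h; have h' := lohi ord0.
by have -> : hi ord0 = lo ord0; [apply/eqP; rewrite eq_le h h'|rewrite subrr].
Qed.

Lemma measurable_inv_itv (al be : R) : 0 < al ->
  measurable_fun `[al, be[ (fun x : R => x^-1).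
Proof.
move=> al0; apply: (@measurable_funS _ _ _ _ `[al, be]) => //.
  by apply: subset_itvl; rewrite bnd_simp.
apply: subspace_continuous_measurable_fun => //.
apply: continuous_in_subspaceT => x; rewrite inE/= in_itv/= => /andP[ax _].
by apply: inv_continuous; rewrite gt_eqF// (lt_le_trans al0).
Qed.

Lemma integral_inv_itv (al be : R) : 0 < al -> al < be ->
  (\int[lebesgue_measure]_(x in `[al, be[) (x^-1)%:E = (ln be - ln al)%:E)%E.
Proof.
move=> al0 ab.
have cinv : {within `[al, be], continuous (fun x : R => x^-1)}.
  apply: continuous_in_subspaceT => x; rewrite inE/= in_itv/= => /andP[ax _].
  by apply: inv_continuous; rewrite gt_eqF// (lt_le_trans al0).
have cln x : al <= x -> {for x, continuous (@ln R)}.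
  by move=> ax; apply: continuous_ln; exact: lt_le_trans ax.
rewrite integral_itv_bndo_bndc; last by apply/measurable_EFinP; exact: measurable_inv_itv.
rewrite (@continuous_FTC2 _ (fun x : R => x^-1) (@ln R))//.
- split.
  + move=> x; rewrite in_itv/= => /andP[ax _].
    by case: (is_derive1_ln (lt_trans al0 ax)).
  + by apply: cvg_at_right_filter; exact: cln.
  + by apply: cvg_at_left_filter; apply: cln; exact: ltW.
- move=> x; rewrite in_itv/= => /andP[ax _]; rewrite derive1E.
  by case: (is_derive1_ln (lt_trans al0 ax)).
Qed.

Lemma measurable_shear m k (A : set (m.-tuple Rm)) (psi : 'I_k -> m.-tuple Rm -> R)
    (lo hi : 'I_k -> R) : measurable A -> (forall t, measurable_fun setT (psi t)) ->
  measurable [set q : m.-tuple Rm * k.-tuple Rm | A q.1 /\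
    forall t, lo t <= tnth q.2 t - psi t q.1 < hi t].
Proof.
move=> mA mpsi.
rewrite (_ : [set _ | _] = (fst @^-1` A) `&`
  \big[setI/setT]_(t < k)
    ((fun q : m.-tuple Rm * k.-tuple Rm => tnth q.2 t - psi t q.1) @^-1` `[lo t, hi t[)).
  apply: measurableI.
    by rewrite -[X in measurable X]setTI; exact: measurable_fst.
  apply: bigsetI_measurable => t _; rewrite -[X in measurable X]setTI.
  have : measurable_fun setT (fun q : m.-tuple Rm * k.-tuple Rm => tnth q.2 t - psi t q.1).
    apply: measurable_funB.
      exact: (measurableT_comp (measurable_tnth t) measurable_snd).
    exact: (measurableT_comp (mpsi t) measurable_fst).
  by apply => //; exact: measurable_itv.
apply/seteqP; split=> q /=.
  move=> [Aq tb]; split=> //.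
  by elim/big_ind : _ => //= i _; rewrite in_itv/= tb.
move=> [Aq tb]; split=> // i; move: tb; rewrite (bigD1 i)//= => -[+ _].
by rewrite in_itv.
Qed.

(** Its sections over the first factor are translates of one box, so the shear, however irregular,
    does not change the measure. *)
Lemma measure_shear m k (A : set (m.-tuple Rm)) (psi : 'I_k -> m.-tuple Rm -> R)
    (lo hi : 'I_k -> R) : measurable A -> (forall t, measurable_fun setT (psi t)) ->
  (forall t, lo t <= hi t) ->
  (lebesgue_tuple R m \x lebesgue_tuple R k)%E [set q | A q.1 /\
    forall t, lo t <= tnth q.2 t - psi t q.1 < hi t] =
  (lebesgue_tuple R m A * (\prod_t (hi t - lo t))%:E)%E.
Proof.
move=> mA mpsi lohi; rewrite /product_measure1.
transitivity (\int[lebesgue_tuple R m]_x ((\prod_t (hi t - lo t))%:E * (\1_A x)%:E)%E)%E.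
  apply: eq_integral => x _ /=; rewrite indicE.
  have [Ax|nAx] := boolP (x \in A); last first.
    rewrite mule0 (_ : xsection _ _ = set0) ?measure0//.
    apply/seteqP; split=> // z; rewrite /xsection/= inE/= => -[Ax _].
    by move/negP: nAx; apply; rewrite inE.
  rewrite mule1 (_ : xsection _ _ = tuple_box (fun t => lo t + psi t x) (fun t => hi t + psi t x)).
    rewrite lebesgue_tuple_box; last by move=> t; rewrite lerD2r.
    by congr EFin; apply: eq_bigr => t _; ring.
  apply/seteqP; split=> z; rewrite /xsection/= inE/=.
    by move=> [_ h] t; have := h t; rewrite lerBrDr ltrBlDr.
  by move=> h; split=> [|t]; [move: Ax; rewrite inE|have := h t; rewrite lerBrDr ltrBlDr].
rewrite ge0_integralZl//.
- by rewrite integral_indic// setIT muleC.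
- by apply/measurable_EFinP; exact: measurable_indic.
- by rewrite lee_fin prodr_ge0// => t _; rewrite subr_ge0.
Qed.

End boxes.

Lemma integral_slab (R : realType) d (T : measurableType d)
    (M : {sigma_finite_measure set T -> \bar R}) (G : set T) (h : measurableTypeR R -> R) :
  measurable G -> measurable_fun setT h -> (forall a, 0 <= h a) ->
  (\int[M \x (@lebesgue_measure R)]_p ((\1_G p.1)%:E * (h p.2)%:E) =
   M G * \int[@lebesgue_measure R]_a (h a)%:E)%E.
Proof.
move=> mG mh h0.
pose f (p : T * measurableTypeR R) : \bar R := ((\1_G p.1)%:E * (h p.2)%:E)%E.
have mf : measurable_fun setT f.
  apply: emeasurable_funM; apply/measurable_EFinP.
    by apply: (measurableT_comp _ measurable_fst); exact: measurable_indic.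
  exact: (measurableT_comp mh measurable_snd).
have f0 p : (0 <= f p)%E by rewrite /f mule_ge0// lee_fin.
transitivity (\int[M]_q \int[@lebesgue_measure R]_y f (q, y))%E.
  exact: fubini_tonelli1.
transitivity (\int[M]_q ((\1_G q)%:E * \int[@lebesgue_measure R]_a (h a)%:E))%E.
  apply: eq_integral => q _; rewrite /f/= ge0_integralZl_EFin//.
  + by move=> y _; rewrite lee_fin.
  + exact/measurable_EFinP.
rewrite ge0_integralZr//.
- by rewrite integral_indic// setIT.
- by apply/measurable_EFinP; exact: measurable_indic.
- by apply: integral_ge0 => a _; rewrite lee_fin.
Qed.

Section product_sigma_finite.
Context (R : realType) d1 d2 (T1 : measurableType d1) (T2 : measurableType d2).
Context (m1 : {sigma_finite_measure set T1 -> \bar R}).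
Context (m2 : {sigma_finite_measure set T2 -> \bar R}).
Local Open Scope ereal_scope.

Lemma sigma_finite_product : sigma_finite setT (m1 \x m2).
Proof.
have /sigma_finiteP[F [FT ndF Ffin]] := sigma_finiteT m1.
have /sigma_finiteP[G [GT ndG Gfin]] := sigma_finiteT m2.
exists (fun i => F i `*` G i).
  apply/esym/seteqP; split=> // -[x y] _.
  have [i _ Fi] : (\bigcup_i F i) x by rewrite -FT.
  have [j _ Gj] : (\bigcup_i G i) y by rewrite -GT.
  exists (maxn i j) => //; split.
    by move: Fi; exact/subsetPset/ndF/leq_maxl.
  by move: Gj; exact/subsetPset/ndG/leq_maxr.
move=> i; have [mF Foo] := Ffin i; have [mG Goo] := Gfin i.
split; first exact: measurableX.
by rewrite product_measure1E// lte_mul_pinfty// ge0_fin_numE.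
Qed.

(** Makes the measure on the coordinates of [(X, Z)] a sigma-finite factor to which Tonelli applies
    in [integral_slab]. *)
Definition product_sigma_finite_measure : {sigma_finite_measure set (T1 * T2)%type -> \bar R} :=
  HB.pack (m1 \x m2) (Measure_isSigmaFinite.Build _ _ _ (m1 \x m2) sigma_finite_product).

End product_sigma_finite.

Section haar_slab.
Context (R : realType) (L : htypeAlgebra R).
Local Notation S := (damekRicci L).
Local Notation Rm := (measurableTypeR R).
Local Notation m := (\dim {:subvs_of (ht_v L)}).
Local Notation k := (\dim {:subvs_of (ht_z L)}).

(** The density [a^-1] becomes Lebesgue measure in the variable [ln a], which is why heights are
    measured there. *)
Lemma dr_haar_slab (G : set (m.-tuple Rm * k.-tuple Rm)) (al be : R) :
  measurable G -> 0 < al -> al < be ->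
  @dr_haar R L [set p | G (dr_coord p).1 /\ al <= (dr_a p)%:num < be] =
  ((lebesgue_tuple R m \x lebesgue_tuple R k) G * (ln be - ln al)%:E)%E.
Proof.
move=> mG al0 ab; rewrite /dr_haar.
have -> : dr_coord (L := L) @` [set p | G (dr_coord p).1 /\ al <= (dr_a p)%:num < be] =
    G `*` `[al, be[%classic.
  apply/seteqP; split=> [_ [p [Gp ap] <-]|[q a] [Gq /=]]; first by split=> //=; rewrite in_itv.
  rewrite in_itv/= => /andP[aa ab'].
  have : range (@dr_coord R L) (q, a) by rewrite range_dr_coord /= (lt_le_trans al0).
  move=> [p _ pE]; exists p => //.
  have pq : (dr_coord p).1 = q by rewrite pE.
  have pa : (dr_a p)%:num = a := congr1 snd pE.
  have Gp : G (dr_coord p).1 by rewrite pq.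
  by split; [exact: Gp|rewrite pa aa].
rewrite integral_mkcond.
pose h (a : Rm) : R := ((fun x : R => x^-1) \_ `[al, be[%classic) a.
have mh : measurable_fun setT h.
  by apply/(measurable_restrictT _ (measurable_itv `[al, be[)); exact: measurable_inv_itv.
have h0 a : 0 <= h a.
  rewrite /h patchE; case: ifPn => //; rewrite inE/= in_itv/= => /andP[aa _].
  by rewrite invr_ge0 (le_trans (ltW al0)).
have hE : (\int[lebesgue_measure]_y (h y)%:E = (ln be - ln al)%:E)%E.
  rewrite -integral_inv_itv// [RHS]integral_mkcond; apply: eq_integral => a _.
  by rewrite /h !patchE; case: ifP.
pose M := product_sigma_finite_measure (lebesgue_tuple R m) (lebesgue_tuple R k).
rewrite -hE; apply: etrans (integral_slab M mG mh h0).
apply: eq_integral => -[q a] _; rewrite /h !patchE/= indicE.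
have -> : ((q, a) \in G `*` `[al, be[%classic) = (q \in G) && (a \in `[al, be[%classic).
  by apply/idP/andP; rewrite !inE.
by case: (q \in G); case: (a \in `[al, be[%classic); rewrite /= ?mul1e ?mul0e.
Qed.

End haar_slab.

Section coordinate_forms.
Context (R : realType) (W : vectType R) (i : 'I_(\dim {:W})).
Implicit Types (x y : W) (a : R).

Lemma cdD x y : cd i (x + y) = cd i x + cd i y :> R. Proof. exact: linearD. Qed.

Lemma cdN x : cd i (- x) = - cd i x :> R. Proof. exact: linearN. Qed.

Lemma cdB x y : cd i (x - y) = cd i x - cd i y :> R. Proof. by rewrite cdD cdN. Qed.

Lemma cdZ a x : cd i (a *: x) = a * cd i x :> R. Proof. exact: linearZ. Qed.

End coordinate_forms.

(** * Tiles: measure, diameter and enlargement *)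

Section tiles.
Context (R : realType) (L : htypeAlgebra R).
Local Notation V := (subvs_of (ht_v L)).
Local Notation Z := (subvs_of (ht_z L)).
Local Notation S := (damekRicci L).
Local Notation Rm := (measurableTypeR R).
Local Notation m := (\dim {:V}).
Local Notation k := (\dim {:Z}).
Local Notation mu := (@dr_haar R L).
Local Notation "p *g q" := (dr_mul p q) (at level 40, left associativity).

Lemma tnth_vtuple (W : vectType R) (X : W) i : tnth (vtuple X) i = cd i X.
Proof. by rewrite tnth_mktuple. Qed.

(** The [phi] of the overview in coordinates: [grid_section] replaces the antisymmetric expressions
    of [cd_bracket], halved once more for the factor 1/2 of the group law. *)
Definition shear_tuple (P : R) (t : 'I_k) (x : m.-tuple Rm) : R :=
  \sum_(i < m) \sum_(j < m) 2^-1 * dr_structure t i j * grid_section P (tnth x i) (tnth x j).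

Definition dr_shear P t (X : V) : R := shear_tuple P t (vtuple X).

Lemma measurable_shear_tuple P t : 0 < P -> measurable_fun setT (shear_tuple P t).
Proof.
move=> P0; apply: measurable_sum => i; apply: measurable_sum => j.
apply: measurable_funM => //.
by apply: measurable_grid_section => //; exact: measurable_tnth.
Qed.

Lemma dr_shear_increment : exists2 C : R, 0 <= C & forall P n X Y t, 0 < P ->
  (forall i, grid_index P n (cd i X) = grid_index P n (cd i Y)) ->
  `|dr_shear P t X - dr_shear P t Y - 2^-1 * cd t (dr_bracket Y X)| <= C * (P / 2 ^+ n) ^+ 2.
Proof.
pose C (t : 'I_k) : R := \sum_(i < m) \sum_(j < m) `|2^-1 * dr_structure t i j| * 10.
have C0 t : 0 <= C t.
  by apply: sumr_ge0 => i _; apply: sumr_ge0 => j _; rewrite mulr_ge0.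
exists (\sum_t C t); first exact: sumr_ge0.
move=> P n X Y t P0 XY.
apply: (@le_trans _ _ (C t * (P / 2 ^+ n) ^+ 2)); last first.
  by rewrite ler_wpM2r ?sqr_ge0// (bigD1 t)//= lerDl sumr_ge0.
rewrite cd_bracket /dr_shear /shear_tuple mulr_sumr -!sumrB mulr_suml.
apply: le_trans (ler_norm_sum _ _ _) _; apply: ler_sum => i _.
rewrite mulr_sumr -!sumrB mulr_suml.
apply: le_trans (ler_norm_sum _ _ _) _; apply: ler_sum => j _.
rewrite !tnth_vtuple (_ : _ - _ - _ = 2^-1 * dr_structure t i j *
  (grid_section P (cd i X) (cd j X) - grid_section P (cd i Y) (cd j Y) -
   (cd i Y * cd j X - cd j Y * cd i X))); last by ring.
rewrite normrM -mulrA ler_wpM2l//.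
exact: grid_section_increment.
Qed.

(** [P], [Q], [H] are the sides of the top tile and [i], [l], [j] count their halvings. The shear
    involves [P] but not [i]: it stays the same at all generations, so that nestedness is that of
    the grids. *)
Definition dr_tile P Q H i l j (p0 : S) : set S := [set p |
  [/\ forall s, grid_index P i (cd s (dr_X p)) = grid_index P i (cd s (dr_X p0)),
      forall t, grid_index Q l (cd t (dr_Z p) - dr_shear P t (dr_X p)) =
                grid_index Q l (cd t (dr_Z p0) - dr_shear P t (dr_X p0))
    & grid_index H j (ln (dr_a p)%:num) = grid_index H j (ln (dr_a p0)%:num)]].

Lemma dr_tile_refl P Q H i l j p0 : dr_tile P Q H i l j p0 p0. Proof. by []. Qed.

Lemma measurable_slab (G : set (m.-tuple Rm * k.-tuple Rm)) (al be : R) : measurable G ->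
  measurable ([set p : S | G (dr_coord p).1 /\ al <= (dr_a p)%:num < be]).
Proof.
move=> mG; exists (G `*` `[al, be[%classic).
  by apply: measurableX => //; exact: measurable_itv.
rewrite setTI; apply/seteqP; split=> p [Gp /=]; rewrite in_itv/= => ap; by split.
Qed.

Definition shear_box (lo hi : 'I_m -> R) (psi : 'I_k -> m.-tuple Rm -> R) (lo' hi' : 'I_k -> R) :=
  [set q : m.-tuple Rm * k.-tuple Rm | tuple_box lo hi q.1 /\
    forall t, lo' t <= tnth q.2 t - psi t q.1 < hi' t].

Lemma dr_haar_shear_box lo hi psi lo' hi' al be :
  (forall t, measurable_fun setT (psi t)) ->
  (forall i, lo i <= hi i) -> (forall t, lo' t <= hi' t) -> 0 < al -> al < be ->
  mu [set p | shear_box lo hi psi lo' hi' (dr_coord p).1 /\ al <= (dr_a p)%:num < be] =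
  ((\prod_i (hi i - lo i)) * (\prod_t (hi' t - lo' t)) * (ln be - ln al))%:E.
Proof.
move=> mpsi lohi lohi' al0 ab.
rewrite dr_haar_slab//; last by apply: measurable_shear => //; exact: measurable_tuple_box.
by rewrite measure_shear//; [rewrite lebesgue_tuple_box|exact: measurable_tuple_box].
Qed.

Lemma dr_tileE P Q H i l j p0 : 0 < P -> 0 < Q -> 0 < H ->
  let p := P / 2 ^+ i in let q := Q / 2 ^+ l in let h := H / 2 ^+ j in
  let kx s : R := (grid_index P i (cd s (dr_X p0)))%:~R in
  let kz t : R := (grid_index Q l (cd t (dr_Z p0) - dr_shear P t (dr_X p0)))%:~R in
  let ka : R := (grid_index H j (ln (dr_a p0)%:num))%:~R in
  dr_tile P Q H i l j p0 = [set y | shear_box (fun s => p * kx s) (fun s => p * (kx s + 1))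
    (fun t => shear_tuple P t) (fun t => q * kz t) (fun t => q * (kz t + 1)) (dr_coord y).1 /\
    expR (h * ka) <= (dr_a y)%:num < expR (h * (ka + 1))].
Proof.
move=> P0 Q0 H0 p q h kx kz ka.
have aE (c : R) (y : S) : (expR c <= (dr_a y)%:num) = (c <= ln (dr_a y)%:num).
  by rewrite -{1}[(dr_a y)%:num]lnK ?posrE// ler_expR.
have aE' (c : R) (y : S) : ((dr_a y)%:num < expR c) = (ln (dr_a y)%:num < c).
  by rewrite -{1}[(dr_a y)%:num]lnK ?posrE// ltr_expR.
have gE G n x y : 0 < G -> grid_index G n x = grid_index G n y <->
    G / 2 ^+ n * (grid_index G n y)%:~R <= x < G / 2 ^+ n * ((grid_index G n y)%:~R + 1).
  by move=> G0; rewrite grid_index_floorP// intrD.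
apply/seteqP; split=> y.
  move=> [h1 h2 h3]; split; first split.
  - by move=> s; rewrite /dr_coord/= tnth_vtuple; exact/gE.
  - by move=> t; rewrite /dr_coord/= tnth_vtuple; exact/gE.
  - by rewrite aE aE'; exact/gE.
move=> [[h1 h2] h3]; split.
- by move=> s; apply/gE => //; have := h1 s; rewrite /dr_coord/= tnth_vtuple.
- by move=> t; apply/gE => //; have := h2 t; rewrite /dr_coord/= tnth_vtuple.
- by apply/gE => //; move: h3; rewrite aE aE'.
Qed.

Lemma measurable_dr_tile P Q H i l j p0 : 0 < P -> 0 < Q -> 0 < H ->
  measurable (dr_tile P Q H i l j p0).
Proof.
move=> P0 Q0 H0; rewrite dr_tileE//; apply: measurable_slab.
apply: measurable_shear; first exact: measurable_tuple_box.
by move=> t; exact: measurable_shear_tuple.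
Qed.

Lemma dr_haar_tile P Q H i l j p0 : 0 < P -> 0 < Q -> 0 < H ->
  mu (dr_tile P Q H i l j p0) =
  ((P / 2 ^+ i) ^+ m * (Q / 2 ^+ l) ^+ k * (H / 2 ^+ j))%:E.
Proof.
move=> P0 Q0 H0; rewrite dr_tileE//.
have p0' G n : 0 < G -> 0 < G / 2 ^+ n :> R by move=> G0; rewrite divr_gt0// exprn_gt0.
rewrite dr_haar_shear_box.
- congr EFin; congr (_ * _ * _).
  + by rewrite -[in RHS](card_ord m) -prodr_const; apply: eq_bigr => s _; ring.
  + by rewrite -[in RHS](card_ord k) -prodr_const; apply: eq_bigr => t _; ring.
  + by rewrite !expRK; ring.
- by move=> t; exact: measurable_shear_tuple.
- by move=> s; rewrite ler_pM2l ?p0'// lerDl.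
- by move=> t; rewrite ler_pM2l ?p0'// lerDl.
- exact: expR_gt0.
- by rewrite ltr_expR ltr_pM2l ?p0'// ltrDl.
Qed.

Lemma cd_X_quotient (p y : S) i : cd i (dr_X (dr_inv p *g y)) =
  (Num.sqrt (dr_a p)%:num)^-1 * (cd i (dr_X y) - cd i (dr_X p)).
Proof. by rewrite dr_XM /= sqrtrV// cdD cdN !cdZ; ring. Qed.

Lemma cd_Z_quotient (p y : S) t : cd t (dr_Z (dr_inv p *g y)) =
  (dr_a p)%:num^-1 * (cd t (dr_Z y) - cd t (dr_Z p) - 2^-1 * cd t (dr_bracket (dr_X p) (dr_X y))).
Proof.
have sa : (Num.sqrt (dr_a p)%:num)^-1 * (Num.sqrt (dr_a p)%:num)^-1 = (dr_a p)%:num^-1.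
  by rewrite -invfM -expr2 sqr_sqrtr.
rewrite dr_ZM /= sqrtrV// dr_bracketNl dr_bracketZl scalerN scalerA.
by rewrite cdB cdD cdN !cdZ -[in RHS]sa -{1 2}sa; ring.
Qed.

(** [p] and [q] are sides rescaled to height 0. The exponents of the lower bounds come from
    [dr_dist_lower] at radius [h] and height at most [h]: [h / 2 + h / 2] for [X] and [h + 2 h] for
    [Z]. The upper bounds feed [dr_dist_upper] with [c = 6]. The last condition makes the bracket
    errors, of order [p^2], comparable to [q]. *)
Definition admissible (h p q : R) : Prop :=
  [/\ h * expR h <= p, h * expR (3 * h) <= q, p <= 4 * (h * expR (6 * h)),
      q <= 4 * (h * expR (6 * h)) & p ^+ 2 <= 4 * q].

Lemma abs_le_itv (x c e : R) : 0 < e -> `|x - c| <= e -> c - e <= x < c + 2 * e.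
Proof. by rewrite ler_norml => e0 /andP[h1 h2]; apply/andP; split; lra. Qed.

Lemma abs_le_itv_widen (x y u h : R) : u <= y < u + h -> `|x - y| <= h ->
  u - h <= x < u + 3 * h.
Proof.
by rewrite ler_norml => /andP[h1 h2] /andP[h3 h4]; apply/andP; split; lra.
Qed.

Lemma ln_a_sqrt (y : S) : Num.sqrt (dr_a y)%:num = expR (ln (dr_a y)%:num / 2).
Proof. by rewrite -sqrt_expR lnK// posrE. Qed.

Lemma ln_a_expR (y : S) : (dr_a y)%:num = expR (ln (dr_a y)%:num).
Proof. by rewrite lnK// posrE. Qed.

Section tile_geometry.
Variables (P Q H : R) (i l j : nat) (p0 : S).
Hypotheses (P0 : 0 < P) (Q0 : 0 < Q) (H0 : 0 < H).
Let p := P / 2 ^+ i.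
Let q := Q / 2 ^+ l.
Let h := H / 2 ^+ j.
Let u := grid_point H j (ln (dr_a p0)%:num).
Hypothesis adm : admissible h (p * expR (- (u / 2))) (q * expR (- u)).

Let p_gt0 : 0 < p. Proof. by rewrite divr_gt0// exprn_gt0. Qed.
Let q_gt0 : 0 < q. Proof. by rewrite divr_gt0// exprn_gt0. Qed.
Let h_gt0 : 0 < h. Proof. by rewrite divr_gt0// exprn_gt0. Qed.

Lemma admissible_sqr : p ^+ 2 <= 4 * q.
Proof.
have [_ _ _ _] := adm.
have -> : (p * expR (- (u / 2))) ^+ 2 = p ^+ 2 * expR (- u).
  by rewrite exprMn (expr2 (expR _)) -expRD; congr (_ * expR _); field.
by rewrite mulrA ler_pM2r// expR_gt0.
Qed.

Lemma tile_ln_a y : dr_tile P Q H i l j p0 y -> u <= ln (dr_a y)%:num < u + h.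
Proof.
move=> [_ _ ay]; have [h1 h2] := grid_pointP j (ln (dr_a y)%:num) H0.
by move: h1 h2; rewrite /grid_point ay -/(grid_point H j (ln (dr_a p0)%:num)) -/u -/h => -> ->.
Qed.

Lemma tile_X y s : dr_tile P Q H i l j p0 y -> `|cd s (dr_X y) - cd s (dr_X p0)| <= p.
Proof. by move=> [xy _ _]; exact: grid_dist. Qed.

(** The quantity bounded is the [Z] part of [p0^-1 y] before rescaling. On the dyadic cube of the
    tile the shear equals the bracket term up to [C p^2 <= 4 C q], and the grid contributes [q]. *)
Lemma tile_Z (C : R) y t : 0 <= C -> (forall P n X Y t, 0 < P ->
    (forall i, grid_index P n (cd i X) = grid_index P n (cd i Y)) ->
    `|dr_shear P t X - dr_shear P t Y - 2^-1 * cd t (dr_bracket Y X)| <= C * (P / 2 ^+ n) ^+ 2) ->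
  dr_tile P Q H i l j p0 y ->
  `|cd t (dr_Z y) - cd t (dr_Z p0) - 2^-1 * cd t (dr_bracket (dr_X p0) (dr_X y))| <= (1 + 4 * C) * q.
Proof.
move=> C0 CP [xy zy _].
have h1 := grid_dist Q0 (zy t); have h2 := CP P i (dr_X y) (dr_X p0) t P0 xy.
rewrite (_ : _ - _ = cd t (dr_Z y) - dr_shear P t (dr_X y) -
  (cd t (dr_Z p0) - dr_shear P t (dr_X p0)) + (dr_shear P t (dr_X y) -
  dr_shear P t (dr_X p0) - 2^-1 * cd t (dr_bracket (dr_X p0) (dr_X y)))); last by ring.
apply: le_trans (ler_normD _ _) _; apply: le_trans (lerD h1 h2) _.
rewrite -/p -/q mulrDl mul1r lerD2l (mulrC 4) -mulrA ler_wpM2l//.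
exact: admissible_sqr.
Qed.

(** Points of the tile have [a >= e^u], so the coordinates of [p0^-1 y] are bounded by the rescaled
    sides; the assumption on [K] is what [dr_dist_upper] provides. *)
Lemma tile_sub_ball (C K : R) : 0 <= C -> (forall P n X Y t, 0 < P ->
    (forall i, grid_index P n (cd i X) = grid_index P n (cd i Y)) ->
    `|dr_shear P t X - dr_shear P t Y - 2^-1 * cd t (dr_bracket Y X)| <= C * (P / 2 ^+ n) ^+ 2) ->
  (forall g r, 0 <= r -> `|ln (dr_a g)%:num| <= r ->
    (forall i, `|cd i (dr_X g)| <= (4 * (1 + 4 * C)) * (r * expR (6 * r))) ->
    (forall t, `|cd t (dr_Z g)| <= (4 * (1 + 4 * C)) * (r * expR (6 * r))) ->
    dr_dist (dr_one L) g <= K * r) ->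
  dr_tile P Q H i l j p0 `<=` dball (@dr_dist R L) p0 ((K + 1) * h).
Proof.
move=> C0 CP Kd y yt; rewrite /dball/= dr_dist1.
have [a1 a2 p4 q4 _] := adm.
have C1 : 1 <= 1 + 4 * C by lra.
have /andP[u1 _] := tile_ln_a (dr_tile_refl P Q H i l j p0).
have hE0 : 0 <= h * expR (6 * h) by rewrite mulr_ge0 ?expR_ge0// ltW.
(* The bound [K * h] is not strict, and [dball] is open: hence [K + 1]. *)
apply: (@le_lt_trans _ _ (K * h)); last by rewrite mulrDl mul1r ltrDl.
apply: Kd; first exact: ltW.
- rewrite /= lnM ?posrE// lnV ?posrE//.
  have [_ _ ay] := yt; have := grid_dist H0 ay; by rewrite addrC -/h.
- move=> s; rewrite cd_X_quotient normrM ger0_norm ?invr_ge0// ln_a_sqrt -expRN.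
  apply: (@le_trans _ _ (expR (- (u / 2)) * p)).
    by apply: ler_pM; rewrite ?expR_ge0//; [rewrite ler_expR; lra|exact: tile_X].
  rewrite mulrC; apply: le_trans p4 _; rewrite -mulrA ler_wpM2l// ler_peMl//.
- move=> t; rewrite cd_Z_quotient normrM ger0_norm ?invr_ge0// {1}ln_a_expR -expRN.
  apply: (@le_trans _ _ (expR (- u) * ((1 + 4 * C) * q))).
    apply: ler_pM; rewrite ?expR_ge0//; [rewrite ler_expR; lra|exact: tile_Z].
  have -> : expR (- u) * ((1 + 4 * C) * q) = (1 + 4 * C) * (q * expR (- u)) by ring.
  have -> : 4 * (1 + 4 * C) * (h * expR (6 * h)) = (1 + 4 * C) * (4 * (h * expR (6 * h))) by ring.
  by rewrite ler_wpM2l//; lra.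
Qed.

(** The lower bounds of [admissible] say that moving by less than [h] shifts [X] by at most [D p]
    and [Z], up to the bracket, by at most [D q]. The enlargement thus fits in a sheared box with
    sides multiplied by constants. *)
Lemma tile_enlargement (C B D : R) : 0 <= C -> (forall P n X Y t, 0 < P ->
    (forall i, grid_index P n (cd i X) = grid_index P n (cd i Y)) ->
    `|dr_shear P t X - dr_shear P t Y - 2^-1 * cd t (dr_bracket Y X)| <= C * (P / 2 ^+ n) ^+ 2) ->
  0 <= B -> (forall X Y c c' t, 0 <= c -> 0 <= c' ->
    (forall i, `|cd i X| <= c) -> (forall i, `|cd i Y| <= c') ->
    `|cd t (@dr_bracket R L X Y)| <= B * (c * c')) ->
  1 <= D -> (forall g r, dr_dist (dr_one L) g < r ->
    [/\ `|ln (dr_a g)%:num| <= r, forall i, `|cd i (dr_X g)| <= D * (r * expR (r / 2))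
      & forall t, `|cd t (dr_Z g)| <= D * (r * expR (2 * r))]) ->
  exists W, [/\ measurable W, enlargement (@dr_dist R L) (dr_tile P Q H i l j p0) h `<=` W &
    mu W = ((3 * (1 + D)) ^+ m * (3 * (1 + 4 * C + D + 2 * B * D)) ^+ k * 4)%:E *
      mu (dr_tile P Q H i l j p0)]%E.
Proof.
move=> C0 CP B0 BP D1 DP; have D0 : 0 <= D by lra.
have [a1 a2 _ _ _] := adm.
(* [1 + 4 C] bounds the displacement inside the tile, [D] the one out of it, and [2 B D] half the
   bracket of the two: [B p (D p) / 2 <= 2 B D q]. *)
set E := 1 + 4 * C + D + 2 * B * D.
have E_gt0 : 0 < E by rewrite /E -!addrA ltr_pwDl// !addr_ge0 ?mulr_ge0.
have E0 := ltW E_gt0.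
(* The box is sheared by the linear function [[X0, X] / 2]: the increments of [dr_shear] are
   controlled only on the dyadic cube of the tile, which the enlargement leaves. *)
pose psi (t : 'I_k) (x : m.-tuple Rm) : R := \sum_(s < m) \sum_(s' < m) 2^-1 * dr_structure t s s' *
  (cd s (dr_X p0) * tnth x s' - cd s' (dr_X p0) * tnth x s).
have psiE t X : psi t (vtuple X) = 2^-1 * cd t (dr_bracket (dr_X p0) X).
  rewrite cd_bracket mulr_sumr; apply: eq_bigr => s _; rewrite mulr_sumr; apply: eq_bigr => s' _.
  by rewrite !tnth_vtuple -mulrA.
have mpsi t : measurable_fun setT (psi t).
  apply: measurable_sum => s; apply: measurable_sum => s'.
  apply: measurable_funM => //; apply: measurable_funB; apply: measurable_funM => //;
    exact: measurable_tnth.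
(* Half-open sides must contain the closed intervals of the estimates: the upper end is taken twice
   as far, which gives the factors 3. *)
pose lo s := cd s (dr_X p0) - (1 + D) * p; pose hi s := cd s (dr_X p0) + 2 * ((1 + D) * p).
pose lo' t := cd t (dr_Z p0) - E * q; pose hi' t := cd t (dr_Z p0) + 2 * (E * q).
exists [set y : S | shear_box lo hi psi lo' hi' (dr_coord y).1 /\
  expR (u - h) <= (dr_a y)%:num < expR (u + 3 * h)]; split.
- apply: measurable_slab; apply: measurable_shear => //; exact: measurable_tuple_box.
- move=> x /= /ereal_inf_lt[_ [y yt <-]]; rewrite lte_fin => dxy.
  have := dxy; rewrite dr_distC dr_dist1 => /DP[ga gx gz].
  have /andP[y1 y2] := tile_ln_a yt.
  have Dh0 e : 0 <= D * (h * expR e) by rewrite !mulr_ge0 ?expR_ge0// ltW.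
  have ga' : `|ln (dr_a x)%:num - ln (dr_a y)%:num| <= h.
    by move: ga; rewrite /= lnM ?posrE// lnV ?posrE// addrC.
  have xy s : `|cd s (dr_X x) - cd s (dr_X y)| <= D * p.
    have := gx s; rewrite cd_X_quotient normrM ger0_norm ?invr_ge0// ler_pdivrMl ?sqrtr_gt0//.
    move/le_trans; apply; rewrite ln_a_sqrt.
    apply: (@le_trans _ _ (expR ((u + h) / 2) * (D * (h * expR (h / 2))))).
      by rewrite ler_wpM2r// ler_expR ler_pM2r// ltW.
    rewrite (_ : _ * _ = D * (h * (expR ((u + h) / 2) * expR (h / 2)))); last by ring.
    rewrite -expRD ler_wpM2l// (_ : (u + h) / 2 + h / 2 = h + u / 2); last by field.
    rewrite expRD mulrA -ler_pdivlMr ?expR_gt0// -expRN; exact: a1.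
  have zy t : `|cd t (dr_Z x) - cd t (dr_Z y) - 2^-1 * cd t (dr_bracket (dr_X y) (dr_X x))| <= D * q.
    have := gz t; rewrite cd_Z_quotient normrM ger0_norm ?invr_ge0// ler_pdivrMl//.
    move/le_trans; apply; rewrite {1}ln_a_expR.
    apply: (@le_trans _ _ (expR (u + h) * (D * (h * expR (2 * h))))).
      by rewrite ler_wpM2r// ler_expR ltW.
    rewrite (_ : _ * _ = D * (h * (expR (u + h) * expR (2 * h)))); last by ring.
    rewrite -expRD ler_wpM2l// (_ : u + h + 2 * h = 3 * h + u); last by ring.
    rewrite expRD mulrA -ler_pdivlMr ?expR_gt0// -expRN; exact: a2.
  have Dp0 : 0 < D * p by rewrite mulr_gt0// (lt_le_trans ltr01 D1).
  split; first split.
  + move=> s; rewrite /dr_coord/= tnth_vtuple /lo /hi.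
    apply: abs_le_itv; first by rewrite mulr_gt0// ltr_pwDl.
    apply: le_trans (ler_distD (cd s (dr_X y)) _ _) _.
    by rewrite mulrDl mul1r addrC lerD ?tile_X.
  + move=> t; rewrite /dr_coord/= tnth_vtuple psiE.
    set beta := cd t (dr_bracket (dr_X p0) (dr_X x)).
    have bb : `|cd t (dr_bracket (dr_X y - dr_X p0) (dr_X x - dr_X y))| <= B * (p * (D * p)).
      by apply: BP; rewrite ?(ltW p_gt0) ?(ltW Dp0)// => s; rewrite cdB;
        [exact: tile_X|exact: xy].
    have bE : cd t (dr_bracket (dr_X y - dr_X p0) (dr_X x - dr_X y)) =
        cd t (dr_bracket (dr_X p0) (dr_X y)) + cd t (dr_bracket (dr_X y) (dr_X x)) - beta.
      have bNr X Y : dr_bracket X (- Y) = - dr_bracket X Y :> Z.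
        by rewrite dr_bracketC dr_bracketNl opprK dr_bracketC.
      rewrite dr_bracketDl dr_bracketNl !dr_bracketDr !bNr dr_bracketxx subr0 opprB.
      by rewrite /beta cdD cdB; ring.
    have b1 := tile_Z t C0 CP yt; have b2 := zy t.
    have pq := admissible_sqr.
    have bb' : `|cd t (dr_bracket (dr_X y - dr_X p0) (dr_X x - dr_X y))| <= 4 * B * D * q.
      apply: le_trans bb _.
      rewrite (_ : B * (p * (D * p)) = B * D * p ^+ 2); last by ring.
      rewrite (_ : 4 * B * D * q = B * D * (4 * q)); last by ring.
      by rewrite ler_wpM2l// mulr_ge0.
    (* Cocycle identity of the group law: the displacement from [p0] to [x] is that from [p0] to [y]
       plus that from [y] to [x] plus half the bracket of their horizontal parts. *)
    have main : `|cd t (dr_Z x) - 2^-1 * beta - cd t (dr_Z p0)| <= E * q.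
      rewrite (_ : _ - _ - _ = (cd t (dr_Z y) - cd t (dr_Z p0) -
          2^-1 * cd t (dr_bracket (dr_X p0) (dr_X y))) +
        (cd t (dr_Z x) - cd t (dr_Z y) - 2^-1 * cd t (dr_bracket (dr_X y) (dr_X x))) +
        2^-1 * cd t (dr_bracket (dr_X y - dr_X p0) (dr_X x - dr_X y))); last by rewrite bE; ring.
      apply: le_trans (ler_normD _ _) _.
      have -> : E * q = (1 + 4 * C) * q + D * q + 2 * B * D * q by rewrite /E; ring.
      apply: lerD; first exact: le_trans (ler_normD _ _) (lerD b1 b2).
      rewrite normrM ger0_norm ?invr_ge0// ler_pdivrMl//; apply: le_trans bb' _.
      by rewrite !mulrA -natrM.
    by apply: abs_le_itv; [rewrite mulr_gt0|exact: main].
  + rewrite (ln_a_expR x) ler_expR ltr_expR.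
    exact: abs_le_itv_widen (tile_ln_a yt) ga'.
- rewrite dr_haar_shear_box//.
  + rewrite dr_haar_tile// -/p -/q -/h -EFinM; congr EFin.
    have -> : \prod_(s < m) (hi s - lo s) = (3 * (1 + D)) ^+ m * p ^+ m.
      by rewrite -exprMn -[in RHS](card_ord m) -prodr_const; apply: eq_bigr => s _; rewrite /hi /lo; ring.
    have -> : \prod_(t < k) (hi' t - lo' t) = (3 * E) ^+ k * q ^+ k.
      by rewrite -exprMn -[in RHS](card_ord k) -prodr_const; apply: eq_bigr => t _; rewrite /hi' /lo'; ring.
    rewrite !expRK (_ : u + 3 * h - (u - h) = 4 * h); last by ring.
    by rewrite (mulrACA _ (p ^+ m)) [LHS]mulrACA.
  + by move=> s; rewrite /lo /hi lerD2l; apply: (@le_trans _ _ 0);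
      rewrite ?oppr_le0 !mulr_ge0// ?addr_ge0// ltW.
  + by move=> t; rewrite /lo' /hi' lerD2l; apply: (@le_trans _ _ 0);
      rewrite ?oppr_le0 !mulr_ge0// ltW.
  + exact: expR_gt0.
  + by rewrite ltr_expR ltrD2l; apply: (@lt_trans _ _ 0); rewrite ?oppr_lt0 ?mulr_gt0.
Qed.

End tile_geometry.
End tiles.

(** * Vertical strips and the order of halvings *)

Lemma grid_point_refine (R : realType) (P : R) n x : 0 < P ->
  grid_point P n x <= grid_point P n.+1 x /\
  grid_point P n.+1 x <= grid_point P n x + P / 2 ^+ n / 2.
Proof.
move=> P0; rewrite /grid_point; set k := grid_index P n x; set k' := grid_index P n.+1 x.
have p0 : 0 < P / 2 ^+ n by rewrite divr_gt0// exprn_gt0.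
have -> : P / 2 ^+ n.+1 = P / 2 ^+ n / 2 by rewrite exprSr invfM mulrA.
have xE : x * 2 ^+ n.+1 / P = 2 * (x * 2 ^+ n / P) by rewrite exprSr; ring.
have /andP[h1 h2] := floor_itv (x * 2 ^+ n / P).
rewrite -/(grid_index P n x) -/k intrD in h1 h2.
have k1 : (2 * k <= k')%R.
  by rewrite /k' /grid_index floor_ge_int xE intrM ler_pM2l.
have k2 : (k' <= 2 * k + 1)%R.
  by rewrite -ltzD1 /k' /grid_index floor_lt_int xE !intrD intrM; lra.
move: k1 k2; rewrite -!(ler_int R) intrD intrM; set a := k%:~R; set b := k'%:~R => k1 k2.
have e1 : P / 2 ^+ n * (2 * a) <= P / 2 ^+ n * b by rewrite ler_pM2l.
have e2 : P / 2 ^+ n * b <= P / 2 ^+ n * (2 * a + 1) by rewrite ler_pM2l.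
split; lra.
Qed.

Section strips.
Context (R : realType) (H : R).
Hypothesis H0 : 0 < H.
Implicit Types (s : R) (n : nat).

Lemma strip_rank_ex s : exists n, - 2 * (H * 2 ^+ n) <= s.
Proof.
have /archi_boundP : 0 <= `|s| / H by rewrite divr_ge0// ltW.
set N := Num.bound _ => sN; exists N.
have : (N%:R : R) <= 2 ^+ N by rewrite -natrX ler_nat ltnW// ltn_expl.
move=> N2; rewrite ltr_pdivrMr// in sN.
have h : `|s| < H * 2 ^+ N by apply: lt_le_trans sN _; rewrite mulrC ler_pM2l.
have := ler_norm (- s); rewrite normrN => h'; have := normr_ge0 s; lra.
Qed.

(* Below [- 2 H] the strips are [[-2h, -h)] with [h] a dyadic multiple of [H]:
   their height grows as [a] tends to [0], to keep the measure of the top tiles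
   bounded below. *)
Definition strip_rank s : nat := ex_minn (strip_rank_ex s).

Definition strip_top s : R := H * 2 ^+ strip_rank s.

Lemma strip_top_gt0 s : 0 < strip_top s.
Proof. by rewrite mulr_gt0// exprn_gt0. Qed.

Lemma strip_top_ge s : H <= strip_top s.
Proof. by rewrite /strip_top ler_peMr ?(ltW H0)// exprn_ege1// ler1n. Qed.

Lemma strip_rankP s : - 2 * strip_top s <= s /\
  forall n, - 2 * (H * 2 ^+ n) <= s -> (strip_rank s <= n)%N.
Proof. by rewrite /strip_top /strip_rank; case: ex_minnP. Qed.

(** Points of one grid interval of side [D = strip_top s] compare alike with [- 2 D] and with [- D].
    These are the thresholds of the rank of [s] and of the previous rank, since tops double. *)
Lemma strip_rank_eq s s' :
  grid_index (strip_top s) 0 s = grid_index (strip_top s) 0 s' -> strip_rank s' = strip_rank s.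
Proof.
have [sD smin] := strip_rankP s; have [s'D s'min] := strip_rankP s'.
have D0 := strip_top_gt0 s.
have E (n : nat) z : (- n%:Z <= grid_index (strip_top s) 0 z) = (- n%:R * strip_top s <= z).
  by rewrite /grid_index floor_ge_int expr0 mulr1 ler_pdivlMr// rmorphN.
move=> ss'; have EE n : (- n%:R * strip_top s <= s') = (- n%:R * strip_top s <= s).
  by rewrite -!E ss'.
have le1 : (strip_rank s' <= strip_rank s)%N.
  by apply: s'min; rewrite -/(strip_top s) EE.
apply/eqP; rewrite eqn_leq le1/= leqNgt; apply/negP => lt1.
have [r sr] : exists r, strip_rank s = r.+1 by case: (strip_rank s) lt1 => // r _; exists r.
have s'1 : - 2 * (H * 2 ^+ r) <= s'.
  apply: le_trans s'D; rewrite /strip_top !mulNr lerN2 ler_pM2l// ler_pM2l//.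
  by rewrite ler_eXn2l ?ltr1n// -ltnS -sr.
have DE : strip_top s = 2 * (H * 2 ^+ r) by rewrite /strip_top sr exprS; ring.
have s1 : strip_top s * (-1) <= s.
  by have := EE 1%N; rewrite mulrC => <-; rewrite DE; move: s'1; lra.
have /smin : - 2 * (H * 2 ^+ r) <= s by move: s1; rewrite DE; lra.
by rewrite sr ltnn.
Qed.

Definition strip_base s : R := grid_point (strip_top s) 0 s.

(** With [top_Z], the smallest sides that [admissible] allows for a tile as high as the strip and
    standing on its base. *)
Definition top_X s : R := expR (strip_base s / 2) * (strip_top s * expR (strip_top s)).

Definition top_Z s : R := expR (strip_base s) * (strip_top s * expR (3 * strip_top s)).

Lemma top_X_gt0 s : 0 < top_X s.
Proof. by rewrite !mulr_gt0 ?expR_gt0// strip_top_gt0. Qed.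

Lemma top_Z_gt0 s : 0 < top_Z s.
Proof. by rewrite !mulr_gt0 ?expR_gt0// strip_top_gt0. Qed.

Lemma strip_base_ge s : - 2 * strip_top s <= strip_base s.
Proof.
have [sD _] := strip_rankP s; have D0 := strip_top_gt0 s.
rewrite /strip_base /grid_point expr0 divr1 mulrC ler_pM2l//.
have : (- 2%:Z <= grid_index (strip_top s) 0 s).
  by rewrite /grid_index floor_ge_int expr0 mulr1 ler_pdivlMr// rmorphN.
by rewrite -(ler_int R) rmorphN.
Qed.

(** The base is at least [- 2 D], so [e^(base / 2) >= e^(- D)], which the factor [e^D] of [top_X]
    compensates. *)
Lemma top_X_ge s : strip_top s <= top_X s.
Proof.
have D0 := strip_top_gt0 s; have h := strip_base_ge s.
rewrite /top_X mulrCA -expRD -[leLHS]mulr1 ler_pM2l// -[leLHS]expR0 ler_expR; lra.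
Qed.

Lemma top_Z_ge s : strip_top s <= top_Z s.
Proof.
have D0 := strip_top_gt0 s; have h := strip_base_ge s.
rewrite /top_Z mulrCA -expRD -[leLHS]mulr1 ler_pM2l// -[leLHS]expR0 ler_expR; lra.
Qed.

(* Halves whichever side of the tile is at least twice as long as a tile of
   height [h] requires, and the height when there is none. *)
Definition state_step s (c : nat * nat * nat) : nat * nat * nat :=
  let: (i, l, j) := c in
  let h := strip_top s / 2 ^+ j in let u := grid_point (strip_top s) j s in
  if 2 * (h * expR h) <= top_X s / 2 ^+ i * expR (- (u / 2)) then (i.+1, l, j)
  else if 2 * (h * expR (3 * h)) <= top_Z s / 2 ^+ l * expR (- u) then (i, l.+1, j)
  else (i, l, j.+1).

Definition state s n := iter n (state_step s) (0, 0, 0)%N.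

Definition state_X s n := (state s n).1.1.
Definition state_Z s n := (state s n).1.2.
Definition state_a s n := (state s n).2.

Lemma stateS s n : state s n.+1 = state_step s (state s n). Proof. by []. Qed.

Lemma state_cases s n :
  [\/ [/\ state_X s n.+1 = (state_X s n).+1, state_Z s n.+1 = state_Z s n
         & state_a s n.+1 = state_a s n],
      [/\ state_X s n.+1 = state_X s n, state_Z s n.+1 = (state_Z s n).+1
         & state_a s n.+1 = state_a s n]
    | [/\ state_X s n.+1 = state_X s n, state_Z s n.+1 = state_Z s n
         & state_a s n.+1 = (state_a s n).+1]].
Proof.
rewrite /state_X /state_Z /state_a stateS; case: (state s n) => [[i l] j] /=.
by case: ifP => _; [constructor 1|case: ifP => _; [constructor 2|constructor 3]].
Qed.

Lemma state_sum s n : (state_X s n + state_Z s n + state_a s n = n)%N.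
Proof.
elim: n => [//|n ih].
by have [[-> -> ->]|[-> -> ->]|[-> -> ->]] := state_cases s n; rewrite ?addnS ?addSn ih.
Qed.

Lemma state_leS s n : [/\ (state_X s n <= state_X s n.+1)%N,
  (state_Z s n <= state_Z s n.+1)%N & (state_a s n <= state_a s n.+1)%N].
Proof. by have [[-> -> ->]|[-> -> ->]|[-> -> ->]] := state_cases s n. Qed.

(** The tests of [state_step] read [s] only through its strip and the grid interval reached so far.
    Points of one tile therefore undergo the same halvings, which makes the tiles partitions. *)
Lemma state_eq s s' n : grid_index (strip_top s) (state_a s n) s =
  grid_index (strip_top s) (state_a s n) s' ->
  [/\ strip_rank s' = strip_rank s, strip_base s' = strip_base s & state s' n = state s n].
Proof.
elim: n => [|n ih] ss'.
  have rE := strip_rank_eq ss'.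
  split=> //; rewrite /strip_base /grid_point.
  by have -> : strip_top s' = strip_top s; [rewrite /strip_top rE|rewrite ss'].
have [_ _ le_a] := state_leS s n.
have ss'n := grid_index_coarse le_a ss'.
have [rE bE sE] := ih ss'n; split=> //.
have tE : strip_top s' = strip_top s by rewrite /strip_top rE.
rewrite !stateS sE /state_step; move: ss'n; rewrite /state_a.
case: (state s n) => [[i l] j] /= ss'n.
by rewrite /top_X /top_Z tE bE /grid_point ss'n.
Qed.

Lemma expR_ge_id (x : R) : x <= expR x.
Proof. by apply: le_trans (expR_ge1Dx x); rewrite lerDr. Qed.

(** A side is halved only when at least twice its lower bound. The height is halved only when both
    sides are below twice theirs, and then [2 h e^(3 h) = 4 (h / 2) e^(6 (h / 2))] gives the new
    upper bounds. *)
Lemma state_admissible s n (h := strip_top s / 2 ^+ state_a s n)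
    (u := grid_point (strip_top s) (state_a s n) s) :
  admissible h (top_X s / 2 ^+ state_X s n * expR (- (u / 2)))
    (top_Z s / 2 ^+ state_Z s n * expR (- u)).
Proof.
have D0 := strip_top_gt0 s.
rewrite {}/h {}/u; elim: n => [|n ih].
  rewrite /state_X /state_Z /state_a /state/= !expr0 !divr1.
  rewrite -/(strip_base s) /top_X /top_Z; set D := strip_top s in D0 *; set b := strip_base s.
  have cancel (e x : R) : expR e * x * expR (- e) = x by rewrite mulrAC -expRD subrr expR0 mul1r.
  rewrite !cancel.
  have DE e e' : e <= e' -> D * expR e <= D * expR e'.
    by move=> ee'; rewrite ler_pM2l// ler_expR.
  have D6 : 0 < D * expR (6 * D) by rewrite mulr_gt0// expR_gt0.
  split=> //.
  - have := DE D (6 * D); lra.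
  - have := DE (3 * D) (6 * D); lra.
  (* At the top [p = D e^D] and [q = D e^(3 D)], so [p^2 <= 4 q] reduces to [D <= 4 e^D]. *)
  - have E3 : expR (3 * D) = expR D ^+ 2 * expR D by rewrite -expRM_natl -expRD; congr expR; ring.
    have e0 : 0 < D * expR D ^+ 2 by rewrite mulr_gt0// exprn_gt0// expR_gt0.
    rewrite E3 (_ : _ ^+ 2 = (D * expR D ^+ 2) * D); last by ring.
    rewrite (_ : 4 * _ = (D * expR D ^+ 2) * (4 * expR D)); last by ring.
    by rewrite ler_pM2l//; have := expR_ge_id D; have := expR_gt0 D; lra.
rewrite /state_X /state_Z /state_a in ih *; rewrite !stateS /state_step.
case: (state s n) ih => [[i l] j] /=.
set h := strip_top s / 2 ^+ j; set u := grid_point _ j s.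
have h0 : 0 < h by rewrite divr_gt0// exprn_gt0.
set p := top_X s / 2 ^+ i; set q := top_Z s / 2 ^+ l.
have p0 : 0 < p by rewrite divr_gt0 ?exprn_gt0// top_X_gt0.
have q0 : 0 < q by rewrite divr_gt0 ?exprn_gt0// top_Z_gt0.
move=> [a1 a2 a3 a4 a5].
have hp (b : R) k : b / 2 ^+ k.+1 = b / 2 ^+ k / 2 by rewrite exprSr invfM mulrA.
set ph := p * expR (- (u / 2)) in a1 a3 a5 *; set qh := q * expR (- u) in a2 a4 a5 *.
have ph0 : 0 < ph by rewrite mulr_gt0 ?expR_gt0.
have qh0 : 0 < qh by rewrite mulr_gt0 ?expR_gt0.
case: ifPn => [c1|c1] /=.
  rewrite -/h -/u (_ : _ * expR _ = ph / 2); last by rewrite hp /ph /p; ring.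
  split=> //; try lra.
  by apply: le_trans a5; rewrite ler_pXn2r ?nnegrE ?divr_ge0 ?(ltW ph0)//; lra.
rewrite -ltNge in c1.
have e0 := expR_gt0 h; have hh := expR_ge_id h.
have E3 : expR (3 * h) = expR h ^+ 2 * expR h.
  by rewrite -expRM_natl -expRD; congr expR; ring.
case: ifPn => [c2|c2] /=.
  rewrite -/h -/u (_ : top_Z s / _ * _ = qh / 2); last by rewrite hp /qh /q; ring.
  split=> //; try lra.
  (* Halving [q] is the one step that endangers [p^2 <= 4 q]. As [X] is tested first, [p < 2 h e^h],
     and [h <= e^h] gives [p^2 <= 4 h e^(3 h) <= 2 q]. *)
  have b1 : ph ^+ 2 <= (2 * (h * expR h)) ^+ 2.
    have he0 : 0 <= 2 * (h * expR h) by rewrite mulr_ge0// mulr_ge0// ltW.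
    by rewrite ler_pXn2r ?nnegrE ?(ltW ph0)// ltW.
  apply: le_trans b1 _; rewrite E3 in c2.
  have b2 : h * (h * expR h ^+ 2) <= expR h * (h * expR h ^+ 2).
    by rewrite ler_wpM2r// mulr_ge0 ?exprn_ge0 ?ltW.
  rewrite (_ : _ ^+ 2 = 4 * (h * (h * expR h ^+ 2))); last by ring.
  lra.
rewrite -ltNge in c2.
rewrite hp -/h.
set u' := grid_point _ j.+1 s.
have [u1 u2] := grid_pointP j s D0; have [u3 u4] := grid_pointP j.+1 s D0.
rewrite -/u -/h in u1 u2; rewrite -/u' hp -/h in u3 u4.
have [uu1 uu2] := grid_point_refine j s D0.
rewrite -/u -/u' -/h in uu1 uu2.
(* Halving the height may raise the base from [u] to [u'], by at most [h / 2]. The rescaled sides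
   shrink by [e >= e^(- h / 4)] and [e ^+ 2 >= e^(- h / 2)], less than the lower bounds drop when
   [h] is halved. *)
pose e := expR (- ((u' - u) / 2)).
have phE : p * expR (- (u' / 2)) = ph * e.
  by rewrite /ph /e -mulrA -expRD; congr (_ * expR _); field.
have qhE : q * expR (- u') = qh * e ^+ 2.
  by rewrite /qh /e -expRM_natl -mulrA -expRD; congr (_ * expR _); field.
rewrite phE qhE.
have e_gt0 : 0 < e by exact: expR_gt0.
have e_le1 : e <= 1 by rewrite -expR0 ler_expR oppr_le0 divr_ge0// subr_ge0.
have e2_le1 : e ^+ 2 <= 1 by rewrite exprn_ile1// ltW.
have e2_gt0 : 0 < e ^+ 2 by rewrite exprn_gt0.
have hE a b : a <= b -> h * expR a <= h * expR b by move=> ab; rewrite ler_pM2l// ler_expR.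
split.
- have h1 : h * expR (h / 2) <= h * expR h * expR (- (h / 4)).
    by rewrite -mulrA -expRD; apply: hE; lra.
  have h2 : h * expR h * expR (- (h / 4)) <= ph * e.
    have g1 : 0 <= h * expR h by rewrite mulr_ge0 ?expR_ge0// ltW.
    apply: (ler_pM g1 (expR_ge0 _) a1); rewrite /e ler_expR; lra.
  have h3 : 0 < h * expR (h / 2) by rewrite mulr_gt0// expR_gt0.
  by rewrite mulrAC; lra.
- have h1 : h * expR (3 * (h / 2)) <= h * expR (3 * h) * expR (- (h / 2)).
    by rewrite -mulrA -expRD; apply: hE; lra.
  have h2 : h * expR (3 * h) * expR (- (h / 2)) <= qh * e ^+ 2.
    have g1 : 0 <= h * expR (3 * h) by rewrite mulr_ge0 ?expR_ge0// ltW.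
    apply: (ler_pM g1 (expR_ge0 _) a2); rewrite /e -expRM_natl ler_expR; lra.
  have h3 : 0 < h * expR (3 * (h / 2)) by rewrite mulr_gt0// expR_gt0.
  by rewrite mulrAC; lra.
- have h1 : ph * e <= ph by rewrite ler_piMr// ltW.
  have h2 : h * expR h <= h * expR (6 * (h / 2)) by apply: hE; lra.
  by have -> : 4 * (h / 2 * expR (6 * (h / 2))) = 2 * (h * expR (6 * (h / 2))); [field|lra].
- have h1 : qh * e ^+ 2 <= qh by rewrite ler_piMr// ltW.
  have h2 : h * expR (3 * h) <= h * expR (6 * (h / 2)) by apply: hE; lra.
  by have -> : 4 * (h / 2 * expR (6 * (h / 2))) = 2 * (h * expR (6 * (h / 2))); [field|lra].
- by rewrite exprMn mulrA ler_pM2r.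
Qed.

(** After [3 N] steps some side has been halved [N] times. If it is not the height, the height is
    small all the same, being dominated by each rescaled side. *)
Lemma strip_top_state_cvg s e : 0 < e -> exists n, strip_top s / 2 ^+ state_a s n < e.
Proof.
move=> e0; have D0 := strip_top_gt0 s.
(* The base [u] varies with the generation but stays above [s - strip_top s]: these constants bound
   the rescaled sides, up to their halvings, uniformly. *)
pose c1 := top_X s * expR (- ((s - strip_top s) / 2)); pose c2 := top_Z s * expR (- (s - strip_top s)).
have c10 : 0 < c1 by rewrite mulr_gt0 ?expR_gt0// top_X_gt0.
have c20 : 0 < c2 by rewrite mulr_gt0 ?expR_gt0// top_Z_gt0.
pose c := c1 + c2 + strip_top s.
have c0 : 0 < c by rewrite !addr_gt0.
have [N cN] : exists N, c / 2 ^+ N < e.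
  have /archi_boundP : 0 <= c / e by rewrite divr_ge0// ltW.
  set N := Num.bound _ => cN; exists N.
  have N2 : (N%:R : R) <= 2 ^+ N by rewrite -natrX ler_nat ltnW// ltn_expl.
  rewrite ltr_pdivrMr ?exprn_gt0// mulrC -ltr_pdivrMr//; exact: lt_le_trans cN N2.
have large (b : R) i : 0 < b -> b <= c -> (N <= i)%N -> b / 2 ^+ i < e.
  move=> b0 bc Ni; apply: le_lt_trans cN; apply: ler_pM => //; first exact: ltW.
  by rewrite lef_pV2 ?posrE ?exprn_gt0// ler_weXn2l ?ler1n.
have c1c : c1 <= c by rewrite /c; lra.
have c2c : c2 <= c by rewrite /c; lra.
have Dc : strip_top s <= c by rewrite /c; lra.
exists (N + N + N)%N.
have := state_admissible s (N + N + N); have := state_sum s (N + N + N).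
move: (state_X s _) (state_Z s _) (state_a s _) => i l j sn [a1 a2 _ _ _].
set h := strip_top s / 2 ^+ j in a1 a2 *.
have h0 : 0 < h by rewrite divr_gt0// exprn_gt0.
have hD : h <= strip_top s.
  by rewrite ler_pdivrMr ?exprn_gt0// ler_peMr ?(ltW D0)// exprn_ege1// ler1n.
have [_ us] := grid_pointP j s D0; rewrite -/h in us.
set u := grid_point _ _ _ in us a1 a2.
have hE b : 0 <= b -> h <= h * expR b.
  by move=> b0; rewrite ler_peMr ?(ltW h0)// -expR0 ler_expR.
have := hE h (ltW h0); have := hE (3 * h); rewrite mulr_ge0 ?(ltW h0)// => /(_ isT) h3 h1.
have [nX|nX] := leqP N i.
  apply: (@le_lt_trans _ _ (c1 / 2 ^+ i)); last exact: large c10 c1c nX.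
  apply: (le_trans h1); apply: (le_trans a1); rewrite /c1 [leRHS]mulrAC ler_wpM2l//.
    by rewrite divr_ge0 ?exprn_ge0// ltW// top_X_gt0.
  by rewrite ler_expR; lra.
have [nZ|nZ] := leqP N l.
  apply: (@le_lt_trans _ _ (c2 / 2 ^+ l)); last exact: large c20 c2c nZ.
  apply: (le_trans h3); apply: (le_trans a2); rewrite /c2 [leRHS]mulrAC ler_wpM2l//.
    by rewrite divr_ge0 ?exprn_ge0// ltW// top_Z_gt0.
  by rewrite ler_expR; lra.
apply: (large _ _ D0 Dc); rewrite leqNgt; apply/negP => nA.
have := leq_add (leq_add nX (ltnW nZ)) (ltnW nA).
by rewrite addSn addSn sn ltnn.
Qed.

End strips.

Lemma pair5_inj (A B C D E : Type) (a a' : A) (b b' : B) (c c' : C) (d d' : D) (e e' : E) :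
  (a, b, c, d, e) = (a', b', c', d', e') -> [/\ a = a', b = b', c = c', d = d' & e = e'].
Proof. by case=> -> -> -> -> ->. Qed.

Lemma mktuple_inj (T : Type) n (f g : 'I_n -> T) :
  [tuple f i | i < n] = [tuple g i | i < n] -> f =1 g.
Proof. by move=> fg i; rewrite -(tnth_mktuple f) fg tnth_mktuple. Qed.

Lemma prod3_le_double (R : realDomainType) (x x' z z' a a' : R) (m k : nat) :
  0 <= x <= 2 * x' -> 0 <= z <= 2 * z' -> 0 <= a <= 2 * a' ->
  x ^+ m * z ^+ k * a <= 2 ^+ (m + k + 1) * (x' ^+ m * z' ^+ k * a').
Proof.
move=> /andP[x0 x1] /andP[z0 z1] /andP[a0 a1].
have -> : 2 ^+ (m + k + 1) * (x' ^+ m * z' ^+ k * a') = (2 * x') ^+ m * (2 * z') ^+ k * (2 * a').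
  by rewrite !exprMn !exprD expr1; ring.
have xx : x ^+ m <= (2 * x') ^+ m by rewrite lerXn2r// nnegrE// (le_trans x0).
have zz : z ^+ k <= (2 * z') ^+ k by rewrite lerXn2r// nnegrE// (le_trans z0).
by rewrite ler_pM ?mulr_ge0 ?exprn_ge0// ler_pM ?exprn_ge0.
Qed.

(** * The filtration by tiles *)

Section filtration.
Context (R : realType) (L : htypeAlgebra R) (H : R).
Hypothesis H0 : 0 < H.
Local Notation V := (subvs_of (ht_v L)).
Local Notation Z := (subvs_of (ht_z L)).
Local Notation S := (damekRicci L).
Local Notation Rm := (measurableTypeR R).
Local Notation m := (\dim {:V}).
Local Notation k := (\dim {:Z}).
Local Notation mu := (@dr_haar R L).
Local Notation D := (strip_top H0).
Implicit Types (p : S) (n : nat).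

Definition dr_height p : R := ln (dr_a p)%:num.

(** Rank and state are recorded because the grid indices refer to sides that depend on them; by
    [state_eq] they add nothing to the tile ([dr_cellE]). *)
Definition dr_level n p :=
  let s := dr_height p in let P := top_X H0 s in
  (strip_rank H0 s, state H0 s n,
   [tuple grid_index P (state_X H0 s n) (cd i (dr_X p)) | i < m],
   [tuple grid_index (top_Z H0 s) (state_Z H0 s n) (cd t (dr_Z p) - dr_shear P t (dr_X p)) | t < k],
   grid_index (D s) (state_a H0 s n) s).

Lemma dr_cellE n p (s := dr_height p) : cell dr_level n p =
  dr_tile (top_X H0 s) (top_Z H0 s) (D s) (state_X H0 s n) (state_Z H0 s n) (state_a H0 s n) p.
Proof.
rewrite /s; apply/seteqP; split=> y.
  move=> lE; have [rE sE xE zE aE] := pair5_inj lE.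
  have DE : D (dr_height y) = D (dr_height p) by rewrite /strip_top rE.
  have jE : state_a H0 (dr_height y) n = state_a H0 (dr_height p) n by rewrite /state_a sE.
  have lE1 : state_X H0 (dr_height y) n = state_X H0 (dr_height p) n by rewrite /state_X sE.
  have lE2 : state_Z H0 (dr_height y) n = state_Z H0 (dr_height p) n by rewrite /state_Z sE.
  rewrite DE jE in aE.
  have [_ bE _] := state_eq (esym aE).
  have XE : top_X H0 (dr_height y) = top_X H0 (dr_height p) by rewrite /top_X DE bE.
  have ZE : top_Z H0 (dr_height y) = top_Z H0 (dr_height p) by rewrite /top_Z DE bE.
  split; last exact: aE.
  - by move=> i; have := mktuple_inj xE i; rewrite XE lE1; apply.
  - by move=> t; have := mktuple_inj zE t; rewrite XE ZE lE2; apply.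
move=> [xE zE aE]; change (dr_level n y = dr_level n p); rewrite /dr_level.
have [rE bE sE] := state_eq (esym aE).
have DE : D (dr_height y) = D (dr_height p) by rewrite /strip_top rE.
have XE : top_X H0 (dr_height y) = top_X H0 (dr_height p) by rewrite /top_X DE bE.
have ZE : top_Z H0 (dr_height y) = top_Z H0 (dr_height p) by rewrite /top_Z DE bE.
rewrite rE XE ZE DE /state_X /state_Z /state_a !sE; congr (_, _, _, _, _).
- exact: eq_mktuple xE.
- exact: eq_mktuple zE.
- exact: aE.
Qed.

Lemma measurable_dr_level n i : measurable [set x | dr_level n x = i].
Proof.
have [[x xi]|nx] := pselect (exists x, dr_level n x = i).
  rewrite -xi; change (measurable (cell dr_level n x)); rewrite dr_cellE.
  apply: measurable_dr_tile; [exact: top_X_gt0|exact: top_Z_gt0|exact: strip_top_gt0].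
rewrite (_ : [set _ | _] = set0)//.
by apply/seteqP; split=> [x xi|x []]; apply: nx; exists x.
Qed.

Lemma dr_level_nest n x y : dr_level n.+1 x = dr_level n.+1 y -> dr_level n x = dr_level n y.
Proof.
have [lX lZ la] := state_leS H0 (dr_height y) n.
rewrite -[_ = _]/(cell dr_level n.+1 y x) -[X in _ -> X]/(cell dr_level n y x) !dr_cellE.
move=> [xE zE aE]; split.
- by move=> i; exact: grid_index_coarse lX (xE i).
- by move=> t; exact: grid_index_coarse lZ (zE t).
- exact: grid_index_coarse la aE.
Qed.

Lemma dr_haar_cell n p (s := dr_height p) : mu (cell dr_level n p) =
  ((top_X H0 s / 2 ^+ state_X H0 s n) ^+ m * (top_Z H0 s / 2 ^+ state_Z H0 s n) ^+ k *
   (D s / 2 ^+ state_a H0 s n))%:E.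
Proof.
rewrite dr_cellE dr_haar_tile//; [exact: top_X_gt0|exact: top_Z_gt0|exact: strip_top_gt0].
Qed.

Lemma dr_haar_cell_fin n p : (mu (cell dr_level n p) < +oo)%E.
Proof. by rewrite dr_haar_cell ltry. Qed.

(** Each counter grows by at most 1, so a step at most halves the sides in all [m + k + 1]
    directions. *)
Lemma dr_haar_cell_doubling n p :
  (mu (cell dr_level n p) <= (2 ^+ (m + k + 1))%:E * mu (cell dr_level n.+1 p))%E.
Proof.
rewrite !dr_haar_cell -EFinM lee_fin.
set s := dr_height p.
have X0 := top_X_gt0 H0 s; have Z0 := top_Z_gt0 H0 s; have D0 := strip_top_gt0 H0 s.
have step (b : R) i j : 0 < b -> (j <= i.+1)%N -> 0 <= b / 2 ^+ i <= 2 * (b / 2 ^+ j).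
  move=> b0 ij; apply/andP; split; first by rewrite divr_ge0 ?exprn_ge0// ltW.
  rewrite mulrCA ler_pM2l// ler_pdivlMr ?exprn_gt0// ler_pdivrMl ?exprn_gt0//.
  by rewrite -exprSr ler_weXn2l// ler1n.
have [lX lZ la] : [/\ (state_X H0 s n.+1 <= (state_X H0 s n).+1)%N,
    (state_Z H0 s n.+1 <= (state_Z H0 s n).+1)%N & (state_a H0 s n.+1 <= (state_a H0 s n).+1)%N].
  by have [[-> -> ->]|[-> -> ->]|[-> -> ->]] := state_cases H0 s n; split.
exact: prod3_le_double (step _ _ _ X0 lX) (step _ _ _ Z0 lZ) (step _ _ _ D0 la).
Qed.

Lemma dr_haar_cell0 p : 1 <= H -> (H%:E <= mu (cell dr_level 0 p))%E.
Proof.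
move=> H1; rewrite dr_haar_cell lee_fin; set s := dr_height p.
have -> : state_X H0 s 0 = 0%N by [].
have -> : state_Z H0 s 0 = 0%N by [].
have -> : state_a H0 s 0 = 0%N by [].
rewrite !expr0 !divr1.
have HD := strip_top_ge H0 s.
have X1 : 1 <= top_X H0 s by apply: le_trans (top_X_ge H0 s); exact: le_trans HD.
have Z1 : 1 <= top_Z H0 s by apply: le_trans (top_Z_ge H0 s); exact: le_trans HD.
apply: (le_trans HD); rewrite ler_peMl ?(ltW (strip_top_gt0 H0 s))//.
by rewrite mulr_ege1// exprn_ege1.
Qed.

Lemma dr_cell_admissible n p (s := dr_height p) : admissible (D s / 2 ^+ state_a H0 s n)
  (top_X H0 s / 2 ^+ state_X H0 s n * expR (- (grid_point (D s) (state_a H0 s n) s / 2)))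
  (top_Z H0 s / 2 ^+ state_Z H0 s n * expR (- grid_point (D s) (state_a H0 s n) s)).
Proof. exact: state_admissible. Qed.

(** The tile of generation [n] around a point lies in a ball of radius [(K + 1) h], and [h] becomes
    arbitrarily small. *)
Lemma dr_dopen_cell_open (A : set S) : dopen (@dr_dist R L) A -> cell_open dr_level A.
Proof.
move=> oA x /oA[e e0 eA].
have [C C0 CP] := dr_shear_increment L.
have A0 : 0 <= 4 * (1 + 4 * C) by rewrite mulr_ge0// addr_ge0// mulr_ge0.
have [K K0 KP] := dr_dist_upper L A0 (ler0n R 6).
have K1 : 0 < K + 1 by rewrite ltr_wpDl.
have [n hn] := strip_top_state_cvg H0 (dr_height x) (divr_gt0 e0 K1).
exists n; rewrite dr_cellE; apply: subset_trans eA.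
apply: subset_trans (tile_sub_ball (top_X_gt0 _ _) (top_Z_gt0 _ _) (strip_top_gt0 _ _)
  (dr_cell_admissible n x) C0 CP KP) _.
move=> y /lt_le_trans; apply.
by rewrite mulrC -ler_pdivlMr//; exact: ltW.
Qed.

Lemma dr_dopen_measurable (A : set S) : dopen (@dr_dist R L) A -> measurable A.
Proof.
move=> /dr_dopen_cell_open; exact: cell_open_measurable measurable_dr_level dr_level_nest _.
Qed.

End filtration.

(** * The topology of the distance *)

Section coordinate_continuity.
Context (R : realType) (L : htypeAlgebra R).
Local Notation V := (subvs_of (ht_v L)).
Local Notation Z := (subvs_of (ht_z L)).
Local Notation S := (damekRicci L).
Local Notation Rm := (measurableTypeR R).
Local Notation m := (\dim {:V}).
Local Notation k := (\dim {:Z}).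
Implicit Types (p y : S).

(** [dr_dist_lower] transported to [p] by translation, at the price of a constant that depends on
    [p]. It separates points and makes the coordinates continuous. *)
Lemma dr_coord_lipschitz p : exists2 M : R, 0 < M & forall y r, 0 < r -> r <= 1 ->
  dr_dist p y < r ->
  [/\ `|dr_height y - dr_height p| <= M * r,
      forall i, `|cd i (dr_X y) - cd i (dr_X p)| <= M * r
    & forall t, `|cd t (dr_Z y) - cd t (dr_Z p)| <= M * r].
Proof.
have [C C1 CP] := dr_dist_lower L; have [B B0 BP] := cd_bracket_bound L.
have C0 : 0 <= C by lra.
have e0 := expR_gt0 (2 : R).
pose a := (dr_a p)%:num; pose X := \sum_i `|cd i (dr_X p)|.
have X0 : 0 <= X by exact: sumr_ge0.
pose M1 := Num.sqrt a * (C * expR 2); pose M2 := a * (C * expR 2) + B * (X * M1).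
have M10 : 0 <= M1 by rewrite !mulr_ge0 ?sqrtr_ge0// ltW.
have a0 : 0 <= a by rewrite /a.
have M20 : 0 <= M2.
  exact: addr_ge0 (mulr_ge0 a0 (mulr_ge0 C0 (ltW e0))) (mulr_ge0 B0 (mulr_ge0 X0 M10)).
exists (1 + M1 + M2); first by lra.
move=> y r r0 r1; rewrite dr_dist1 => /CP[ga gx gz].
have M1r : 0 <= M1 * r by rewrite mulr_ge0// ltW.
have M2r : 0 <= M2 * r by rewrite mulr_ge0// ltW.
have Mr : (1 + M1 + M2) * r = r + M1 * r + M2 * r by ring.
have eC c : c <= 2 -> C * (r * expR c) <= C * expR 2 * r.
  by move=> c2; rewrite -mulrA (mulrC (expR 2)) ler_wpM2l// ler_wpM2l ?ler_expR// ltW.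
have hX i : `|cd i (dr_X y) - cd i (dr_X p)| <= M1 * r.
  have := gx i; rewrite cd_X_quotient normrM ger0_norm ?invr_ge0// ler_pdivrMl ?sqrtr_gt0//.
  move/le_trans; apply; rewrite /M1 -mulrA ler_wpM2l ?sqrtr_ge0//; apply: eC; lra.
split.
- rewrite Mr; move: ga; rewrite /= lnM ?posrE// lnV ?posrE// addrC -/(dr_height p) -/(dr_height y); lra.
- by move=> i; rewrite Mr; have := hX i; lra.
- move=> t; rewrite Mr.
  have h1 : `|cd t (dr_Z y) - cd t (dr_Z p) - 2^-1 * cd t (dr_bracket (dr_X p) (dr_X y))|
      <= a * (C * expR 2) * r.
    have := gz t; rewrite cd_Z_quotient normrM ger0_norm ?invr_ge0// ler_pdivrMl//.
    move/le_trans; apply; rewrite -mulrA ler_wpM2l//; apply: eC; lra.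
  have bE : dr_bracket (dr_X p) (dr_X y) = dr_bracket (dr_X p) (dr_X y - dr_X p) :> Z.
    by rewrite dr_bracketDr [X in _ + X]dr_bracketC dr_bracketNl opprK dr_bracketxx addr0.
  have h2 : `|cd t (dr_bracket (dr_X p) (dr_X y))| <= B * (X * (M1 * r)).
    rewrite bE; apply: BP => // i; last by rewrite cdB.
    by rewrite /X (bigD1 i)//= lerDl sumr_ge0.
  have h3 : B * (X * (M1 * r)) = B * (X * M1) * r by ring.
  have h4 := ler_normD (cd t (dr_Z y) - cd t (dr_Z p) - 2^-1 * cd t (dr_bracket (dr_X p) (dr_X y)))
    (2^-1 * cd t (dr_bracket (dr_X p) (dr_X y))).
  rewrite subrK normrM (ger0_norm (_ : 0 <= 2^-1 :> R))// in h4.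
  have := normr_ge0 (cd t (dr_bracket (dr_X p) (dr_X y))).
  have M2E : M2 * r = a * (C * expR 2) * r + B * (X * M1) * r by rewrite /M2; ring.
  lra.
Qed.

Lemma dr_sublevel_dopen (F : S -> R) (c : R) :
  (forall p, exists2 M : R, 0 < M & forall y r, 0 < r -> r <= 1 -> dr_dist p y < r ->
    `|F y - F p| <= M * r) ->
  dopen (@dr_dist R L) [set p | F p < c].
Proof.
move=> FL p /= pc; have [M M0 FM] := FL p.
have d0 : 0 < (c - F p) / (2 * M) by rewrite divr_gt0 ?subr_gt0// mulr_gt0.
set e := Num.min 1 ((c - F p) / (2 * M)).
have e0 : 0 < e by rewrite lt_min ltr01.
have e1 : e <= 1 by rewrite ge_min lexx.
have eM : M * e <= (c - F p) / 2.
  rewrite (_ : _ / 2 = M * ((c - F p) / (2 * M))); last by field; rewrite gt_eqF.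
  by rewrite ler_pM2l// ge_min lexx orbT.
exists e => // y py; rewrite /=.
by have := FM y _ e0 e1 py; rewrite ler_norml => /andP[_]; lra.
Qed.

Lemma dr_dist_eq0 p y : dr_dist p y = 0 -> p = y.
Proof.
move=> py; have [M M0 MP] := dr_coord_lipschitz p.
have small (b : R) : (forall r, 0 < r -> r <= 1 -> `|b| <= M * r) -> b = 0.
  move=> br; apply/eqP; rewrite -normr_le0 leNgt; apply/negP => b0.
  have d0 : 0 < `|b| / (2 * M) by rewrite divr_gt0// mulr_gt0.
  have [d1|d1] := leP (`|b| / (2 * M)) 1.
    have := br _ d0 d1; rewrite (_ : M * _ = `|b| / 2); [lra|by field; rewrite gt_eqF].
  have M2 : 0 < 2 * M by rewrite mulr_gt0.
  by have := br 1 ltr01 (lexx 1); move: d1; rewrite (ltr_pdivlMr _ _ M2); lra.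
have E r (r0 : 0 < r) (r1 : r <= 1) := MP y r r0 r1 (eq_ind_r (fun b => b < r) r0 py).
apply/esym/dr_eq.
- apply: vtuple_inj; apply: eq_mktuple => i; apply/eqP; rewrite -subr_eq0; apply/eqP.
  by apply: small => r r0 r1; have [_ /(_ i)] := E r r0 r1.
- apply: vtuple_inj; apply: eq_mktuple => t; apply/eqP; rewrite -subr_eq0; apply/eqP.
  by apply: small => r r0 r1; have [_ _ /(_ t)] := E r r0 r1.
- apply: ln_inj; rewrite ?posrE//; apply/eqP; rewrite -subr_eq0; apply/eqP.
  by apply: small => r r0 r1; have [] := E r r0 r1.
Qed.

Lemma dr_is_distance : is_distance (@dr_dist R L).
Proof.
split; [exact: dr_dist_ge0| |exact: dr_distC|exact: dr_dist_triangle].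
by move=> p y; split; [exact: dr_dist_eq0|move=> ->; exact: dr_distxx].
Qed.

Lemma enlargement_dopen (A : set S) (r : R) : dopen (@dr_dist R L) (enlargement (@dr_dist R L) A r).
Proof.
move=> x /= /ereal_inf_lt[_ [y Ay <-]]; rewrite lte_fin => xy.
exists (r - dr_dist x y); first by rewrite subr_gt0.
move=> z; rewrite /dball/= => xz; apply: (@le_lt_trans _ _ (dr_dist z y)%:E).
  by apply: ereal_inf_lbound; exists y.
by rewrite lte_fin; have := dr_dist_triangle z x y; rewrite (dr_distC z x); lra.
Qed.

End coordinate_continuity.

(** * Generation of the Borel sets and the choice of the family *)

Section assembly.
Context (R : realType) (L : htypeAlgebra R).
Local Notation V := (subvs_of (ht_v L)).
Local Notation Z := (subvs_of (ht_z L)).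
Local Notation S := (damekRicci L).
Local Notation Rm := (measurableTypeR R).
Local Notation m := (\dim {:V}).
Local Notation k := (\dim {:Z}).
Local Notation mu := (@dr_haar R L).
Implicit Types (p y : S).

(** The coordinates are continuous for the distance, hence measurable for any sigma-algebra that
    contains its open sets, and they generate the Borel sets of [S]. *)
Lemma dr_measurable_gen (G : set (set S)) :
  (forall A, dopen (@dr_dist R L) A -> <<s G >> A) -> (@measurable _ S) `<=` <<s G >>.
Proof.
move=> oG.
have mF (F : S -> R) : (forall p, exists2 M : R, 0 < M & forall y r, 0 < r -> r <= 1 ->
    dr_dist p y < r -> `|F y - F p| <= M * r) ->
    measurable_fun (setT : set (g_sigma_algebraType G)) (F : g_sigma_algebraType G -> Rm).
  move=> FL; apply: (measurability _ (RGenInftyO.measurableE R)) => _ [_ [c ->] <-].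
  rewrite setTI; apply: oG.
  rewrite (_ : _ @^-1` _ = [set p | F p < c]); first exact: dr_sublevel_dopen.
  by apply/seteqP; split=> p /=; rewrite in_itv.
suff mc : measurable_fun (setT : set (g_sigma_algebraType G))
    (@dr_coord R L : g_sigma_algebraType G -> (m.-tuple Rm * k.-tuple Rm * Rm)%type).
  move=> A [B mB <-]; exact: mc.
apply/measurable_fun_pairP; split; first apply/measurable_fun_pairP; first split.
- apply/measurable_fun_tnthP => i.
  rewrite (_ : _ \o _ = fun p : S => cd i (dr_X p)); last first.
    by apply/funext => p; exact: tnth_vtuple.
  apply: mF => p; have [M M0 MP] := dr_coord_lipschitz p.
  by exists M => // y r r0 r1 py; have [_ /(_ i)] := MP y r r0 r1 py.
- apply/measurable_fun_tnthP => t.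
  rewrite (_ : _ \o _ = fun p : S => cd t (dr_Z p)); last first.
    by apply/funext => p; exact: tnth_vtuple.
  apply: mF => p; have [M M0 MP] := dr_coord_lipschitz p.
  by exists M => // y r r0 r1 py; have [_ _ /(_ t)] := MP y r r0 r1 py.
- rewrite (_ : _ \o _ = expR \o @dr_height R L); last first.
    by apply/funext => p /=; rewrite /dr_height -ln_a_expR.
  apply: measurableT_comp; first exact: measurable_expR.
  apply: mF => p; have [M M0 MP] := dr_coord_lipschitz p.
  by exists M => // y r r0 r1 py; have [] := MP y r r0 r1 py.
Qed.

Lemma dr_cell_gen (H : R) (H0 : 0 < H) : (@measurable _ S) `<=`
  <<s [set A | exists n x, A = cell (@dr_level R L H H0) n x] >>.
Proof.
apply: dr_measurable_gen => A oA; apply: cell_open_gen; first exact: dr_level_nest.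
exact: dr_dopen_cell_open.
Qed.

(** All measurable sets that satisfy condition (i) with constant [kappa]: the family is thus
    independent of the filtration, whose top height varies with [f] and [alpha]. *)
Definition cz_sets (kappa : R) : set (set S) := fun A => measurable A /\
  exists r : R, [/\ 0 < r,
    (exists x (s : R), [/\ (0 < s), (s <= kappa * r) & A `<=` dball (@dr_dist R L) x s])
    & (mu (enlargement (@dr_dist R L) A r) <= kappa%:E * mu A)%E].

(** Needed because the sequence of stopped pieces contains empty sets. The enlargement is empty too,
    the distance to the empty set being [+oo]. *)
Lemma cz_sets0 kappa : 0 < kappa -> cz_sets kappa set0.
Proof.
move=> k0; split; first exact: measurable0.
exists 1; split=> //.
  by exists (dr_one L), kappa; rewrite mulr1; split; [exact: k0|exact: lexx|exact: sub0set].
rewrite (_ : enlargement _ _ _ = set0) ?measure0 ?mule0//.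
apply/seteqP; split=> // x /=; rewrite /enlargement/= /dist_to_set image_set0 ereal_inf0.
by rewrite ltNge leey.
Qed.

(** The constant is chosen before [H], so it suits all filtrations: [K + 1] serves the radius of the
    ball and [c] the measure of the enlargement. *)
Lemma cz_sets_cell : exists2 kappa0 : R, 0 < kappa0 & forall kappa H (H0 : 0 < H) n p,
  kappa0 <= kappa -> cz_sets kappa (cell (@dr_level R L H H0) n p).
Proof.
have [C C0 CP] := dr_shear_increment L.
have A0 : 0 <= 4 * (1 + 4 * C) by rewrite mulr_ge0// addr_ge0// mulr_ge0.
have [K K0 KP] := dr_dist_upper L A0 (ler0n R 6).
have [B B0 BP] := cd_bracket_bound L.
have [D D1 DP] := dr_dist_lower L.
pose c := (3 * (1 + D)) ^+ m * (3 * (1 + 4 * C + D + 2 * B * D)) ^+ k * 4.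
have D0 : 0 <= D by lra.
have c0 : 0 <= c.
  have E0 : 0 <= 1 + 4 * C + D + 2 * B * D by rewrite !addr_ge0 ?mulr_ge0.
  by rewrite /c mulr_ge0// mulr_ge0// exprn_ge0// mulr_ge0// addr_ge0.
have K1 : 0 < K + 1 by lra.
exists (K + 1 + c); first by lra.
move=> kappa H H0 n p kk.
have Kk : K + 1 <= kappa by lra.
have ck : c <= kappa by lra.
have h0 : 0 < strip_top H0 (dr_height p) / 2 ^+ state_a H0 (dr_height p) n.
  by rewrite divr_gt0 ?exprn_gt0// strip_top_gt0.
split; first exact: (measurable_cell (@measurable_dr_level R L H H0)).
exists (strip_top H0 (dr_height p) / 2 ^+ state_a H0 (dr_height p) n); split.
- exact: h0.
- exists p, ((K + 1) * (strip_top H0 (dr_height p) / 2 ^+ state_a H0 (dr_height p) n)); split.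
  + exact: mulr_gt0 K1 h0.
  + exact: ler_wpM2r (ltW h0) _ _ Kk.
  + rewrite dr_cellE; have := tile_sub_ball (top_X_gt0 _ _) (top_Z_gt0 _ _) (strip_top_gt0 _ _)
      (dr_cell_admissible H0 n p) C0 CP KP; apply.
- have [W [mW eW muW]] := tile_enlargement (top_X_gt0 _ _) (top_Z_gt0 _ _) (strip_top_gt0 _ _)
    (dr_cell_admissible H0 n p) C0 CP B0 BP D1 DP.
  rewrite dr_cellE; apply: (@le_trans _ _ (mu W)).
    apply: le_measure => //; rewrite inE//; apply: (dr_dopen_measurable H0).
    exact: enlargement_dopen.
  rewrite muW; apply: lee_wpmul2r; first exact: measure_ge0.
  by rewrite lee_fin.
Qed.

End assembly.

Theorem theorem3p18 (R : realType) (L : htypeAlgebra R) :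
  exists (family : set (set (damekRicci L))) (kappa0 : R),
    0 < kappa0 /\
    is_calderon_zygmund_space (@dr_haar R L) (@dr_dist R L) family kappa0.
Proof.
have [c c0 cP] := cz_sets_cell L.
pose N : R := 2 ^+ (\dim {:subvs_of (ht_v L)} + \dim {:subvs_of (ht_z L)} + 1).
have N1 : 1 <= N by rewrite exprn_ege1// ler1n.
have k0 : 0 < 3 * N + c by lra.
exists (cz_sets (3 * N + c)), (3 * N + c); split; first exact: k0.
split.
- exact: dr_is_distance.
- by move=> A; exact: (dr_dopen_measurable (ltr01 : 0 < 1 :> R)).
- by move=> A [].
- by move=> A [].
- move=> f alpha fi f_alpha.
  have nf0 : (0 <= cL1norm (@dr_haar R L) f)%E.
    by apply: integral_ge0 => x _; rewrite lee_fin; case: (f x) => a b /=; exact: sqrtr_ge0.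
  have alpha0 : 0 < alpha.
    rewrite -lte_fin; apply: le_lt_trans f_alpha.
    apply: mule_ge0; first by rewrite mule_ge0// lee_fin ltW.
    by rewrite inve_ge0.
  (* Top tiles have measure at least [H], so [alpha * H >= ||f||] prevents stopping at generation 0;
     the summand 1 gives [1 <= H], which keeps the other sides of the top tiles at least 1. *)
  pose H : R := 1 + fine (cL1norm (@dr_haar R L) f) / alpha.
  have H1 : 1 <= H.
    by rewrite lerDl divr_ge0 ?(ltW alpha0)// fine_ge0.
  have H0 : 0 < H by exact: lt_le_trans ltr01 H1.
  have kN : 3 * N <= 3 * N + c by rewrite lerDl ltW.
  have kc : c <= 3 * N + c by rewrite lerDr mulr_ge0// (le_trans _ N1).
  have nfoo : (cL1norm (@dr_haar R L) f < +oo)%E.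
    exact: integrable_lty (integrable_normc fi).
  apply: (filtration_cz_decomposition (@measurable_dr_level R L H H0) (@dr_level_nest R L H H0)
    (@dr_haar_cell_fin R L H H0) (@dr_cell_gen R L H H0) N1 kN alpha0 fi
    (@dr_haar_cell_doubling R L H H0) _ (cz_sets0 _ k0)).
  + move=> x; apply: (@le_trans _ _ (alpha * H)%:E).
      rewrite /H mulrDr mulr1 mulrCA mulfV ?gt_eqF// mulr1 EFinD fineK ?ge0_fin_numE//.
      by rewrite leeDr// lee_fin ltW.
    rewrite EFinM; apply: lee_wpmul2l; first by rewrite lee_fin ltW.
    exact: dr_haar_cell0 H1.
  + by move=> n x; exact: cP kc.
Qed.
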